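(* Let $-\Delta=-\left(\partial_x^2-\frac{1}{\sin(x)\cos(x)}\partial_x+\tan(x)^2\partial_\phi^2\right)$ be the (minus) Laplace-Beltrami operator of the Grushin sphere acting on $L^2(S_+,d\omega)$, where $S_+$ is the open north hemisphere with coordinates $x\in(0,\pi/2)$, $\phi\in[0,2\pi]/\sim$, and $d\omega=\frac1{\tan(x)}\,dx\,d\phi$. Let $N(E)$ be the number of its eigenvalues not exceeding $E$. Then, as $E\to+\infty$, $$N(E)=\frac E4\log(E)+\left(\gamma-\log(2)-\frac12\right)\frac E2+O(\sqrt E),$$ where $\gamma$ is the Euler-Mascheroni constant.
   Context: The Grushin sphere is $\mathbb{S}^2=\{y_1^2+y_2^2+y_3^2=1\}$ with orthonormal frame $Y_1=(-y_3,0,y_1)^T$, $Y_2=(0,-y_3,y_2)^T$; in spherical coordinates $(\cos x\cos\phi,\cos x\sin\phi,\sin x)$ an equivalent frame is $X_1=\partial_x$, $X_2=\tan(x)\,\partial_\phi$, with singular set the equator $\{x=0\}$. The singularity of the coordinates at $x=\pi/2$ is only due to the coordinate system: $S_+=\{y\in\mathbb{S}^2\mid y_3>0\}$ contains the north pole. The operator $\Delta$ with domain $C_c^\infty(S_+)$ is essentially self-adjoint in $L^2(S_+,d\omega)$, and $\Delta$ denotes its self-adjoint closure. Its spectrum is purely discrete. The counting function is $N(E):=\#\{\lambda\in\sigma_{\rm d}(-\Delta)\mid\lambda\le E\}$, eigenvalues being counted with multiplicity. *)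

(* Defs.v *)
From HB Require Import structures.
From mathcomp Require Import all_boot all_order all_algebra.
From mathcomp Require Export complex.
From mathcomp Require Import all_classical all_reals all_analysis.

Set Implicit Arguments.
Unset Strict Implicit.
Unset Printing Implicit Defensive.

Import Order.TTheory GRing.Theory Num.Theory.
Import numFieldNormedType.Exports.

Local Open Scope classical_set_scope.
Local Open Scope ring_scope.
Local Open Scope complex_scope.

Section GrushinSphere.
Context {R : realType}.

(** ** The Hilbert space L^2(S_+, dω)

   S_+ is described by the coordinates (x, φ) in ]0, π/2[ × [0, 2π[: these
   miss only the north pole, which is ω-negligible.  An element of L^2 is
   represented by a function on the coordinate plane, of which only the values
   on [hemi] matter; two representatives at L^2-distance 0 denote the same
   element. *)

Definition hemi : set (measurableTypeR R * measurableTypeR R) :=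
  `]0%R, (pi / 2)%R[%classic `*` `[0%R, (2 * pi)%R[%classic.

Definition omega_integral (f : R * R -> \bar R) : \bar R :=
  (\int[(@lebesgue_measure R \x @lebesgue_measure R)%E]_(p in hemi)
     (f p * ((tan p.1)^-1)%:E))%E.

Definition L2norm (u : R * R -> R[i]) : \bar R :=
  (omega_integral (fun p => (complex.Re (u p) ^+ 2 + complex.Im (u p) ^+ 2)%:E) `^ 2^-1)%E.

Definition inL2 (u : R * R -> R[i]) : Prop :=
  [/\ measurable_fun hemi (fun p => complex.Re (u p)),
      measurable_fun hemi (fun p => complex.Im (u p)) &
      (L2norm u < +oo)%E].

(** ** Smooth functions *)

Definition cderive (v : R * R) (u : R * R -> R[i]) (p : R * R) : R[i] :=
  'D_v (fun q => complex.Re (u q)) p +i* 'D_v (fun q => complex.Im (u q)) p.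

Definition smooth (u : R * R -> R[i]) : Prop :=
  forall (s : seq (R * R)) (p : R * R),
    differentiable (fun q => complex.Re (foldr cderive u s q)) p /\
    differentiable (fun q => complex.Im (foldr cderive u s q)) p.

(** C_c^∞(S_+), pole included, in coordinates.  The projection
   (y_1, y_2, y_3) |-> (y_1, y_2) is a global chart of S_+ onto the open unit
   disc; an element of C_c^∞(S_+) is thus a smooth function [F] with compact
   support in that disc (extended by 0 to the plane), read at
   (cos x cos φ, cos x sin φ).  The pole has to be covered by the chart: the
   smooth functions supported away from it would give an operator with another
   closure. *)
Definition test_function (u : R * R -> R[i]) : Prop :=
  exists F : R * R -> R[i],
    [/\ smooth F,
        exists2 r : R, r < 1 &
          forall y : R * R, r <= y.1 ^+ 2 + y.2 ^+ 2 -> F y = 0 &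
        forall x phi : R, u (x, phi) = F (cos x * cos phi, cos x * sin phi)].

(** ** The operator -Δ *)

Definition d_x : (R * R -> R[i]) -> R * R -> R[i] := cderive (1, 0).
Definition d_phi : (R * R -> R[i]) -> R * R -> R[i] := cderive (0, 1).

Definition grushin_laplacian (u : R * R -> R[i]) (p : R * R) : R[i] :=
  d_x (d_x u) p
  - ((sin p.1 * cos p.1)^-1)%:C * d_x u p
  + (tan p.1 ^+ 2)%:C * d_phi (d_phi u) p.

(** Unbounded operators on L^2 are given by their graphs.  [minus_Delta] is the
   closure of -Δ on C_c^∞(S_+). *)
Definition minus_Delta (u v : R * R -> R[i]) : Prop :=
  [/\ inL2 u, inL2 v &
      exists w : nat -> R * R -> R[i],
        [/\ forall n, test_function (w n),
            L2norm (fun p => w n p - u p) @[n --> \oo] --> 0%E &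
            L2norm (fun p => - grushin_laplacian (w n) p - v p)
              @[n --> \oo] --> 0%E]].

(** ** Spectrum of an operator given by its graph *)

Section Spectrum.
Variable A : (R * R -> R[i]) -> (R * R -> R[i]) -> Prop.

(** [A - z] maps the domain of [A] onto L^2, and is injective with bounded
   inverse. *)
Definition resolvent_set : set R[i] := [set z |
  (forall f, inL2 f -> exists u, A u (fun p => z * u p + f p)) /\
  (exists C : R, forall u v, A u v ->
     (L2norm u <= C%:E * L2norm (fun p => v p - z * u p)%R)%E)].

Definition spectrum : set R[i] := ~` resolvent_set.

Definition eigenspace_of (z : R[i]) : set (R * R -> R[i]) :=
  [set u | A u (fun p => z * u p)].

Definition L2_independent (n : nat) (e : 'I_n -> R * R -> R[i]) : Prop :=
  forall c : 'I_n -> R[i],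
    L2norm (fun p => \sum_(i < n) c i * e i p) = 0%E -> forall i, c i = 0.

(** Complex dimension, in L^2, of the eigenspace: 0 if [z] is not an
   eigenvalue, +oo if the dimension is infinite. *)
Definition multiplicity (z : R[i]) : \bar R :=
  ereal_sup [set (n%:R)%:E | n in [set n : nat |
    exists e : 'I_n -> R * R -> R[i],
      (forall i, eigenspace_of z (e i)) /\ L2_independent e]].

Definition discrete_spectrum : set R[i] := [set z |
  [/\ spectrum z,
      exists2 eps : R, 0 < eps &
        forall z', spectrum z' -> `|z' - z| < eps%:C -> z' = z &
      (0 < multiplicity z < +oo)%E]].

(** In the order of [R[i]], [z <= E%:C] says that [z] is real and at most
   [E]. *)
Definition eigenvalue_counting (E : R) : \bar R :=
  (\esum_(z in discrete_spectrum `&` [set z | (z <= E%:C)%R])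
     multiplicity z)%E.

End Spectrum.

End GrushinSphere.

Definition euler_mascheroni (R : realType) : R :=
  limn (fun n : nat => \sum_(1 <= k < n.+1) (k%:R)^-1 - ln (n%:R : R)).

(* Main.v *)
(** In the chart (y_1, y_2) = (cos x cos phi, cos x sin phi) the operator is
   (1 - |y|^2) times the Euclidean Laplacian of the unit disc, and d omega is
   dy / (1 - |y|^2).  For every harmonic polynomial H = Re, Im (y_1 + i y_2)^k
   and every m there is a polynomial q of degree m such that
   (1 - |y|^2) q(|y|^2) H is an eigenfunction for 4 (m + 1) (m + k + 1).
   These functions are orthogonal by Green's formula and the rotation
   invariance, and complete because their span contains (1 - |y|^2) times every
   polynomial.  They vanish on the equator only to first order; multiplied by
   e h(1 + delta ln(1 - |y|^2)) with h(u) = exp(-1/u), they become test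
   functions, and -Delta of the product picks up an extra term O(delta) supported
   in 1 - |y|^2 > exp(-1/delta), a set of omega-measure O(1/delta): the
   approximation holds in the graph norm.  Hence the closure is
   the diagonal operator in this basis, its spectrum is {4 k | k >= 1}, the
   multiplicity of 4 k is the number of factorizations k = (a + 1) (b + 1), and
   N(E) is the Dirichlet divisor sum at E / 4, which the hyperbola method
   evaluates. *)

From HB Require Import structures.
Require Import Defs.
From mathcomp Require Import all_boot all_order all_algebra.
From mathcomp Require Import all_classical all_reals all_analysis.
From mathcomp Require Import measurable_realfun ring lra zify.
From Stdlib Require Cantor.
Set Implicit Arguments.
Unset Strict Implicit.
Unset Printing Implicit Defensive.
Import Order.TTheory GRing.Theory Num.Theory.
Import numFieldNormedType.Exports.
Local Open Scope classical_set_scope.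
Local Open Scope ring_scope.

(** * Dirichlet divisor sums *)

Section DirichletDivisor.
Context {R : realType}.
Implicit Types (n m K : nat) (x : R).

(** The logarithm in the cutoff is forced. In s = 1 - |y|^2 the measure behaves like ds / s, and an
    eigenfunction is only O(s). A cutoff that switches on between s = eta and s = 2 eta therefore
    creates an extra term of order one on a set whose measure does not shrink with eta. Spreading
    the transition over ln s makes the squared error O(delta^2) times O(1/delta). That the
    polynomials determine an L^2 function is shown by hand: explicit polynomials tend to indicators
    of half-planes, their products give a pi-system of cells, and a Dynkin argument reaches all
    measurable sets. The closure is identified through Fourier coefficients. Green's formula against
    a fixed eigenfunction survives the graph limit. Conversely, truncated expansions are cut off
    with error 1/(j + 1). Since the operator has real coefficients, everything up to the graph is
    done for real functions; complex numbers return for the spectrum. *)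

Let dn n : R := \sum_(1 <= k < n.+1) (k%:R)^-1 - ln (n%:R : R).

Lemma ln_succ_le n : ln (n.+2%:R : R) - ln (n.+1%:R : R) <= (n.+1%:R)^-1.
Proof.
rewrite -ln_div ?posrE//.
have -> : n.+2%:R / n.+1%:R = 1 + (n.+1%:R)^-1 :> R.
  by rewrite -[n.+2]addn1 natrD mulrDl mul1r divff.
by apply: le_ln1Dx; apply: (@lt_trans _ _ 0); rewrite ?invr_gt0// ltrN10.
Qed.

Lemma ln_succ_ge n : (n.+2%:R)^-1 <= ln (n.+2%:R : R) - ln (n.+1%:R : R).
Proof.
rewrite -[leRHS]opprB lerNr -ln_div ?posrE//.
have -> : n.+1%:R / n.+2%:R = 1 + (- (n.+2%:R)^-1) :> R.
  rewrite -[in LHS](addnK 1%N n.+1) natrB// addn1.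
  by rewrite mulrBl mul1r divff.
apply: le_ln1Dx; rewrite ltrN2 invf_lt1//.
by rewrite ltr1n.
Qed.

Lemma dnS n : dn n.+2 = dn n.+1 + (n.+2%:R)^-1 - (ln (n.+2%:R : R) - ln (n.+1%:R : R)).
Proof. rewrite /dn big_nat_recr//=; ring. Qed.

(** [dn] decreases and [dn n - 1/n] increases, with the same limit, so the constant is caught
    between them. Both monotonicities come from ln (1 + x) <= x. *)
Lemma euler_mascheroni_bounds m : (0 < m)%N ->
  ln (m%:R : R) + euler_mascheroni R <= \sum_(1 <= k < m.+1) (k%:R)^-1
  <= ln (m%:R : R) + euler_mascheroni R + m%:R^-1.
Proof.
case: m => // m _.
have dec i j : dn (i + j).+1 <= dn i.+1.
  elim: j => [|j IH]; first by rewrite addn0.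
  rewrite addnS; apply: le_trans IH; rewrite dnS -addrA gerDl subr_le0; exact: ln_succ_ge.
have inc i j : dn i.+1 - i.+1%:R^-1 <= dn (i + j).+1 - (i + j).+1%:R^-1.
  elim: j => [|j IH]; first by rewrite addn0.
  rewrite addnS; apply: (le_trans IH); rewrite dnS.
  have aux (d u v l : R) : l <= u -> d - u <= d + v - l - v by lra.
  exact/aux/ln_succ_le.
(* Shifted by one: [dn 0] involves the default value of [ln 0] and breaks the monotonicity. *)
have c0 : cvgn (fun n => dn n.+1).
  apply: nonincreasing_is_cvgn.
    by move=> i j ij; rewrite -(subnKC ij).
  exists (dn 1 - 1) => _ [n _ <-].
  have := inc 0 n; rewrite invr1 add0n.
  by move=> h; rewrite (le_trans h)// gerBl invr_ge0.
have ec : dn n @[n --> \oo] --> limn (fun n => dn n.+1).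
  by rewrite -(cvg_shiftS dn); exact: c0.
have eE : euler_mascheroni R = limn (fun n => dn n.+1).
  by rewrite /euler_mascheroni; exact: (cvg_lim _ ec).
have h1 : euler_mascheroni R <= dn m.+1.
  rewrite eE; apply: (@limr_le _ _ _ _ _ (fun n => dn n.+1)) => //.
  near=> n; have mn : (m <= n)%N by near: n; exists m.
  by rewrite -(subnKC mn).
have h2 : dn m.+1 - m.+1%:R^-1 <= euler_mascheroni R.
  rewrite eE; apply: (@limr_ge _ _ _ _ _ (fun n => dn n.+1)) => //.
  near=> n; have mn : (m <= n)%N by near: n; exists m.
  apply: le_trans (inc m (n - m)%N) _; rewrite subnKC// lerBlDr lerDl invr_ge0//.
move: h1 h2; rewrite /dn; move: (\sum_(1 <= k < _) _) (ln _) (_^-1) (euler_mascheroni R).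
by clear; move=> a b c d h1 h2; apply/andP; split; lra.
Unshelve. all: by end_near. Qed.

Lemma sum_leq_div K a : (\sum_(b < K) (a.+1 * b.+1 <= K) = K %/ a.+1)%N.
Proof.
have -> : (\sum_(b < K) (a.+1 * b.+1 <= K) = \sum_(0 <= b < K) (b < K %/ a.+1))%N.
  rewrite big_mkord; apply: eq_bigr => b _.
  by rewrite leq_divRL// mulnC.
have aux : forall L q, (q <= L)%N -> (\sum_(0 <= b < L) (b < q) = q)%N.
  move=> L q qL; rewrite (@big_cat_nat _ _ _ q)//= big_nat.
  rewrite (eq_bigr (fun=> 1%N)); last by move=> b /andP[_ ->].
  rewrite -big_nat sum_nat_const_nat subn0 muln1 big_nat big1 ?addn0// => b /andP[h _].
  by rewrite ltnNge h.
by rewrite aux// leq_div.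
Qed.

Lemma sum_bool_lt K m : (m <= K)%N -> (\sum_(b < K) (b < m) = m)%N.
Proof.
move=> mK; rewrite -(big_mkord xpredT (fun b => (b < m)%N : nat)).
rewrite (@big_cat_nat _ _ _ m)//= big_nat.
rewrite (eq_bigr (fun=> 1%N)); last by move=> b /andP[_ ->].
rewrite -big_nat sum_nat_const_nat subn0 muln1 big_nat big1 ?addn0// => b /andP[h _].
by rewrite ltnNge h.
Qed.

(** Lattice points under the hyperbola, that is, the summatory function of the number of divisors.
    The ordinals below K stand for the factors 1, ..., K. *)
Definition divisor_sum K : nat :=
  (\sum_(a < K) \sum_(b < K) (a.+1 * b.+1 <= K))%N.

(** Dirichlet's hyperbola method: m is the integer square root of K. A point under the hyperbola has
    a coordinate at most m, so the two strips of width m cover all of them and overlap exactly in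
    the m by m square. *)
Lemma divisor_sum_hyperbola K m : (m ^ 2 <= K < m.+1 ^ 2)%N ->
  (divisor_sum K + m ^ 2 = 2 * \sum_(a < m) K %/ a.+1)%N.
Proof.
move=> /andP[mK Km].
have mK' : (m <= K)%N by nia.
have S1 : (\sum_(a < m) K %/ a.+1 =
   \sum_(a < K) \sum_(b < K) ((a < m) && (a.+1 * b.+1 <= K)))%N.
  rewrite (big_ord_widen _ (fun a => K %/ a.+1)%N mK') big_mkcond/=.
  apply: eq_bigr => a _; case: ifP => am; first by rewrite -sum_leq_div.
  by rewrite big1.
have S2 : (\sum_(a < m) K %/ a.+1 =
   \sum_(a < K) \sum_(b < K) ((b < m) && (a.+1 * b.+1 <= K)))%N.
  rewrite S1 exchange_big/=; apply: eq_bigr => a _; apply: eq_bigr => b _.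
  by rewrite mulnC.
have S3 : (m ^ 2 = \sum_(a < K) \sum_(b < K) ((a < m) && (b < m)))%N.
  transitivity (\sum_(a < K) (a < m)%N * m)%N.
    by rewrite -big_distrl/= sum_bool_lt.
  apply: eq_bigr => a _; rewrite -[X in (_ * X)%N](sum_bool_lt mK') big_distrr/=.
  by apply: eq_bigr => b _; case: (_ < _)%N; case: (_ < _)%N.
rewrite mul2n -addnn {1}S1 S2 S3 /divisor_sum -!big_split/=.
apply: eq_bigr => a _; rewrite -!big_split/=; apply: eq_bigr => b _.
(* The square lies entirely under the hyperbola, and a point outside both strips lies above it. *)
have lo : (a < m -> b < m -> a.+1 * b.+1 <= K)%N.
  by move=> am bm; apply: leq_trans mK; rewrite -mulnn leq_mul.
have hi : (m <= a -> m <= b -> K < a.+1 * b.+1)%N.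
  by move=> am bm; apply: (leq_trans Km); rewrite -mulnn leq_mul.
case: (ltnP a m) lo hi => am; case: (ltnP b m) => bm lo hi; rewrite ?addn0 ?add0n//=.
- by rewrite lo.
- by rewrite leqNgt hi.
Qed.

(** The variable x is real because it will be E / 4. Exchanging the integer quotients for x / a
    costs O(1) in each of only m <= sqrt x terms, which is why the remainder is a square root. *)
Lemma divisor_sum_asymptotics x K : 1 <= x -> K%:R <= x < K.+1%:R ->
  `|(divisor_sum K)%:R - (x * ln x + (2 * euler_mascheroni R - 1) * x)|
    <= 14 * Num.sqrt x.
Proof.
move=> x1 /andP[Kx xK].
have x0 : 0 < x by lra.
set s := Num.sqrt x.
have s0 : 0 < s by rewrite sqrtr_gt0.
have ss : s ^+ 2 = x by rewrite sqr_sqrtr// ltW.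
have K0 : (0 < K)%N by rewrite -ltnS -(ltr_nat R); exact: le_lt_trans xK.
have [m /andP[mK Km]] : exists m, (m ^ 2 <= K < m.+1 ^ 2)%N.
  have ex0 : exists m, (m ^ 2 <= K)%N by exists 0%N.
  have ub : forall m, (m ^ 2 <= K)%N -> (m <= K)%N by move=> i; nia.
  have [m mK mm] := ex_maxnP ex0 ub.
  exists m; rewrite mK ltnNge/=; apply/negP => /mm; rewrite ltnn//.
have m0 : (0 < m)%N by nia.
have mR0 : 0 < m%:R :> R by rewrite ltr0n.
have ms : m%:R <= s.
  rewrite -(@ler_pXn2r _ 2)// ?nnegrE ?ler0n ?sqrtr_ge0// ss -natrX.
  by rewrite (le_trans _ Kx)// ler_nat.
have sm : s < m%:R + 1.
  rewrite -(@ltr_pXn2r _ 2)// ?nnegrE ?addr_ge0 ?ler0n ?sqrtr_ge0// ss.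
  apply: (lt_le_trans xK); rewrite natr1 -natrX ler_nat//.
have := divisor_sum_hyperbola (introT andP (conj mK Km)).
move/(congr1 (fun n => n%:R : R)); rewrite natrD natrX natrM [in RHS]natr_sum.
set D := (divisor_sum K)%:R => hD.
(* Each quotient differs from x / (a + 1) by at most 1; the bound 2 per term leaves room. *)
have hS : `|\sum_(a < m) (K %/ a.+1)%:R - x * \sum_(1 <= k < m.+1) (k%:R)^-1| <= m%:R *+ 2 :> R.
  rewrite big_add1/= big_mkord mulr_sumr -sumrB.
  apply: (le_trans (ler_norm_sum _ _ _)).
  have -> : m%:R *+ 2 = \sum_(a < m) 2 :> R.
    by rewrite sumr_const card_ord -!mulrnA mulnC.
  apply: ler_sum => a _.
  rewrite ler_norml; apply/andP.
  have a0 : 0 < a.+1%:R :> R by rewrite ltr0n.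
  have e1 : (K %/ a.+1)%:R * a.+1%:R <= x :> R.
    apply: le_trans Kx; rewrite -natrM ler_nat; exact: leq_trunc_div.
  have e2 : x <= (K %/ a.+1)%:R * a.+1%:R + a.+1%:R :> R.
    apply: (le_trans (ltW xK)); rewrite -natrM -natrD ler_nat.
    by rewrite {1}(divn_eq K a.+1) -addnS leq_add2l ltn_mod.
  have e3 : x / a.+1%:R * a.+1%:R = x by rewrite mulfVK// gt_eqF.
  by split; rewrite -(ler_pM2r a0) mulrBl e3; nra.
have /andP[h1 h2] := euler_mascheroni_bounds m0.
set H := \sum_(1 <= k < m.+1) _ in hS h1 h2.
set g := euler_mascheroni R in h1 h2 *.
have lx : ln x = 2 * ln s by rewrite -ss lnXn// mulr_natl.
have l1 : ln (m%:R : R) <= ln s by rewrite ler_ln// posrE.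
(* ln (s / m) <= s / m - 1 <= 1 / m, because s < m + 1. *)
have l2 : ln s <= ln (m%:R : R) + m%:R^-1.
  rewrite -lerBlDl -ln_div ?posrE//.
  have -> : s / m%:R = 1 + (s / m%:R - 1) by ring.
  apply: (@le_trans _ _ (s / m%:R - 1)).
    by apply: le_ln1Dx; rewrite ltrBrDl addrN divr_gt0.
  rewrite -(ler_pM2r mR0) mulrBl mulVf ?gt_eqF// mulfVK ?gt_eqF// mul1r; lra.
have m1 : 1 <= m%:R :> R by rewrite ler1n.
(* The constant 14 is 4 + 4 + 4 + 2, in multiples of s: the quotients ([hS], doubled), the harmonic
   sum (2 x / m), the passage from ln m to ln s (again 2 x / m), and x - m^2. *)
have xm : x * m%:R^-1 <= 2 * s.
  rewrite ler_pdivrMr// -ss; nra.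
have xpos := ltW x0.
have i1 : x * ln m%:R + x * g <= x * H by rewrite -mulrDr ler_wpM2l.
have i2 : x * H <= x * ln m%:R + x * g + x * m%:R^-1.
  by rewrite -!mulrDr ler_wpM2l.
have i3 : x * ln m%:R <= x * ln s by rewrite ler_wpM2l.
have i4 : x * ln s <= x * ln m%:R + x * m%:R^-1 by rewrite -!mulrDr ler_wpM2l.
have q1 : m%:R ^+ 2 <= x by rewrite -ss ler_pXn2r// ?nnegrE ?ler0n ?sqrtr_ge0.
have q2 : x - 2 * s <= m%:R ^+ 2 by rewrite -ss; nra.
move: hS; rewrite ler_norml => /andP[hS1 hS2].
rewrite lx ler_norml; apply/andP; rewrite mulr2n in hS1 hS2.
have xl : x * (2 * ln s) = 2 * (x * ln s) by ring.
rewrite xl; split; lra.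
Qed.

End DirichletDivisor.

(** * Weighted square-integrable functions *)

(** The increments are at most sqrt C / 2^k, hence summable, with tails at most 2 sqrt C / 2^n. The
    squared, weighted form is the one that a convergent series of weighted squares supplies
    pointwise. *)
Lemma rapidly_cauchy_cvg {R : realType} (a : nat -> R) (C : R) : 0 <= C ->
  (forall k, 4 ^+ k * (a k.+1 - a k) ^+ 2 <= C) ->
  cvgn a /\ forall n, (limn a - a n) ^+ 2 <= 4 * C * 4^-1 ^+ n.
Proof.
move=> C0 aC; set s := Num.sqrt C.
have s0 : 0 <= s by rewrite sqrtr_ge0.
pose h n : R := 2^-1 ^+ n.
have hS n : h n.+1 *+ 2 = h n.
  by rewrite /h exprS -mulrnAl -mulr_natr mulVf// mul1r.
have h0 n : 0 <= h n by rewrite exprn_ge0.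
have da k : `|a k.+1 - a k| <= s * h k.
  rewrite -ler_sqr ?nnegrE ?mulr_ge0// real_normK ?num_real// exprMn sqr_sqrtr//.
  have -> : h k ^+ 2 = (4 ^+ k)^-1.
    by rewrite /h -exprVn -exprM mulnC exprM; congr (_ ^+ k); rewrite exprVn -natrX.
  by rewrite ler_pdivlMr ?exprn_gt0// mulrC.
(* Adding or subtracting the remaining tail makes the sequence monotone from either side. *)
pose b n := a n + 2 * s * h n; pose c n := a n - 2 * s * h n.
have bS n : b n.+1 <= b n.
  have := da n; rewrite ler_norml => /andP[_]; rewrite /b -(hS n) mulr2n; nra.
have cS n : c n <= c n.+1.
  have := da n; rewrite ler_norml => /andP[+ _]; rewrite /c -(hS n) mulr2n; nra.
have bmono : nonincreasing_seq b by apply/nonincreasing_seqP.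
have cmono : nondecreasing_seq c by apply/nondecreasing_seqP.
have cb n : c n <= b n by rewrite /c /b lerD2l ge0_cp// mulr_ge0// mulr_ge0.
have bcvg : cvgn b.
  apply: nonincreasing_is_cvgn => //; exists (c 0) => _ [n _ <-].
  by rewrite (le_trans _ (cb n))// cmono.
have hcvg : h n @[n --> \oo] --> 0.
  by apply: cvg_expr; rewrite ger0_norm// invf_lt1// ltr1n.
have acvg : a n @[n --> \oo] --> limn b.
  have -> : a = (fun n => b n - 2 * s * h n) by apply/funext => n; rewrite /b addrK.
  rewrite -[X in _ --> X]subr0 -(mulr0 (2 * s)).
  by apply: cvgB => //; apply: cvgMr.
have la : limn a = limn b by exact: cvg_lim.
split; first by apply/cvg_ex; exists (limn b).
move=> n; rewrite la.
have l1 : limn b <= b n.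
  by apply: limr_le => //; near=> m; apply: bmono; near: m; exists n.
have l2 : c n <= limn b.
  apply: limr_ge => //; near=> m; rewrite (le_trans _ (cb m))//.
  by apply: cmono; near: m; exists n.
have -> : 4 * C * 4^-1 ^+ n = (2 * s * h n) ^+ 2.
  rewrite !exprMn sqr_sqrtr// /h -exprM mulnC exprM [2^-1 ^+ 2]expr2 -invfM -natrM.
  by rewrite -natrX.
have r0 : 0 <= 2 * s * h n by rewrite !mulr_ge0.
rewrite -[(_ - _) ^+ 2]real_normK ?num_real// ler_sqr ?nnegrE// ler_norml.
by move: l1 l2; rewrite /b /c => l1 l2; apply/andP; split; lra.
Unshelve. all: by end_near. Qed.

Section RealIntegrable.
Context d (T : measurableType d) (R : realType) (mu : {measure set T -> \bar R}).
Context (D : set T) (mD : measurable D).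
Implicit Types f g : T -> R.

Lemma integrable_EFinD f g : mu.-integrable D (EFin \o f) ->
  mu.-integrable D (EFin \o g) -> mu.-integrable D (EFin \o (fun x => f x + g x)).
Proof. by move=> If Ig; exact: (integrableD mD If Ig). Qed.

Lemma integrable_EFinZl (c : R) f : mu.-integrable D (EFin \o f) ->
  mu.-integrable D (EFin \o (fun x => c * f x)).
Proof. by move=> If; exact: (integrableZl mD c If). Qed.

End RealIntegrable.

Section WeightedL2.
Context d (T : measurableType d) (R : realType) (mu : {measure set T -> \bar R}).
Context (D : set T) (mD : measurable D) (w : T -> R).
Context (mw : measurable_fun D w) (w_gt0 : forall x, D x -> 0 < w x).
Implicit Types f g h : T -> R.

Definition wsq f : \bar R := (\int[mu]_(x in D) (f x ^+ 2 * w x)%:E)%E.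
Definition wL2 f := measurable_fun D f /\ (wsq f < +oo)%E.
Definition wip f g : R := \int[mu]_(x in D) (f x * g x * w x).

Lemma wsq_measurable f : measurable_fun D f ->
  measurable_fun D (fun x => (f x ^+ 2 * w x)%:E).
Proof.
move=> mf; apply/measurable_EFinP; apply: measurable_funM => //.
exact: measurable_funX.
Qed.

Lemma wsq_ge0 f : (0 <= wsq f)%E.
Proof.
apply: integral_ge0 => x Dx; rewrite lee_fin mulr_ge0 ?sqr_ge0//.
exact/ltW/w_gt0.
Qed.

Lemma wL2_integrable_sq f : wL2 f ->
  mu.-integrable D (EFin \o (fun x => f x ^+ 2 * w x)).
Proof.
move=> [mf sf]; apply/integrableP; split; first exact: wsq_measurable.
rewrite (eq_integral (fun x => (f x ^+ 2 * w x)%:E))// => x; rewrite inE => Dx /=.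
by rewrite ger0_norm// mulr_ge0 ?sqr_ge0//; exact/ltW/w_gt0.
Qed.

Lemma wL2_dominated f g (c : R) : measurable_fun D f -> wL2 g ->
  (forall x, D x -> f x ^+ 2 <= c * g x ^+ 2) -> wL2 f.
Proof.
move=> mf Lg fg; split => //.
have ig : mu.-integrable D (EFin \o (fun x => c * (g x ^+ 2 * w x))).
  by apply: integrable_EFinZl => //; exact: wL2_integrable_sq.
apply: le_lt_trans (integrable_lty mD ig).
apply: ge0_le_integral => //.
- by move=> x Dx; rewrite lee_fin mulr_ge0 ?sqr_ge0//; exact/ltW/w_gt0.
- exact: wsq_measurable.
- exact: (measurable_int mu ig).
- move=> x Dx; rewrite /= lee_fin mulrA ler_wpM2r ?fg//; exact/ltW/w_gt0.
Qed.

Lemma wL2_add f g : wL2 f -> wL2 g -> wL2 (fun x => f x + g x).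
Proof.
move=> Lf Lg; split; first exact: measurable_funD (proj1 Lf) (proj1 Lg).
have ifg : mu.-integrable D (EFin \o (fun x => 2 * (f x ^+ 2 * w x) + 2 * (g x ^+ 2 * w x))).
  by apply: integrable_EFinD => //; apply: integrable_EFinZl => //; exact: wL2_integrable_sq.
apply: le_lt_trans (integrable_lty mD ifg).
apply: ge0_le_integral => //.
- by move=> x Dx; rewrite lee_fin mulr_ge0 ?sqr_ge0//; exact/ltW/w_gt0.
- by apply: wsq_measurable; exact: measurable_funD (proj1 Lf) (proj1 Lg).
- exact: (measurable_int mu ifg).
- move=> x Dx; rewrite /= lee_fin !mulrA -mulrDl ler_wpM2r//; first exact/ltW/w_gt0.
  by have := sqr_ge0 (f x - g x); lra.
Qed.

Lemma wL2_scale a f : wL2 f -> wL2 (fun x => a * f x).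
Proof.
move=> Lf; apply: (@wL2_dominated _ f (a ^+ 2)) => //.
  by apply: measurable_funM => //; exact: (proj1 Lf).
by move=> x _; rewrite exprMn.
Qed.

Lemma wL2_opp f : wL2 f -> wL2 (fun x => - f x).
Proof.
by move=> /(wL2_scale (-1)); under eq_fun do rewrite mulN1r.
Qed.

Lemma wL2_sub f g : wL2 f -> wL2 g -> wL2 (fun x => f x - g x).
Proof. by move=> Lf Lg; exact: wL2_add (wL2_opp Lg). Qed.

Lemma wL2_0 : wL2 (fun=> 0).
Proof.
split; first exact: measurable_cst.
by rewrite /wsq; under eq_integral do rewrite expr0n mul0r; rewrite integral0.
Qed.

Lemma wip_integrable f g : wL2 f -> wL2 g ->
  mu.-integrable D (EFin \o (fun x => f x * g x * w x)).
Proof.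
move=> Lf Lg.
have ifg : mu.-integrable D (EFin \o (fun x => f x ^+ 2 * w x + g x ^+ 2 * w x)).
  by apply: integrable_EFinD => //; exact: wL2_integrable_sq.
apply: le_integrable ifg => //.
  apply/measurable_EFinP; apply: measurable_funM => //.
  exact: measurable_funM (proj1 Lf) (proj1 Lg).
move=> x Dx /=; have wx := ltW (w_gt0 Dx).
rewrite lee_fin -mulrDl !normrM ler_wpM2r//.
rewrite [leRHS]ger0_norm ?addr_ge0 ?sqr_ge0// -normrM ler_norml; apply/andP.
have := sqr_ge0 (f x - g x); have := sqr_ge0 (f x + g x).
have := sqr_ge0 (f x); have := sqr_ge0 (g x).
by split; lra.
Qed.

Lemma wsqE f : wL2 f -> wsq f = (wip f f)%:E.
Proof.
move=> Lf; rewrite /wip /Rintegral fineK.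
  by apply: eq_integral => x _; rewrite expr2.
exact: (integrable_fin_num mD (wip_integrable Lf Lf)).
Qed.

Lemma wipC f g : wip f g = wip g f.
Proof. by rewrite /wip; under eq_Rintegral do rewrite [_ * _ in X in X * _]mulrC. Qed.

Lemma wipDl f g h : wL2 f -> wL2 g -> wL2 h ->
  wip (fun x => f x + g x) h = wip f h + wip g h.
Proof.
move=> Lf Lg Lh; rewrite /wip -RintegralD//; try exact: wip_integrable.
by apply: eq_Rintegral => x _; ring.
Qed.

Lemma wipZl a f h : wL2 f -> wL2 h -> wip (fun x => a * f x) h = a * wip f h.
Proof.
move=> Lf Lh; rewrite /wip -RintegralZl//; last exact: wip_integrable.
by apply: eq_Rintegral => x _; ring.
Qed.

Lemma wipNl f h : wL2 f -> wL2 h -> wip (fun x => - f x) h = - wip f h.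
Proof.
by move=> Lf Lh; rewrite -[RHS]mulN1r -wipZl//; under [in RHS]eq_fun do rewrite mulN1r.
Qed.

Lemma wipBl f g h : wL2 f -> wL2 g -> wL2 h ->
  wip (fun x => f x - g x) h = wip f h - wip g h.
Proof. by move=> Lf Lg Lh; rewrite wipDl ?wipNl//; exact: wL2_opp. Qed.

Lemma wip_ge0 f : 0 <= wip f f.
Proof.
apply: Rintegral_ge0 => x Dx; rewrite mulr_ge0 -?expr2 ?sqr_ge0//.
exact/ltW/w_gt0.
Qed.

Lemma wip_sub_sq f g : wL2 f -> wL2 g ->
  wip (fun x => f x - g x) (fun x => f x - g x) = wip f f - 2 * wip f g + wip g g.
Proof.
move=> Lf Lg; have Lfg := wL2_sub Lf Lg.
rewrite wipBl// (wipC f) (wipC g) !wipBl// (wipC g f); ring.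
Qed.

Lemma wip_cauchy_schwarz f g : wL2 f -> wL2 g ->
  wip f g ^+ 2 <= wip f f * wip g g.
Proof.
move=> Lf Lg.
have q t : 0 <= wip f f - 2 * t * wip f g + t ^+ 2 * wip g g.
  have Lt := wL2_scale t Lg.
  have := wip_ge0 (fun x => f x - t * g x).
  by rewrite wip_sub_sq// wipZl// (wipC f) wipZl// (wipC g f) (wipC g) wipZl// !mulrA.
have g0 := wip_ge0 g; have f0 := wip_ge0 f.
have [ge0|ge0] := eqVneq (wip g g) 0.
  rewrite ge0 mulr0.
  (* For a null g the quadratic is affine in t; if the product were nonzero, this t would give it
     the value -1. *)
  have h := q ((wip f f + 1) / (2 * wip f g)); rewrite ge0 mulr0 addr0 in h.
  have [->|fg0] := eqVneq (wip f g) 0; first by rewrite expr0n.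
  have e : 2 * ((wip f f + 1) / (2 * wip f g)) * wip f g = wip f f + 1 by field.
  rewrite e in h; lra.
have := q (wip f g / wip g g).
have -> : wip f f - 2 * (wip f g / wip g g) * wip f g + (wip f g / wip g g) ^+ 2 * wip g g
  = (wip f f * wip g g - wip f g ^+ 2) / wip g g by field.
by rewrite pmulr_lge0 ?subr_ge0// invr_gt0 lt_neqAle g0 andbT eq_sym.
Qed.

Lemma wip_ext f g h k : (forall x, D x -> f x = g x) -> (forall x, D x -> h x = k x) ->
  wip f h = wip g k.
Proof.
by move=> fg hk; apply: eq_Rintegral => x; rewrite inE => Dx; rewrite fg// hk.
Qed.

Lemma wip_eq0 f : wL2 f -> wip f f = 0 -> forall g, wL2 g -> wip f g = 0.
Proof.
move=> Lf f0 g Lg; apply/eqP; rewrite -sqrf_eq0 eq_le sqr_ge0 andbT.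
by have := wip_cauchy_schwarz Lf Lg; rewrite f0 mul0r.
Qed.

(** The rate 16^-n leaves 4^-n to spare after the weight 4^n that pointwise convergence requires.
    The limit is thus built pointwise, and the error at stage n is controlled by one integrable
    majorant [G]. *)
Lemma riesz_fischer (f : nat -> T -> R) : (forall n, wL2 (f n)) ->
  (forall n, (wsq (fun x => f n.+1 x - f n x)%R <= (16^-1 ^+ n)%:E)%E) ->
  exists2 u, wL2 u & forall n, (wsq (fun x => u x - f n x)%R <= (8 * 4^-1 ^+ n)%:E)%E.
Proof.
move=> Lf fC.
(* The upper limit is measurable whether or not the sequence converges at the point. *)
pose u x := fine (limn_esup (fun n => (f n x)%:E)).
have mu_ : measurable_fun D u.
  apply: (measurableT_comp (@fine_measurable R setT measurableT)) => //.
  apply: measurable_fun_limn_esup => n; apply/measurable_EFinP; exact: (proj1 (Lf n)).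
pose t n x : \bar R := (4 ^+ n * ((f n.+1 x - f n x) ^+ 2 * w x))%:E.
pose G x : \bar R := (\sum_(0 <= n <oo) t n x)%E.
have t0 n x : D x -> (0 <= t n x)%E.
  move=> Dx; rewrite lee_fin; apply: mulr_ge0; first exact: exprn_ge0.
  by rewrite mulr_ge0 ?sqr_ge0// ltW// w_gt0.
have mt n : measurable_fun D (t n).
  apply/measurable_EFinP; apply: measurable_funM => //.
  by apply/measurable_EFinP; apply: wsq_measurable; exact: (proj1 (wL2_sub (Lf n.+1) (Lf n))).
have mG : measurable_fun D G.
  by apply: (@ge0_emeasurable_sum _ _ _ _ t xpredT) => // k x Dx _; exact: t0.
have G0 x : D x -> (0 <= G x)%E by move=> Dx; apply: nneseries_ge0 => n _ _; exact: t0.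
(* 4^i 16^-i = 4^-i <= 2^-i, and these last bounds sum to 2. *)
have iG : (\int[mu]_(x in D) G x <= 2%:E)%E.
  rewrite /G integral_nneseries//.
  apply: (@le_trans _ _ (\sum_(0 <= i <oo) (2 / (2 ^ i.+1)%:R)%:E)%E); last first.
    exact: (@epsilon_trick0 _ 2 xpredT).
  apply: lee_nneseries => [i _ _|i _]; first by apply: integral_ge0 => x Dx; exact: t0.
  under eq_integral do rewrite /t EFinM.
  rewrite ge0_integralZl//; first last.
  - by move=> x Dx; rewrite lee_fin mulr_ge0 ?sqr_ge0//; exact/ltW/w_gt0.
  - by apply: wsq_measurable; exact: (proj1 (wL2_sub (Lf i.+1) (Lf i))).
  apply: (@le_trans _ _ ((4 ^+ i)%:E * (16^-1 ^+ i)%:E)%E).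
    by rewrite lee_pmul2l// ?lte_fin ?exprn_gt0//; exact: fC.
  rewrite -EFinM lee_fin natrX exprS invfM mulrA divff// mul1r -exprVn -exprMn.
  by apply: lerXn2r; rewrite ?nnegrE//; lra.
have bd n x : D x -> (((u x - f n x) ^+ 2 * w x)%:E <= (4 * 4^-1 ^+ n)%:E * G x)%E.
  move=> Dx; have wx := w_gt0 Dx.
  (* Where [G] is infinite the bound is trivial, so it holds everywhere on D and no null set has to
     be removed. *)
  have [Gy|Gfin] := eqVneq (G x) +oo%E.
    by rewrite Gy gt0_muley ?leey// lte_fin mulr_gt0// exprn_gt0.
  have Gf : G x \is a fin_num by rewrite ge0_fin_numE ?G0// ltey.
  set C := fine (G x) / w x.
  have C0 : 0 <= C by rewrite divr_ge0 ?fine_ge0 ?G0// ltW.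
  have [|ca la] := @rapidly_cauchy_cvg _ (fun n => f n x) C C0.
    move=> k; rewrite /C ler_pdivlMr// -lee_fin fineK// -mulrA.
    apply: le_trans (nneseries_lim_ge k.+1 (fun n _ _ => t0 n x Dx)).
    rewrite big_nat_recr//=; apply: leeDr; apply: sume_ge0 => i _; exact: t0.
  have -> : u x = limn (fun n => f n x).
    rewrite /u is_cvg_limn_esupE; last by apply/cvg_ex; exists (limn (fun n => f n x))%:E; apply: cvg_EFin => //; exact: nearW.
    by rewrite (EFin_lim ca).
  rewrite -[G x]fineK// -EFinM lee_fin.
  have -> : 4 * 4^-1 ^+ n * fine (G x) = 4 * C * 4^-1 ^+ n * w x.
    by rewrite /C; field; rewrite gt_eqF.
  by rewrite ler_wpM2r// ltW.
have key n : (wsq (fun x => u x - f n x)%R <= (8 * 4^-1 ^+ n)%:E)%E.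
  apply: (@le_trans _ _ (\int[mu]_(x in D) ((4 * 4^-1 ^+ n)%:E * G x))%E).
    apply: ge0_le_integral => //; last by move=> x; exact: bd.
    - by move=> x Dx; rewrite lee_fin mulr_ge0 ?sqr_ge0//; exact/ltW/w_gt0.
    - by apply: wsq_measurable; apply: measurable_funB => //; exact: (proj1 (Lf n)).
    - by apply: emeasurable_funM => //; exact: measurable_cst.
  rewrite ge0_integralZl// ?lee_fin ?mulr_ge0 ?exprn_ge0//.
  have -> : (8 * 4^-1 ^+ n)%:E = ((4 * 4^-1 ^+ n)%:E * 2%:E)%E :> \bar R.
    by rewrite -EFinM; congr EFin; ring.
  by rewrite lee_pmul2l// lte_fin mulr_gt0// exprn_gt0.
exists u => //.
have L0 : wL2 (fun x => u x - f 0 x).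
  split; first by apply: measurable_funB => //; exact: (proj1 (Lf 0)).
  by apply: le_lt_trans (key 0) _; rewrite ltry.
by have := wL2_add L0 (Lf 0); under eq_fun do rewrite subrK.
Qed.

End WeightedL2.

(** * Orthonormal systems: Bessel, synthesis from square-summable coefficients, Parseval *)

Section OrthonormalBasis.
Context d (T : measurableType d) (R : realType) (mu : {measure set T -> \bar R}).
Context (D : set T) (mD : measurable D) (w : T -> R).
Context (mw : measurable_fun D w) (w_gt0 : forall x, D x -> 0 < w x).
Context (e : nat -> T -> R).

Local Notation wL2 := (wL2 mu D w).
Local Notation wip := (wip mu D w).
Local Notation wsq := (wsq mu D w).

Hypothesis Le : forall n, wL2 (e n).
Hypothesis e_ortho : forall m n, wip (e m) (e n) = (m == n)%:R.

Implicit Types (f g u : T -> R) (c : nat -> R).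

Definition psum c n (x : T) := \sum_(i < n) c i * e i x.

Lemma psumS c n : psum c n.+1 = (fun x => psum c n x + c n * e n x).
Proof. by apply/funext => x; rewrite /psum big_ord_recr. Qed.

Lemma psum0 c : psum c 0 = (fun=> 0).
Proof. by apply/funext => x; rewrite /psum big_ord0. Qed.

Lemma wL2_psum c n : wL2 (psum c n).
Proof.
elim: n => [|n IH]; first by rewrite psum0; exact: wL2_0.
by rewrite psumS; apply: wL2_add => //; exact: wL2_scale.
Qed.

Lemma wip0l f : wip (fun=> 0) f = 0.
Proof.
by rewrite /wip (@eq_Rintegral _ _ _ _ _ (cst 0)) ?Rintegral_cst ?mul0r// => x _; rewrite !mul0r.
Qed.

Lemma wip_psuml c n g : wL2 g -> wip (psum c n) g = \sum_(i < n) c i * wip (e i) g.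
Proof.
move=> Lg; elim: n => [|n IH]; first by rewrite psum0 big_ord0 wip0l.
rewrite psumS big_ord_recr/= -IH wipDl//; first by rewrite wipZl.
- exact: wL2_psum.
- exact: wL2_scale.
Qed.

Lemma wip_psum_e c n m : wip (psum c n) (e m) = if (m < n)%N then c m else 0.
Proof.
rewrite wip_psuml//; case: ifP => mn.
  rewrite (bigD1 (Ordinal mn))//= e_ortho eqxx mulr1 big1 ?addr0// => i im.
  by rewrite e_ortho; case: eqP => [E|]; rewrite ?mulr0//; move/eqP: im; case; exact/val_inj.
rewrite big1// => i _; rewrite e_ortho; case: eqP => [E|]; rewrite ?mulr0//.
by rewrite -E ltn_ord in mn.
Qed.

Lemma wip_psum_psum c n m :
  wip (psum c n) (psum c m) = \sum_(i < minn n m) c i ^+ 2.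
Proof.
wlog nm : n m / (n <= m)%N.
  by move=> H; have /orP[nm|nm] := leq_total n m; [|rewrite wipC minnC]; exact: H.
rewrite (minn_idPl nm) wip_psuml; last exact: wL2_psum.
by apply: eq_bigr => i _; rewrite wipC wip_psum_e (leq_trans (ltn_ord i) nm) expr2.
Qed.

Lemma psum_sub_sq c n m : wip (fun x => psum c n x - psum c m x) (fun x => psum c n x - psum c m x)
  = `|\sum_(i < n) c i ^+ 2 - \sum_(i < m) c i ^+ 2|.
Proof.
rewrite wip_sub_sq//; try exact: wL2_psum.
rewrite !wip_psum_psum !minnn.
have le i j : (i <= j)%N -> \sum_(k < i) c k ^+ 2 <= \sum_(k < j) c k ^+ 2.
  move=> ij; rewrite -!(big_mkord xpredT (fun k => c k ^+ 2)).
  rewrite [leRHS](@big_cat_nat _ _ _ i)//= lerDl sumr_ge0// => k _; exact: sqr_ge0.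
case: (leqP n m) => nm.
  by rewrite ler0_norm ?subr_le0 ?le//; ring.
by rewrite ger0_norm ?subr_ge0 ?le ?(ltnW nm)//; ring.
Qed.

Definition coef u n := wip u (e n).

Lemma bessel_identity u n : wL2 u ->
  wip (fun x => u x - psum (coef u) n x) (fun x => u x - psum (coef u) n x)
  = wip u u - \sum_(i < n) coef u i ^+ 2.
Proof.
move=> Lu; rewrite wip_sub_sq//; last exact: wL2_psum.
rewrite wip_psum_psum minnn wipC wip_psuml//.
under eq_bigr do rewrite wipC -expr2.
by ring.
Qed.

Lemma bessel_inequality u n : wL2 u -> \sum_(i < n) coef u i ^+ 2 <= wip u u.
Proof. by move=> Lu; rewrite -subr_ge0 -bessel_identity//; exact: wip_ge0. Qed.

(** The partial sums are Cauchy, but with no known rate; along a subsequence [N] the tails of the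
    squares fall below 16^-k, which is the rate that [riesz_fischer] asks for. The distance along
    [N] is kept for [parseval]. *)
Lemma basis_synthesis_subseq c M : (forall n, \sum_(i < n) c i ^+ 2 <= M) ->
  exists u, [/\ wL2 u, forall n, coef u n = c n &
    exists N : nat -> nat, forall k,
      wip (fun x => u x - psum c (N k) x) (fun x => u x - psum c (N k) x)
        <= 8 * 4^-1 ^+ k].
Proof.
move=> cM; pose s n := \sum_(i < n) c i ^+ 2.
have smono : nondecreasing_seq s.
  by apply/nondecreasing_seqP => n; rewrite /s big_ord_recr/= lerDl sqr_ge0.
have scvg : cvgn s.
  by apply: nondecreasing_is_cvgn => //; exists M => _ [n _ <-]; exact: cM.
have sle n : s n <= limn s by apply: nondecreasing_cvgn_le.
(* The clause k <= N k puts every fixed index below N k eventually, so that the coefficients pass to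
   the limit. *)
have [N NP] : {N : nat -> nat &
    forall k, (k <= N k)%N /\ limn s - s (N k) <= 16^-1 ^+ k}.
  apply: (@choice _ _ (fun k n => (k <= n)%N /\ limn s - s n <= 16^-1 ^+ k)) => k.
  have e0 : 0 < 16^-1 ^+ k :> R by rewrite exprn_gt0.
  have /cvgrPdist_le/(_ _ e0) := scvg.
  move=> -[n _ nP]; exists (maxn n k); rewrite leq_maxr; split=> //.
  by have /= := nP _ (leq_maxl n k); apply: le_trans; exact: ler_norm.
have LN k := wL2_psum c (N k).
have [|u Lu uN] := @riesz_fischer _ _ _ mu D mD w mw w_gt0 (fun k => psum c (N k)) LN.
  move=> k; rewrite wsqE//; last exact: wL2_sub.
  rewrite lee_fin psum_sub_sq.
  have h1 := (NP k).2; have h2 := (NP k.+1).2.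
  have h3 := sle (N k); have h4 := sle (N k.+1).
  have h5 : 16^-1 ^+ k.+1 <= 16^-1 ^+ k :> R.
    by rewrite exprS ler_piMl ?exprn_ge0//; lra.
  by rewrite ler_norml; apply/andP; split; rewrite -/(s _) -/(s _); lra.
have uN' k : wip (fun x => u x - psum c (N k) x) (fun x => u x - psum c (N k) x)
        <= 8 * 4^-1 ^+ k.
  by rewrite -lee_fin -wsqE//; exact: wL2_sub.
exists u; split => //; last by exists N.
move=> n; apply/eqP; rewrite -subr_eq0 -sqrf_eq0 eq_le sqr_ge0 andbT.
apply/ler_addgt0Pl => eps eps0; rewrite addr0.
have h0 : (fun k => 8 * 4^-1 ^+ k : R) k @[k --> \oo] --> 0.
  rewrite -[X in _ --> X](mulr0 8); apply: cvgMr; apply: cvg_expr.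
  by rewrite ger0_norm// invf_lt1// ltr1n.
have /cvgrPdist_le/(_ _ eps0)[k0 _ k0P] := h0.
set k := maxn k0 n.+1.
have kn : (n < N k)%N by rewrite (leq_trans _ (NP k).1)// leq_maxr.
have -> : coef u n - c n = wip (fun x => u x - psum c (N k) x) (e n).
  by rewrite wipBl// wip_psum_e kn.
apply: le_trans (wip_cauchy_schwarz mD mw w_gt0 _ (Le n)) _; first exact: wL2_sub.
rewrite e_ortho eqxx mulr1 (le_trans (uN' k))//.
have /= := k0P k (leq_maxl _ _); rewrite sub0r normrN; apply: le_trans; exact: ler_norm.
Qed.

Lemma basis_synthesis c M : (forall n, \sum_(i < n) c i ^+ 2 <= M) ->
  exists2 u, wL2 u & forall n, coef u n = c n.
Proof. by move=> /basis_synthesis_subseq[u [Lu uc _]]; exists u. Qed.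

Lemma wip_cvg (f : nat -> T -> R) u g : (forall n, wL2 (f n)) -> wL2 u -> wL2 g ->
  wip (fun x => f n x - u x) (fun x => f n x - u x) @[n --> \oo] --> 0 ->
  wip (f n) g @[n --> \oo] --> wip u g.
Proof.
move=> Lf Lu Lg f0; apply/subr_cvg0.
have h : (wip (f n) g - wip u g) ^+ 2 @[n --> \oo] --> 0.
  apply: (@squeeze_cvgr _ _ _ _ (fun=> 0) (fun n =>
    wip (fun x => f n x - u x) (fun x => f n x - u x) * wip g g)).
  - apply: nearW => n; rewrite sqr_ge0/= -wipBl//.
    by apply: wip_cauchy_schwarz => //; exact: wL2_sub.
  - exact: cvg_cst.
  - by rewrite -[X in _ --> X](mul0r (wip g g)); apply: cvgMl.
apply/norm_cvg0P.
have -> : (fun n => `|wip (f n) g - wip u g|) =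
    Num.sqrt \o (fun n => (wip (f n) g - wip u g) ^+ 2).
  by apply/funext => n /=; rewrite sqrtr_sqr.
by rewrite -[X in _ --> X]sqrtr0; apply: (cvg_comp _ _ h); exact: sqrt_continuous.
Qed.

Hypothesis e_complete : forall g, wL2 g -> (forall n, coef g n = 0) -> wip g g = 0.

(** The function v synthesized from the coefficients of u differs from u by a function orthogonal to
    the basis, hence null. The partial sums approach v along a subsequence, and monotonicity extends
    this to the whole sequence. *)
Lemma parseval u : wL2 u -> \sum_(i < n) coef u i ^+ 2 @[n --> \oo] --> wip u u.
Proof.
move=> Lu; have [v [Lv vc [N vN]]] := basis_synthesis_subseq (fun n => bessel_inequality n Lu).
have uv : wip (fun x => u x - v x) (fun x => u x - v x) = 0.
  apply: e_complete; first exact: wL2_sub.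
  by move=> n; rewrite /coef wipBl// -/(coef u n) -/(coef v n) vc subrr.
have bnd k : wip u u - 8 * 4^-1 ^+ k <= \sum_(i < N k) coef u i ^+ 2.
  rewrite lerBlDr -lerBlDl -bessel_identity// (le_trans _ (vN k))//.
  have L1 := wL2_sub mD mw w_gt0 Lv (wL2_psum (coef u) (N k)).
  have L0 := wL2_sub mD mw w_gt0 Lu Lv.
  have E : (fun x => u x - psum (coef u) (N k) x) =
    (fun x => (u x - v x) - - (v x - psum (coef u) (N k) x)).
    by apply/funext => x; rewrite opprK addrA subrK.
  have L2 := wL2_opp mD mw w_gt0 L1.
  rewrite E wip_sub_sq// uv (wip_eq0 mD mw w_gt0 L0 uv L2).
  rewrite wipNl// (wipC _ _ _ _ (fun x => - _)) wipNl//; lra.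
have smono : nondecreasing_seq (fun n => \sum_(i < n) coef u i ^+ 2).
  by apply/nondecreasing_seqP => n; rewrite big_ord_recr/= lerDl sqr_ge0.
apply/cvgrPdist_le => eps eps0.
have h0 : (fun k => 8 * 4^-1 ^+ k : R) k @[k --> \oo] --> 0.
  rewrite -[X in _ --> X](mulr0 8); apply: cvgMr; apply: cvg_expr.
  by rewrite ger0_norm// invf_lt1// ltr1n.
have /cvgrPdist_le/(_ _ eps0)[k _ kP] := h0.
exists (N k) => // n /= Nn.
have h1 := bnd k; have h2 := smono _ _ Nn; have h3 := bessel_inequality n Lu.
have := kP k (leqnn k); rewrite /= sub0r normrN ger0_norm ?mulr_ge0 ?exprn_ge0// => h4.
rewrite ger0_norm ?subr_ge0//; lra.
Qed.

Lemma basis_expansion u : wL2 u ->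
  wip (fun x => psum (coef u) n x - u x) (fun x => psum (coef u) n x - u x)
    @[n --> \oo] --> 0.
Proof.
move=> Lu; rewrite -(subrr (wip u u)).
under eq_cvg.
  move=> n; rewrite (_ : wip _ _ = wip u u - \sum_(i < n) coef u i ^+ 2).
    over.
  rewrite -bessel_identity//; apply: eq_Rintegral => x _; ring.
by apply: cvgB; [exact: cvg_cst|exact: parseval].
Qed.

End OrthonormalBasis.

(** * Smooth functions on the plane *)

(** Locked, so that the derivation rules rewrite it without exposing the limit behind ['D_v]. *)
HB.lock Definition dd {R : realType} (v : R * R) (f : R * R -> R) (p : R * R) : R :=
  'D_v f p.

Section DirectionalDerivative.
Context {R : realType}.
Implicit Types (f g : R * R -> R) (p v : R * R) (c : R).

Lemma ddE v f p : dd v f p = 'D_v f p.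
Proof. by rewrite dd.unlock. Qed.

Lemma dd_cst v c : dd v (fun=> c) = fun=> 0.
Proof. by apply/funext => p; rewrite ddE; exact: derive_cst. Qed.

Lemma dd_add v f g : (forall p, differentiable f p) -> (forall p, differentiable g p) ->
  dd v (fun p => f p + g p) = fun p => dd v f p + dd v g p.
Proof.
move=> df dg; apply/funext => p; rewrite !ddE; apply: deriveD; exact: diff_derivable.
Qed.

Lemma dd_mul v f g : (forall p, differentiable f p) -> (forall p, differentiable g p) ->
  dd v (fun p => f p * g p) = fun p => f p * dd v g p + g p * dd v f p.
Proof.
move=> df dg; apply/funext => p; rewrite !ddE.
by rewrite (@deriveM _ _ f g)//; exact: diff_derivable.
Qed.

Lemma differentiable_comp1 (h : R -> R) (f : R * R -> R) p (d : R) :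
  is_derive (f p) 1 h d -> differentiable f p -> differentiable (fun q => h (f q)) p.
Proof.
move=> hd df; apply: (@differentiable_comp _ _ _ _ f h) => //.
by apply/derivable1_diffP; case: hd.
Qed.

Let deriveE1 (h : R -> R) (a v : R) : differentiable h a -> 'D_v h a = 'd h a v.
Proof. exact: deriveE. Qed.

Let deriveE2 f p v : differentiable f p -> 'D_v f p = 'd f p v.
Proof. exact: deriveE. Qed.

Let linear1E (L : {linear R -> R^o}) (t : R) : L t = t * L 1.
Proof. by rewrite -[LHS](congr1 L (mulr1 t)) -[t * 1]/(t *: (1 : R^o)) linearZ. Qed.

Let linear2E (L : {linear (R * R)%type -> R^o}) (s t : R) :
  L (s, t) = s * L (1, 0) + t * L (0, 1).
Proof.
have E : (s, t) = s *: ((1, 0) : (R * R)%type) + t *: ((0, 1) : (R * R)%type).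
  by apply/pair_equal_spec; rewrite /= /GRing.scale/= !mulr1 !mulr0 addr0 add0r.
by rewrite [in LHS]E linearD !linearZ.
Qed.

Lemma dd_comp1 v (h : R -> R) (f : R * R -> R) p (d : R) :
  is_derive (f p) 1 h d -> differentiable f p ->
  dd v (fun q => h (f q)) p = d * dd v f p.
Proof.
move=> hd df; rewrite !ddE.
have dh : differentiable h (f p) by apply/derivable1_diffP; case: hd.
have dhf : differentiable (h \o f) p by exact: differentiable_comp.
rewrite (_ : (fun q => h (f q)) = h \o f)// (deriveE _ dhf) (diff_comp df dh)/=.
rewrite -(deriveE _ df); set t := 'D_v f p.
have e : 'd h (f p) 1 = d by rewrite -(deriveE1 1 dh); case: hd.
by rewrite -e mulrC; exact: linear1E.
Qed.

Lemma differentiable_comp2 (F a b : R * R -> R) p :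
  differentiable F (a p, b p) -> differentiable a p -> differentiable b p ->
  differentiable (fun q => F (a q, b q)) p.
Proof.
move=> dF da db; apply: (@differentiable_comp _ _ _ _ (fun q => (a q, b q)) F) => //.
exact: differentiable_pair.
Qed.

Lemma dd_comp2 v (F a b : R * R -> R) p :
  differentiable F (a p, b p) -> differentiable a p -> differentiable b p ->
  dd v (fun q => F (a q, b q)) p =
    dd v a p * dd (1, 0) F (a p, b p) + dd v b p * dd (0, 1) F (a p, b p).
Proof.
move=> dF da db; rewrite !ddE.
have dab : differentiable (fun q => (a q, b q)) p by exact: differentiable_pair.
have dFab : differentiable (F \o (fun q => (a q, b q))) p by exact: differentiable_comp.
rewrite (_ : (fun q => F (a q, b q)) = F \o (fun q => (a q, b q)))//.
rewrite (deriveE _ dFab) (diff_comp dab dF)/= diff_pair//.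
rewrite (deriveE2 v da) (deriveE2 v db) (deriveE2 (1, 0) dF) (deriveE2 (0, 1) dF).
exact: linear2E.
Qed.

Lemma differentiable_fst p : differentiable (fun q : R * R => q.1) p.
Proof. by apply: (@linear_differentiable R (R * R)%type R fst) => q; exact: cvg_fst. Qed.

Lemma differentiable_snd p : differentiable (fun q : R * R => q.2) p.
Proof. by apply: (@linear_differentiable R (R * R)%type R snd) => q; exact: cvg_snd. Qed.

Lemma dd_fst v : dd v (fun q : R * R => q.1) = fun=> v.1.
Proof.
apply/funext => p; rewrite ddE.
rewrite (deriveE v (differentiable_fst p)) (@diff_lin R (R * R)%type R fst)//.
by move=> q; exact: cvg_fst.
Qed.

Lemma dd_snd v : dd v (fun q : R * R => q.2) = fun=> v.2.
Proof.
apply/funext => p; rewrite ddE.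
rewrite (deriveE v (differentiable_snd p)) (@diff_lin R (R * R)%type R snd)//.
by move=> q; exact: cvg_snd.
Qed.

Definition rsmooth f := forall (s : seq (R * R)) p, differentiable (foldr dd f s) p.

(** Each derivative of a product is a sum of products, so induction on the list of directions needs
    a class closed under all of these. If generators are differentiable and their derivatives stay
    in the generated algebra, every member is smooth. *)
Inductive alg (B : (R * R -> R) -> Prop) : (R * R -> R) -> Prop :=
| alg_base f : B f -> alg B f
| alg_cst c : alg B (fun=> c)
| alg_add f g : alg B f -> alg B g -> alg B (fun p => f p + g p)
| alg_mul f g : alg B f -> alg B g -> alg B (fun p => f p * g p).

Lemma rsmooth_coind (C : (R * R -> R) -> Prop) :
  (forall f p, C f -> differentiable f p) -> (forall f v, C f -> C (dd v f)) ->
  forall f, C f -> rsmooth f.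
Proof.
move=> Cd CD f Cf s p; apply: Cd; elim: s => //= v s IH; exact: CD.
Qed.

Lemma alg_differentiable B : (forall f p, B f -> differentiable f p) ->
  forall f p, alg B f -> differentiable f p.
Proof.
move=> Bd f p; elim => {f} [f Bf|c|f g _ df _ dg|f g _ df _ dg].
- exact: Bd.
- exact: differentiable_cst.
- exact: differentiableD.
- exact: differentiableM.
Qed.

Lemma alg_rsmooth B : (forall f p, B f -> differentiable f p) ->
  (forall f v, B f -> alg B (dd v f)) -> forall f, alg B f -> rsmooth f.
Proof.
move=> Bd BD; have Ad := alg_differentiable Bd; apply: rsmooth_coind => //.
move=> f v; elim => {f} [f Bf|c|f g Af IHf Ag IHg|f g Af IHf Ag IHg].
- exact: BD.
- by rewrite dd_cst; exact: alg_cst.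
- by rewrite dd_add; [exact: alg_add| |] => p; exact: Ad.
- rewrite dd_mul; [|by move=> p; exact: Ad..].
  by apply: alg_add; exact: alg_mul.
Qed.

Lemma rsmooth_differentiable f p : rsmooth f -> differentiable f p.
Proof. by move=> /(_ [::] p). Qed.

Lemma rsmooth_dd f v : rsmooth f -> rsmooth (dd v f).
Proof. by move=> sf s p; have := sf (rcons s v) p; rewrite foldr_rcons. Qed.

Lemma alg_rsmoothP f : alg rsmooth f -> rsmooth f.
Proof.
apply: alg_rsmooth => [{}f p /rsmooth_differentiable//|{}f v sf].
exact/alg_base/rsmooth_dd.
Qed.

Lemma rsmooth_cst c : rsmooth (fun=> c).
Proof. exact/alg_rsmoothP/alg_cst. Qed.

Lemma rsmooth_add f g : rsmooth f -> rsmooth g -> rsmooth (fun p => f p + g p).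
Proof. by move=> sf sg; apply: alg_rsmoothP; apply: alg_add; exact: alg_base. Qed.

Lemma rsmooth_mul f g : rsmooth f -> rsmooth g -> rsmooth (fun p => f p * g p).
Proof. by move=> sf sg; apply: alg_rsmoothP; apply: alg_mul; exact: alg_base. Qed.

Lemma rsmooth_scale c f : rsmooth f -> rsmooth (fun p => c * f p).
Proof. by move=> sf; apply: rsmooth_mul => //; exact: rsmooth_cst. Qed.

Lemma rsmooth_opp f : rsmooth f -> rsmooth (fun p => - f p).
Proof. by move=> /(rsmooth_scale (-1)); under eq_fun do rewrite mulN1r. Qed.

Lemma rsmooth_sub f g : rsmooth f -> rsmooth g -> rsmooth (fun p => f p - g p).
Proof. by move=> sf sg; apply: rsmooth_add => //; exact: rsmooth_opp. Qed.

Lemma rsmooth_exp f n : rsmooth f -> rsmooth (fun p => f p ^+ n).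
Proof.
move=> sf; elim: n => [|n IH].
  by under eq_fun do rewrite expr0; exact: rsmooth_cst.
by under eq_fun do rewrite exprS; exact: rsmooth_mul.
Qed.

Lemma rsmooth_sum n (F : nat -> R * R -> R) : (forall i, rsmooth (F i)) ->
  rsmooth (fun p => \sum_(i < n) F i p).
Proof.
move=> sF; elim: n => [|n IH].
  by under eq_fun do rewrite big_ord0; exact: rsmooth_cst.
by under eq_fun do rewrite big_ord_recr/=; exact: rsmooth_add.
Qed.

Lemma rsmooth_fst : rsmooth (fun p => p.1).
Proof.
apply: (@alg_rsmooth (fun f => f = fun p => p.1)); last exact: alg_base.
- by move=> _ p ->; exact: differentiable_fst.
- by move=> _ v ->; rewrite dd_fst; exact: alg_cst.
Qed.

Lemma rsmooth_snd : rsmooth (fun p => p.2).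
Proof.
apply: (@alg_rsmooth (fun f => f = fun p => p.2)); last exact: alg_base.
- by move=> _ p ->; exact: differentiable_snd.
- by move=> _ v ->; rewrite dd_snd; exact: alg_cst.
Qed.

(* A family of one-variable functions whose span is stable under derivation *)
Lemma rsmooth_comp1 (H : (R -> R) -> Prop) f : rsmooth f ->
  (forall h, H h -> exists a b c h1 h2 h3, [/\ H h1, H h2, H h3 &
    forall x : R, is_derive x 1 h (a * h1 x + b * h2 x + c * h3 x)]) ->
  forall h, H h -> rsmooth (fun p => h (f p)).
Proof.
move=> sf HD h Hh.
pose B g := rsmooth g \/ exists2 h, H h & g = (fun p => h (f p)).
have Bd g p : B g -> differentiable g p.
  case=> [/rsmooth_differentiable//|[k Hk ->]].
  have [a [b [c [h1 [h2 [h3 [_ _ _ D]]]]]]] := HD k Hk.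
  by apply: differentiable_comp1 (D _) _; exact: rsmooth_differentiable.
apply: (@alg_rsmooth B) => //; last by apply: alg_base; right; exists h.
move=> g v [sg|[k Hk ->]]; first by apply: alg_base; left; exact: rsmooth_dd.
have [a [b [c [h1 [h2 [h3 [H1 H2 H3 D]]]]]]] := HD k Hk.
have -> : dd v (fun p => k (f p)) = fun p =>
    (a * h1 (f p) + b * h2 (f p) + c * h3 (f p)) * dd v f p.
  apply/funext => p; apply: dd_comp1 => //; exact: rsmooth_differentiable.
have Bh c' h' : H h' -> alg B (fun p => c' * h' (f p)).
  move=> Hh'; apply: (@alg_mul B (fun=> c') (fun p => h' (f p))); first exact: alg_cst.
  by apply: alg_base; right; exists h'.
apply: (@alg_mul B (fun p => a * h1 (f p) + b * h2 (f p) + c * h3 (f p))).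
  apply: (@alg_add B (fun p => a * h1 (f p) + b * h2 (f p))); last exact: Bh.
  by apply: (@alg_add B (fun p => a * h1 (f p))); exact: Bh.
by apply: alg_base; left; exact: rsmooth_dd.
Qed.

Lemma rsmooth_cos_sin f : rsmooth f ->
  rsmooth (fun p => cos (f p)) /\ rsmooth (fun p => sin (f p)).
Proof.
move=> sf; pose H (h : R -> R) := h = cos \/ h = sin.
have HD h : H h -> exists a b c h1 h2 h3, [/\ H h1, H h2, H h3 &
    forall x : R, is_derive x 1 h (a * h1 x + b * h2 x + c * h3 x)].
  move=> [->|->].
    exists (-1), 0, 0, sin, sin, sin; split; [by right..|move=> x].
    by rewrite !mul0r !addr0 mulN1r; exact: is_derive_cos.
  exists 1, 0, 0, cos, cos, cos; split; [by left..|move=> x].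
  by rewrite !mul0r !addr0 mul1r; exact: is_derive_sin.
by split; apply: (rsmooth_comp1 sf HD); [left|right].
Qed.

Lemma rsmooth_comp2 (F a b : R * R -> R) : rsmooth F -> rsmooth a -> rsmooth b ->
  rsmooth (fun p => F (a p, b p)).
Proof.
move=> sF sa sb.
(* The chain rule produces partial derivatives of F composed with (a, b); the generators must
   therefore contain every smooth G composed with (a, b). *)
pose B g := rsmooth g \/ exists2 F, rsmooth F & g = (fun p => F (a p, b p)).
apply: (@alg_rsmooth B); last by apply: alg_base; right; exists F.
  move=> g p [/rsmooth_differentiable//|[G sG ->]].
  by apply: differentiable_comp2; exact: rsmooth_differentiable.
move=> g v [sg|[G sG ->]]; first by apply: alg_base; left; exact: rsmooth_dd.
have -> : dd v (fun p => G (a p, b p)) = (fun p =>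
    dd v a p * dd (1, 0) G (a p, b p) + dd v b p * dd (0, 1) G (a p, b p)).
  by apply/funext => p; apply: dd_comp2; exact: rsmooth_differentiable.
apply: (@alg_add B (fun p => dd v a p * dd (1, 0) G (a p, b p))); apply: alg_mul.
- by apply: alg_base; left; exact: rsmooth_dd.
- by apply: alg_base; right; exists (dd (1, 0) G) => //; exact: rsmooth_dd.
- by apply: alg_base; left; exact: rsmooth_dd.
- by apply: alg_base; right; exists (dd (0, 1) G) => //; exact: rsmooth_dd.
Qed.

Lemma smoothP (u : R * R -> R[i]) :
  smooth u <-> rsmooth (fun p => complex.Re (u p)) /\ rsmooth (fun p => complex.Im (u p)).
Proof.
have E s : (fun p => complex.Re (foldr cderive u s p)) = foldr dd (fun p => complex.Re (u p)) s /\
    (fun p => complex.Im (foldr cderive u s p)) = foldr dd (fun p => complex.Im (u p)) s.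
  elim: s => //= v s [<- <-].
  by split; apply/funext => p; rewrite ddE.
split=> [su|[s1 s2] s p].
  by split=> s p; [rewrite -(E s).1|rewrite -(E s).2]; case: (su s p).
by rewrite (E s).1 (E s).2.
Qed.

End DirectionalDerivative.

Lemma is_derive_pow {R : realType} (f : R -> R) n (x df : R) : is_derive x 1 f df ->
  is_derive x 1 (fun y => f y ^+ n) (n%:R * f x ^+ n.-1 * df).
Proof.
move=> h; have := @is_deriveX _ _ f n x 1 df h.
by rewrite (_ : f ^+ n = fun y => f y ^+ n)// exprfctE.
Qed.

Lemma is_derive_prod {R : realType} (f g : R -> R) (x df dg : R) : is_derive x 1 f df ->
  is_derive x 1 g dg -> is_derive x 1 (fun y => f y * g y) (f x * dg + g x * df).
Proof. by move=> hf hg; exact: (@is_deriveM _ _ f g x 1 df dg hf hg). Qed.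

(** * The flat function exp(-1/u) and the logarithmic cutoff *)

Section FlatFunction.
Context {R : realType}.
Implicit Types (u s : R) (n m : nat).

(** The case n = 0 is the classical flat function; the other powers are there because the family
    must be closed under derivation. *)
Definition hexp n u : R := if 0 < u then u^-1 ^+ n * expR (- u^-1) else 0.

Lemma hexp_ge0 n u : 0 <= hexp n u.
Proof.
rewrite /hexp; case: ifPn => // u0.
by rewrite mulr_ge0 ?expR_ge0// exprn_ge0// invr_ge0 ltW.
Qed.

(** With t = 1/u this is t^n / n! <= exp t. These factorials become the constants of the cutoff
    estimates. *)
Lemma hexp_le_fact n u : hexp n u <= n`!%:R.
Proof.
rewrite /hexp; case: ifPn => // u0.
have t0 : 0 <= u^-1 by rewrite invr_ge0 ltW.
rewrite expRN ler_pdivrMr ?expR_gt0//.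
case: n => [|n].
  by rewrite expr0 fact0 mul1r; have := expR_ge1Dx u^-1; lra.
have := expR_ge1Dxn n t0.
rewrite -ler_pdivrMl ?ltr0n ?fact_gt0// mulrC; lra.
Qed.

Lemma hexp_sq n u : hexp n u = u ^+ 2 * hexp n.+2 u.
Proof.
rewrite /hexp; case: ifPn => [u0|]; last by rewrite mulr0.
by rewrite !exprS; field; rewrite gt_eqF.
Qed.

(** Away from 0 this is calculus. At 0, [hexp_sq] rewrites the difference quotient as h times a
    bounded function, so the derivative is 0. *)
Lemma is_derive_hexp n u : is_derive u 1 (hexp n) (- n%:R * hexp n.+1 u + hexp n.+2 u).
Proof.
have [u0|u0|u0] := ltgtP 0 u.
- pose f (x : R) := x^-1 ^+ n * expR (- x^-1).
  have df : is_derive u 1 f (- n%:R * hexp n.+1 u + hexp n.+2 u).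
    have un0 : u != 0 by rewrite gt_eqF.
    have di : is_derive u 1 (fun x : R => x^-1) (- u ^- 2 *: 1).
      by apply: (@is_deriveV _ (@id R)) => //; exact: is_derive_id.
    have dn := is_derive_pow n di.
    have dm : is_derive u 1 (fun x : R => - x^-1) (- (- u ^- 2 *: 1)).
      exact: (@is_deriveN _ _ _ _ _ _ _ di).
    have de : is_derive u 1 (fun x : R => expR (- x^-1)) (expR (- u^-1) * (- (- u ^- 2 *: 1))).
      exact: (@is_derive1_comp _ expR (fun x => - x^-1)).
    have dp := is_derive_prod dn de.
    apply: (is_derive_eq dp).
    rewrite /hexp u0 /GRing.scale/= mulr1.
    move: (expR _) {f dn dp de} => E; rewrite -exprVn; case: n => [|n] /=.
      by rewrite !mul0r mulr0 oppr0 mul0r; ring.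
    by rewrite !exprS; ring.
  apply: near_eq_is_derive df.
  near=> x; rewrite /hexp /f; have -> : 0 < x by near: x; exact: lt_nbhsr.
  by [].
- have df : is_derive u 1 (fun=> 0 : R) (- n%:R * hexp n.+1 u + hexp n.+2 u).
    by rewrite /hexp (lt_gtF u0) mulr0 addr0; exact: is_derive_cst.
  apply: near_eq_is_derive df.
  near=> x; rewrite /hexp; have -> // : (0 < x) = false.
  by apply/negbTE; rewrite -leNgt ltW//; near: x; exact: lt_nbhsl.
- subst u.
  have E0 k : hexp k 0 = 0 by rewrite /hexp ltxx.
  rewrite !E0 mulr0 addr0.
  have lim0 : (fun h : R => h^-1 *: (hexp n (h + 0) - hexp n 0)) @ 0^' --> (0 : R).
    apply/cvgrPdist_le => eps eps0.
    have fg : 0 < (n.+2)`!%:R :> R by rewrite ltr0n fact_gt0.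
    near=> h; rewrite sub0r normrN E0 subr0 addr0 hexp_sq /GRing.scale/=.
    have h0 : h != 0 by near: h; exact: nbhs_dnbhs_neq.
    have -> : h^-1 * (h ^+ 2 * hexp n.+2 h) = h * hexp n.+2 h by field.
    rewrite normrM (ger0_norm (hexp_ge0 _ _)).
    apply: (@le_trans _ _ (`|h| * (n.+2)`!%:R)); first by rewrite ler_wpM2l// hexp_le_fact.
    rewrite -ler_pdivlMr//; near: h; apply: dnbhs0_le; exact: divr_gt0.
  have H : derivable (hexp n) 0 1.
    rewrite /derivable; apply/cvg_ex; exists 0.
    by under eq_fun do rewrite /GRing.scale/= mulr1; exact: lim0.
  apply: DeriveDef => //; rewrite /derive.
  apply/cvg_lim => //.
  by under eq_fun do rewrite /GRing.scale/= mulr1; exact: lim0.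
Unshelve. all: by end_near. Qed.

Variables (delta : R) (delta0 : 0 < delta).

(* Depends on ln s only: s d/ds costs a factor delta. *)
Definition lcut n m s : R := if 0 < s then s^-1 ^+ m * hexp n (1 + delta * ln s) else 0.

(** At this threshold 1 + delta ln s reaches 0; its positivity is what makes the supports compact in
    the open disc. *)
Lemma lcut_eq0 n m s : s <= expR (- delta^-1) -> lcut n m s = 0.
Proof.
rewrite /lcut; case: ifPn => // s0 sd; rewrite /hexp ifF ?mulr0//.
apply/negbTE; rewrite -leNgt.
have : ln s <= - delta^-1 by rewrite -[leRHS]expRK ler_ln ?posrE ?expR_gt0.
by rewrite -(ler_pM2l delta0) mulrN divff ?gt_eqF//; lra.
Qed.

Lemma lcut_bound n m s : 0 <= s ^+ m * lcut n m s <= n`!%:R.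
Proof.
rewrite /lcut; case: ifPn => s0; last by rewrite mulr0 lexx ler0n.
by rewrite mulrA -exprMn divff ?gt_eqF// expr1n mul1r hexp_ge0 hexp_le_fact.
Qed.

Lemma is_derive_lcut n m s : is_derive s 1 (lcut n m)
  (- m%:R * lcut n m.+1 s + (- delta * n%:R) * lcut n.+1 m.+1 s + delta * lcut n.+2 m.+1 s).
Proof.
have [s0|s0] := ltP 0 s; last first.
  have df : is_derive s 1 (fun=> 0 : R) (- m%:R * lcut n m.+1 s +
      (- delta * n%:R) * lcut n.+1 m.+1 s + delta * lcut n.+2 m.+1 s).
    by rewrite /lcut ltNge s0/= !mulr0 !addr0; exact: is_derive_cst.
  (* The two branches meet without harm at 0: the function already vanishes up to exp(-1/delta) > 0,
     hence on a neighbourhood of s. *)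
  apply: near_eq_is_derive df; near=> x; rewrite lcut_eq0// ltW//.
  near: x; apply: lt_nbhsl; apply: (le_lt_trans s0); exact: expR_gt0.
have sn0 : s != 0 by rewrite gt_eqF.
pose f (x : R) := x^-1 ^+ m * hexp n (1 + delta * ln x).
have df : is_derive s 1 f (- m%:R * lcut n m.+1 s + (- delta * n%:R) * lcut n.+1 m.+1 s
    + delta * lcut n.+2 m.+1 s).
  have di : is_derive s 1 (fun x : R => x^-1) (- s ^- 2 *: 1).
    by apply: (@is_deriveV _ (@id R)) => //; exact: is_derive_id.
  have dn := is_derive_pow m di.
  have dl : is_derive s 1 (fun x : R => 1 + delta * ln x) (0 + delta *: s^-1).
    apply: (@is_deriveD R R R (fun=> 1) (fun x => delta * ln x)).
    by apply: (@is_deriveZ R R R (@ln R) delta); exact: is_derive1_ln.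
  have dh : is_derive s 1 (fun x : R => hexp n (1 + delta * ln x))
      ((- n%:R * hexp n.+1 (1 + delta * ln s) + hexp n.+2 (1 + delta * ln s)) * (0 + delta *: s^-1)).
    by apply: (@is_derive1_comp _ (hexp n) (fun x => 1 + delta * ln x)) => //; exact: is_derive_hexp.
  have dp := is_derive_prod dn dh.
  apply: (is_derive_eq dp).
  rewrite /lcut s0 /GRing.scale/= mulr1.
  move: (hexp n _) (hexp n.+1 _) (hexp n.+2 _) {f dn dp dh} => E E' E''.
  rewrite -exprVn; case: m => [|m] /=.
    by rewrite !mul0r mulr0 oppr0 mul0r; ring.
  by rewrite !exprS; ring.
apply: near_eq_is_derive df.
near=> x; rewrite /lcut /f; have -> // : 0 < x by near: x; exact: lt_nbhsr.
Unshelve. all: by end_near. Qed.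

End FlatFunction.

(** * Eigenfunctions in the disc *)

Section DiscEigenfunctions.
Context {R : realType}.
Implicit Types (f g : R * R -> R) (p v : R * R) (k m i : nat) (b : bool).

Definition lap f p : R := dd (1, 0) (dd (1, 0) f) p + dd (0, 1) (dd (0, 1) f) p.

Definition euler f p : R := p.1 * dd (1, 0) f p + p.2 * dd (0, 1) f p.

(** The squared radius, so that smooth functions of it remain smooth at the centre, which is the
    pole. *)
Definition rho p : R := p.1 ^+ 2 + p.2 ^+ 2.

Lemma rho_ge0 p : 0 <= rho p.
Proof. by rewrite addr_ge0 ?sqr_ge0. Qed.

Lemma rsmooth_rho : rsmooth rho.
Proof.
by apply: rsmooth_add; apply: rsmooth_exp; [exact: rsmooth_fst|exact: rsmooth_snd].
Qed.

Lemma dd_rho v : dd v rho = fun p => 2 * (v.1 * p.1 + v.2 * p.2).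
Proof.
have -> : rho = fun p => p.1 * p.1 + p.2 * p.2 by [].
rewrite dd_add; first last.
- by move=> p; apply: differentiableM; exact: differentiable_snd.
- by move=> p; apply: differentiableM; exact: differentiable_fst.
rewrite (@dd_mul _ v (fun p => p.1) (fun p => p.1)); [|exact: differentiable_fst..].
rewrite (@dd_mul _ v (fun p => p.2) (fun p => p.2)); [|exact: differentiable_snd..].
by rewrite dd_fst dd_snd; apply/funext => p; ring.
Qed.

Lemma dd_dd_rho v : dd v (dd v rho) = fun=> 2 * (v.1 ^+ 2 + v.2 ^+ 2).
Proof.
have d1 (a : R) p : differentiable (fun q : R * R => a * q.1) p.
  by apply: differentiableM; [exact: differentiable_cst|exact: differentiable_fst].
have d2 (a : R) p : differentiable (fun q : R * R => a * q.2) p.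
  by apply: differentiableM; [exact: differentiable_cst|exact: differentiable_snd].
rewrite dd_rho (_ : (fun p => _) = fun p => (2 * v.1) * p.1 + (2 * v.2) * p.2); last first.
  by apply/funext => p; ring.
rewrite dd_add//.
rewrite (@dd_mul _ v (fun=> 2 * v.1) (fun p => p.1)); first last.
- exact: differentiable_fst.
- by move=> p; exact: differentiable_cst.
rewrite (@dd_mul _ v (fun=> 2 * v.2) (fun p => p.2)); first last.
- exact: differentiable_snd.
- by move=> p; exact: differentiable_cst.
by rewrite !dd_cst dd_fst dd_snd; apply/funext => p; ring.
Qed.

Section RadialProduct.
Variables (h h1 h2 : R -> R).
Hypothesis hD : forall x : R, is_derive x 1 h (h1 x).
Hypothesis h1D : forall x : R, is_derive x 1 h1 (h2 x).

Lemma dd_radial_mul v f : rsmooth f -> dd v (fun p => h (rho p) * f p) =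
  fun p => h (rho p) * dd v f p + f p * (h1 (rho p) * dd v rho p).
Proof.
move=> sf; have dr p := rsmooth_differentiable p rsmooth_rho.
rewrite dd_mul; first last.
- by move=> p; exact: rsmooth_differentiable.
- by move=> p; exact: differentiable_comp1.
by apply/funext => p; rewrite (dd_comp1 _ (hD _)).
Qed.

Lemma dd_dd_radial_mul v f : rsmooth f -> dd v (dd v (fun p => h (rho p) * f p)) =
  fun p => h (rho p) * dd v (dd v f) p + 2 * h1 (rho p) * dd v rho p * dd v f p
    + (h2 (rho p) * dd v rho p ^+ 2 + h1 (rho p) * dd v (dd v rho) p) * f p.
Proof.
move=> sf; have dr p := rsmooth_differentiable p rsmooth_rho.
have drr p : differentiable (dd v rho) p.
  exact/rsmooth_differentiable/rsmooth_dd/rsmooth_rho.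
have df p := rsmooth_differentiable p sf.
have dvf p := rsmooth_differentiable p (rsmooth_dd v sf).
have dh p : differentiable (fun q => h (rho q)) p by exact: differentiable_comp1.
have dh1 p : differentiable (fun q => h1 (rho q)) p by exact: differentiable_comp1.
have dh1r p : differentiable (fun q => h1 (rho q) * dd v rho q) p by exact: differentiableM.
rewrite dd_radial_mul// dd_add; first last.
- by move=> p; exact: differentiableM.
- by move=> p; exact: differentiableM.
rewrite (@dd_mul _ v (fun p => h (rho p)) (dd v f))//.
rewrite (@dd_mul _ v f (fun p => h1 (rho p) * dd v rho p))//.
rewrite (@dd_mul _ v (fun p => h1 (rho p)) (dd v rho))//.
apply/funext => p; rewrite (dd_comp1 _ (hD _))// (dd_comp1 _ (h1D _))//.
by ring.
Qed.

(** In the plane |grad rho|^2 = 4 rho and the Laplacian of rho is 4; the cross term 2 grad h(rho) .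
    grad f is 4 h' times the Euler field of f. *)
Lemma lap_radial_mul f p : rsmooth f -> lap (fun q => h (rho q) * f q) p =
  h (rho p) * lap f p + 4 * h1 (rho p) * euler f p
    + (4 * rho p * h2 (rho p) + 4 * h1 (rho p)) * f p.
Proof.
move=> sf; rewrite /lap !dd_dd_radial_mul// !dd_dd_rho !dd_rho /euler /rho/=.
by ring.
Qed.

End RadialProduct.

Fixpoint zpow k p : R * R :=
  if k is k'.+1 then
    (p.1 * (zpow k' p).1 - p.2 * (zpow k' p).2, p.1 * (zpow k' p).2 + p.2 * (zpow k' p).1)
  else (1, 0).

(* Real and imaginary part of (y_1 + i y_2) ^ k *)
Definition zharm b k p : R := if b then (zpow k p).2 else (zpow k p).1.

Lemma zharm0 b : zharm b 0 = fun=> (~~ b)%:R.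
Proof. by case: b. Qed.

Lemma zharmS b k : zharm b k.+1 =
  fun p => p.1 * zharm b k p + (-1) ^+ (~~ b) * (p.2 * zharm (~~ b) k p).
Proof. by apply/funext => p; case: b; rewrite /zharm /=; ring. Qed.

Lemma rsmooth_zharm b k : rsmooth (zharm b k).
Proof.
elim: k b => [|k IH] b; first by rewrite zharm0; exact: rsmooth_cst.
rewrite zharmS; apply: rsmooth_add; last apply: rsmooth_scale.
  by apply: rsmooth_mul => //; exact: rsmooth_fst.
by apply: rsmooth_mul => //; exact: rsmooth_snd.
Qed.

(** The complex derivative (k + 1) (v_1 + i v_2) z^k, split into parts: multiplication by i
    exchanges real and imaginary part, with a sign carried by (-1)^(~~ b). *)
Lemma dd_zharmS v b k : dd v (zharm b k.+1) =
  fun p => k.+1%:R * (v.1 * zharm b k p + (-1) ^+ (~~ b) * v.2 * zharm (~~ b) k p).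
Proof.
have dz b' k' p := rsmooth_differentiable p (rsmooth_zharm b' k').
have D b' k' : dd v (zharm b' k'.+1) = fun p =>
    p.1 * dd v (zharm b' k') p + zharm b' k' p * v.1
    + (-1) ^+ (~~ b') * (p.2 * dd v (zharm (~~ b') k') p + zharm (~~ b') k' p * v.2).
  have d1 p : differentiable (fun q : R * R => q.1 * zharm b' k' q) p.
    by apply: differentiableM => //; exact: differentiable_fst.
  have d2 p : differentiable (fun q : R * R => q.2 * zharm (~~ b') k' q) p.
    by apply: differentiableM => //; exact: differentiable_snd.
  rewrite zharmS dd_add//; last first.
    by move=> p; apply: differentiableM => //; exact: differentiable_cst.
  rewrite (@dd_mul _ v (fun p => p.1) (zharm b' k'))//; last exact: differentiable_fst.
  rewrite (@dd_mul _ v (fun=> (-1) ^+ (~~ b')) (fun q => q.2 * zharm (~~ b') k' q))//.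
  rewrite (@dd_mul _ v (fun p => p.2) (zharm (~~ b') k'))//; last exact: differentiable_snd.
  by rewrite dd_fst dd_snd dd_cst; apply/funext => p; ring.
elim: k b => [|k IH] b.
  by rewrite D !zharm0 !dd_cst; apply/funext => p; case: b => /=; ring.
rewrite D !IH negbK; apply/funext => p; rewrite !zharmS negbK -[k.+2%:R](@natr1 R k.+1).
by case: b => /=; rewrite ?expr0 ?expr1; ring.
Qed.

Lemma euler_zharm b k p : euler (zharm b k) p = k%:R * zharm b k p.
Proof.
case: k => [|k]; first by rewrite /euler zharm0 !dd_cst; ring.
by rewrite /euler !dd_zharmS zharmS/=; ring.
Qed.

(** Deriving twice along i instead of along 1 multiplies z^k by i^2 = -1, so the two second
    derivatives cancel. *)
Lemma lap_zharm b k p : lap (zharm b k) p = 0.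
Proof.
have dscale (c : R) v f : rsmooth f -> dd v (fun p => c * f p) = fun p => c * dd v f p.
  move=> sf; rewrite (@dd_mul _ v (fun=> c) f); first last.
  - by move=> q; exact: rsmooth_differentiable.
  - by move=> q; exact: differentiable_cst.
  by rewrite dd_cst; apply/funext => q; rewrite mulr0 addr0.
have d1 b' k' : dd (1, 0) (zharm b' k'.+1) = fun p => k'.+1%:R * zharm b' k' p.
  by rewrite dd_zharmS; apply/funext => q /=; ring.
have d2 b' k' : dd (0, 1) (zharm b' k'.+1) =
    fun p => (k'.+1%:R * (-1) ^+ (~~ b')) * zharm (~~ b') k' p.
  by rewrite dd_zharmS; apply/funext => q /=; ring.
rewrite /lap; case: k => [|k]; first by rewrite !zharm0 !dd_cst addr0.
rewrite d1 d2 !dscale; try exact: rsmooth_zharm.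
case: k => [|k]; first by rewrite !zharm0 !dd_cst !mulr0 addr0.
by rewrite d1 d2 negbK; case: b => /=; rewrite ?expr0 ?expr1; ring.
Qed.

Definition radial (q : {poly R}) b k p : R := q.[rho p] * zharm b k p.

Lemma rsmooth_horner (q : {poly R}) f : rsmooth f -> rsmooth (fun p => q.[f p]).
Proof.
move=> sf; pose H (h : R -> R) := exists q : {poly R}, h = horner q.
apply: (@rsmooth_comp1 _ H f sf); last by exists q.
move=> _ [r ->]; exists 1, 0, 0, (horner r^`()), (horner r), (horner r).
split; [by exists r^`()|by exists r|by exists r|move=> x].
by rewrite !mul0r !addr0 mul1r; exact: is_derive_poly.
Qed.

Lemma rsmooth_radial q b k : rsmooth (radial q b k).
Proof.
apply: rsmooth_mul; last exact: rsmooth_zharm.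
exact/rsmooth_horner/rsmooth_rho.
Qed.

Lemma lap_radial q b k : lap (radial q b k) =
  radial (4%:P * 'X * q^`()^`() + (4 * k.+1%:R)%:P * q^`()) b k.
Proof.
apply/funext => p; rewrite /radial.
rewrite (@lap_radial_mul (horner q) (horner q^`()) (horner q^`()^`())).
- rewrite lap_zharm euler_zharm !(hornerD, hornerM, hornerC, hornerX) -natr1; ring.
- exact: rsmooth_zharm.
Qed.

Definition eigval k m : R := 4 * (m.+1%:R * (m.+1 + k)%:R).

Lemma eigval_gt0 k m : 0 < eigval k m.
Proof. by rewrite !mulr_gt0// ltr0n. Qed.

(* The coefficients solve the two-term recursion coming from the action of the
   Laplacian on (1 - rho) rho ^ i H, H harmonic homogeneous of degree k. *)
Definition eigcoef k m i : R := \prod_(j < i) (1 - eigval k m / eigval k j).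

Definition eigpoly k m : {poly R} := \poly_(i < m.+1) eigcoef k m i.

(** Truncation loses nothing: beyond degree m the product contains the factor j = m, which is 0. The
    recursion therefore holds at every index, the last one included. *)
Lemma coef_eigpoly k m i : (eigpoly k m)`_i = eigcoef k m i.
Proof.
rewrite coef_poly ltnS; case: leqP => // mi.
rewrite /eigcoef (bigD1 (Ordinal mi))//= divff ?subrr ?mul0r//.
by rewrite gt_eqF// eigval_gt0.
Qed.

(** At X^i the left side is 4 (i + 1) (i + k + 1) = [eigval k i] times the coefficient of r at i +
    1, which is c_(i+1) - c_i. The recursion for c was chosen to turn this into - [eigval k m]
    c_i. *)
Lemma eigpoly_eq k m (r := (1 - 'X) * eigpoly k m) :
  4%:P * 'X * r^`()^`() + (4 * k.+1%:R)%:P * r^`() = - (eigval k m)%:P * eigpoly k m.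
Proof.
apply/polyP => i; rewrite {}/r coefD -mulrA !coefCM coefXM -rmorphN coefCM.
have e j : ((1 - 'X) * eigpoly k m)`_j.+1 = eigcoef k m j.+1 - eigcoef k m j.
  by rewrite mulrBl mul1r coefB coefXM/= !coef_eigpoly.
have -> : (if i == 0%N then 0 else ((1 - 'X) * eigpoly k m)^`()^`()`_i.-1)
   = ((1 - 'X) * eigpoly k m)`_i.+1 *+ i.+1 *+ i.
  by case: i => [|i]/=; rewrite ?mulr0n// !coef_deriv.
rewrite coef_deriv e coef_eigpoly.
have -> : eigcoef k m i.+1 = eigcoef k m i * (1 - eigval k m / eigval k i).
  by rewrite /eigcoef big_ord_recr.
have := eigval_gt0 k i; set E := eigval k m; set c := eigcoef k m i; set F := eigval k i.
move=> F0; have Fn0 : F != 0 by rewrite gt_eqF.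
have -> : c * (1 - E / F) - c = - (c * E) / F by ring.
transitivity (- (c * E) / F * F); last by rewrite mulfVK// mulNr mulrC.
rewrite -(mulr_natr _ i) -!(mulr_natr (- (c * E) / F) i.+1).
have -> : - (c * E) / F * F = - (c * E) / F * (4 * (i.+1%:R * (i.+1 + k)%:R)) by [].
move: (- (c * E) / F) => t; rewrite natrD.
rewrite -[k.+1]addn1 -[i.+1]addn1 !natrD; ring.
Qed.

Definition efun b k m : R * R -> R := radial ((1 - 'X) * eigpoly k m) b k.

Lemma efunE b k m p : efun b k m p = (1 - rho p) * radial (eigpoly k m) b k p.
Proof. by rewrite /efun /radial hornerM !(hornerD, hornerN, hornerC, hornerX) mulrA. Qed.

Lemma rsmooth_efun b k m : rsmooth (efun b k m).
Proof. exact: rsmooth_radial. Qed.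

Lemma lap_efun b k m p : (1 - rho p) * lap (efun b k m) p = - eigval k m * efun b k m p.
Proof.
rewrite /efun lap_radial eigpoly_eq -/(efun b k m) efunE /radial hornerM hornerN hornerC.
by ring.
Qed.

End DiscEigenfunctions.

(** * Pulling functions and vector fields back from the disc to the coordinates (x, phi) *)

Section PolarCoordinates.
Context {R : realType}.
Implicit Types (F H f g : R * R -> R) (p v : R * R).

(** Differentiability and derivative travel together, so that a derivative can be left as an
    existential variable and be computed by following the syntax of f. *)
Definition isdd v f g := (forall p, differentiable f p) /\ dd v f = g.

Lemma isdd_cst v (c : R) : isdd v (fun=> c) (fun=> 0).
Proof. by split; [move=> p; exact: differentiable_cst|rewrite dd_cst]. Qed.

Lemma isdd_add v f f' g g' : isdd v f f' -> isdd v g g' ->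
  isdd v (fun p => f p + g p) (fun p => f' p + g' p).
Proof.
move=> [df <-] [dg <-]; split; last by rewrite dd_add.
by move=> p; exact: differentiableD.
Qed.

Lemma isdd_mul v f f' g g' : isdd v f f' -> isdd v g g' ->
  isdd v (fun p => f p * g p) (fun p => f p * g' p + g p * f' p).
Proof.
move=> [df <-] [dg <-]; split; last by rewrite dd_mul.
by move=> p; exact: differentiableM.
Qed.

Lemma isdd_opp v f f' : isdd v f f' -> isdd v (fun p => - f p) (fun p => - f' p).
Proof.
move=> /(isdd_mul (isdd_cst v (-1))).
rewrite (_ : (fun p => -1 * f p) = fun p => - f p); last by apply/funext => p; rewrite mulN1r.
by rewrite (_ : (fun p => _ + _) = fun p => - f' p)//; apply/funext => p; rewrite mulN1r mulr0 addr0.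
Qed.

Lemma isdd_rsmooth v f : rsmooth f -> isdd v f (dd v f).
Proof. by move=> sf; split => // p; exact: rsmooth_differentiable. Qed.

Definition cosx p : R := cos p.1.
Definition sinx p : R := sin p.1.
Definition cosphi p : R := cos p.2.
Definition sinphi p : R := sin p.2.

Let ddc1 v (h h' : R -> R) (a : R * R -> R) (va : R) : (forall x : R, is_derive x 1 h (h' x)) ->
  (forall p, differentiable a p) -> dd v a = (fun=> va) ->
  isdd v (fun p => h (a p)) (fun p => h' (a p) * va).
Proof.
move=> hD da vaE; split; first by move=> p; exact: differentiable_comp1.
by apply/funext => p; rewrite (dd_comp1 _ (hD _))// vaE.
Qed.

Lemma isdd_cosx v : isdd v cosx (fun p => - sinx p * v.1).
Proof. exact: (ddc1 (@is_derive_cos R) differentiable_fst (dd_fst v)). Qed.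

Lemma isdd_sinx v : isdd v sinx (fun p => cosx p * v.1).
Proof. exact: (ddc1 (@is_derive_sin R) differentiable_fst (dd_fst v)). Qed.

Lemma isdd_cosphi v : isdd v cosphi (fun p => - sinphi p * v.2).
Proof. exact: (ddc1 (@is_derive_cos R) differentiable_snd (dd_snd v)). Qed.

Lemma isdd_sinphi v : isdd v sinphi (fun p => cosphi p * v.2).
Proof. exact: (ddc1 (@is_derive_sin R) differentiable_snd (dd_snd v)). Qed.

Definition polar p : R * R := (cos p.1 * cos p.2, cos p.1 * sin p.2).

Definition pull F p := F (polar p).

Lemma rsmooth_cosx : rsmooth cosx.
Proof. exact: (rsmooth_cos_sin rsmooth_fst).1. Qed.
Lemma rsmooth_sinx : rsmooth sinx.
Proof. exact: (rsmooth_cos_sin rsmooth_fst).2. Qed.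
Lemma rsmooth_cosphi : rsmooth cosphi.
Proof. exact: (rsmooth_cos_sin rsmooth_snd).1. Qed.
Lemma rsmooth_sinphi : rsmooth sinphi.
Proof. exact: (rsmooth_cos_sin rsmooth_snd).2. Qed.

Lemma rsmooth_pull F : rsmooth F -> rsmooth (pull F).
Proof.
move=> sF; apply: (@rsmooth_comp2 _ F (fun p => cosx p * cosphi p) (fun p => cosx p * sinphi p)) => //.
  by apply: rsmooth_mul; [exact: rsmooth_cosx|exact: rsmooth_cosphi].
by apply: rsmooth_mul; [exact: rsmooth_cosx|exact: rsmooth_sinphi].
Qed.

Lemma isdd_pull v F : rsmooth F -> isdd v (pull F) (fun p =>
  (cosx p * (- sinphi p * v.2) + cosphi p * (- sinx p * v.1)) * pull (dd (1, 0) F) p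
  + (cosx p * (cosphi p * v.2) + sinphi p * (- sinx p * v.1)) * pull (dd (0, 1) F) p).
Proof.
move=> sF; split; first by move=> p; exact/rsmooth_differentiable/rsmooth_pull.
have [d1 e1] := isdd_mul (isdd_cosx v) (isdd_cosphi v).
have [d2 e2] := isdd_mul (isdd_cosx v) (isdd_sinphi v).
apply/funext => p; rewrite /pull.
rewrite (@dd_comp2 _ v F (fun p => cosx p * cosphi p) (fun p => cosx p * sinphi p))//.
  by rewrite e1 e2.
exact: rsmooth_differentiable.
Qed.

Definition lop f p := dd (1, 0) (dd (1, 0) f) p
  - (sin p.1 * cos p.1)^-1 * dd (1, 0) f p + tan p.1 ^+ 2 * dd (0, 1) (dd (0, 1) f) p.

Ltac solve_isdd := repeat (first [exact: isdd_cosx|exact: isdd_sinx|exact: isdd_cosphi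
  |exact: isdd_sinphi|(apply: isdd_pull; try assumption; try exact: rsmooth_dd)
  |exact: isdd_cst|apply: isdd_add|apply: isdd_opp|apply: isdd_mul]).

(** Since sin^2 x = 1 - rho, the operator is (1 - rho) times the Euclidean Laplacian. The chain rule
    reduces this to an identity in sines and cosines. *)
Lemma lop_pull F p : rsmooth F -> sin p.1 != 0 -> cos p.1 != 0 ->
  lop (pull F) p = sin p.1 ^+ 2 * lap F (polar p).
Proof.
move=> sF s0 c0; rewrite /lop.
have [_ ->] := isdd_pull (1, 0) sF.
have [_ ->] := isdd_pull (0, 1) sF.
rewrite [(1, 0).1]/= [(1, 0).2]/= [(0, 1).1]/= [(0, 1).2]/=.
eassert (D : isdd (1, 0) (fun p => (cosx p * (- sinphi p * 0) + cosphi p * (- sinx p * 1)) *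
    pull (dd (1, 0) F) p + (cosx p * (cosphi p * 0) + sinphi p * (- sinx p * 1)) *
    pull (dd (0, 1) F) p) _) by solve_isdd.
eassert (D' : isdd (0, 1) (fun p => (cosx p * (- sinphi p * 1) + cosphi p * (- sinx p * 0)) *
    pull (dd (1, 0) F) p + (cosx p * (cosphi p * 1) + sinphi p * (- sinx p * 0)) *
    pull (dd (0, 1) F) p) _) by solve_isdd.
rewrite D.2 D'.2 /lap /pull /cosx /sinx /cosphi /sinphi /tan /=.
have := cos2Dsin2 p.2; have := cos2Dsin2 p.1.
move: (cos p.1) (sin p.1) (cos p.2) (sin p.2) c0 s0 => c s cf sf c0 s0 cs1 cs2.
move: (dd (1, 0) F _) (dd (0, 1) F _) {D D'} => a' b'.
move: (dd (1, 0) (dd (1, 0) F) _) (dd (0, 1) (dd (1, 0) F) _) => a b.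
move: (dd (1, 0) (dd (0, 1) F) _) (dd (0, 1) (dd (0, 1) F) _) => b2 d.
(* The first-order terms all carry the factor 1 - (cos^2 x + sin^2 x); the mixed second derivatives
   cancel. *)
transitivity (s ^+ 2 * (cf ^+ 2 + sf ^+ 2) * (a + d)
  + c^-1 * (1 - (c ^+ 2 + s ^+ 2)) * (cf * a' + sf * b')); last by rewrite cs1 cs2; ring.
by field; rewrite c0 s0.
Qed.

(** The two fluxes are the field (V1, V2) seen as a density on the rectangle: radial part times cos
    x (negative, since the radius decreases with x) and angular part times sin x. Their divergence
    then acquires just the Jacobian sin x cos x, and integration on the rectangle replaces Stokes on
    the disc. *)
Definition flux_x (V1 V2 : R * R -> R) p :=
  - cosx p * (pull V1 p * cosphi p + pull V2 p * sinphi p).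
Definition flux_phi (V1 V2 : R * R -> R) p :=
  sinx p * (- pull V1 p * sinphi p + pull V2 p * cosphi p).

Lemma divergence_polar V1 V2 p : rsmooth V1 -> rsmooth V2 ->
  dd (1, 0) (flux_x V1 V2) p + dd (0, 1) (flux_phi V1 V2) p =
  sin p.1 * cos p.1 * (dd (1, 0) V1 (polar p) + dd (0, 1) V2 (polar p)).
Proof.
move=> s1 s2.
eassert (D : isdd (1, 0) (flux_x V1 V2) _) by (rewrite /flux_x; solve_isdd).
eassert (D' : isdd (0, 1) (flux_phi V1 V2) _) by (rewrite /flux_phi; solve_isdd).
rewrite D.2 D'.2 /= /pull /cosx /sinx /cosphi /sinphi.
have := cos2Dsin2 p.2.
move: (cos p.1) (sin p.1) (cos p.2) (sin p.2) => c s cf sf cs2.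
transitivity (s * c * (dd (1, 0) V1 (polar p) + dd (0, 1) V2 (polar p)) * (cf ^+ 2 + sf ^+ 2)).
  by ring.
by rewrite cs2 mulr1.
Qed.

Lemma rsmooth_flux_x V1 V2 : rsmooth V1 -> rsmooth V2 -> rsmooth (flux_x V1 V2).
Proof.
move=> s1 s2; apply: rsmooth_mul; first exact/rsmooth_opp/rsmooth_cosx.
apply: rsmooth_add; apply: rsmooth_mul; try exact: rsmooth_pull.
- exact: rsmooth_cosphi.
- exact: rsmooth_sinphi.
Qed.

Lemma rsmooth_flux_phi V1 V2 : rsmooth V1 -> rsmooth V2 -> rsmooth (flux_phi V1 V2).
Proof.
move=> s1 s2; apply: rsmooth_mul; first exact: rsmooth_sinx.
apply: rsmooth_add; apply: rsmooth_mul; try exact: rsmooth_pull.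
- exact/rsmooth_opp/rsmooth_pull.
- exact: rsmooth_sinphi.
- exact: rsmooth_cosphi.
Qed.

End PolarCoordinates.

(** * Integration over the hemisphere *)

Section PlaneIntegration.
Context {R : realType}.
Local Notation mR := (measurableTypeR R).
Local Notation leb := (@lebesgue_measure R).
Local Notation leb2 := (leb \x leb)%E.
Implicit Types (f g : R * R -> R).

(** The sigma-algebra is the product one; an open set belongs to it as a countable union of rational
    rectangles. *)
Lemma open_measurable_plane (U : set (R * R)) : open U ->
  measurable (U : set (mR * mR)).
Proof.
move=> oU.
pose rect (t : rat * rat * rat * rat) : set (mR * mR) :=
  `]ratr t.1.1.1, ratr t.1.1.2[%classic `*` `]ratr t.1.2, ratr t.2[%classic.
pose F t := if `[< rect t `<=` U >] then rect t else set0.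
have -> : U = \bigcup_t F t.
  apply/seteqP; split=> [[x y] Uxy|p [t _]]; last first.
    by rewrite /F; case: asboolP => // tU; exact: tU.
  have /nbhs_ballP[e /= e0 eU] := open_nbhs_nbhs (conj oU Uxy).
  have [a] := @rat_in_itvoo R (x - e) x (ltac:(by rewrite ltrBlDr ltrDl)).
  have [b] := @rat_in_itvoo R x (x + e) (ltac:(by rewrite ltrDl)).
  have [c] := @rat_in_itvoo R (y - e) y (ltac:(by rewrite ltrBlDr ltrDl)).
  have [d] := @rat_in_itvoo R y (y + e) (ltac:(by rewrite ltrDl)).
  rewrite !in_itv/= => /andP[d1 d2] /andP[c1 c2] /andP[b1 b2] /andP[a1 a2].
  exists (a, b, c, d) => //; rewrite /F; case: asboolP => [_|[]].
    by split; rewrite /= in_itv/=; apply/andP.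
  move=> [x' y'] [] /=; rewrite !in_itv/= => /andP[h1 h2] /andP[h3 h4].
  apply: eU; split; rewrite /ball/= ltr_norml; apply/andP; split; lra.
apply: countable_bigcupT_measurable; first exact: countableP.
move=> t; rewrite /F; case: asboolP => // _.
by apply: measurableX; exact: measurable_itv.
Qed.

Lemma continuous_measurable_plane f (D : set (mR * mR)) : continuous f ->
  measurable_fun D (f : mR * mR -> R).
Proof.
move=> cf; apply: (@measurable_funS _ _ _ _ setT) => //.
apply: (measurability _ (RGenOpens.measurableE R)).
move=> _ [_ [a [b ->] <-]]; rewrite setTI; apply: open_measurable_plane.
by move/continuousP : cf; apply; exact: interval_open.
Qed.

Lemma rsmooth_continuous f : rsmooth f -> continuous f.
Proof. by move=> sf p; apply: differentiable_continuous; exact: rsmooth_differentiable. Qed.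

Lemma measurable_hemi : measurable (@hemi R).
Proof. by apply: measurableX; exact: measurable_itv. Qed.

Lemma leb2_hemi_lty : (leb2 (@hemi R) < +oo)%E.
Proof.
rewrite product_measure1E; try exact: measurable_itv.
have /= := @lebesgue_measure_itv R `]0, (pi / 2)[.
rewrite lte_fin divr_gt0 ?pi_gt0// => ->.
have /= := @lebesgue_measure_itv R `[0, (2 * pi)[.
rewrite lte_fin mulr_gt0 ?pi_gt0// => ->.
by rewrite -!EFinD -EFinM ltry.
Qed.

Lemma integrable_hemi_bounded f (M : R) : measurable_fun (@hemi R) (f : mR * mR -> R) ->
  (forall p, hemi p -> `|f p| <= M) -> leb2.-integrable (@hemi R) (EFin \o f).
Proof.
move=> mf fM; apply: measurable_bounded_integrable => //.
- exact: measurable_hemi.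
- exact: leb2_hemi_lty.
- exists M; split; first exact: num_real.
  by move=> x Mx p hp; apply: (le_trans (fM p hp)); exact: ltW.
Qed.

Lemma continuous_hemi_bounded f : continuous f ->
  exists M : R, forall p, hemi p -> `|f p| <= M.
Proof.
move=> cf.
have cK : compact (`[0, pi / 2]%classic `*` `[0, 2 * pi]%classic : set (R * R)).
  by apply: compact_setX; exact: segment_compact.
have cfK : compact (f @` (`[0, pi / 2]%classic `*` `[0, 2 * pi]%classic)).
  by apply: continuous_compact => //; exact: continuous_subspaceT.
have [M [_ MP]] := compact_bounded cfK.
exists (M + 1) => -[x y] [/=]; rewrite !in_itv/= => /andP[x0 x1] /andP[y0 y1].
apply: MP; first by rewrite ltrDl.
by exists (x, y) => //; split; rewrite /= in_itv/= ?(ltW x0) ?(ltW x1) ?y0 ?(ltW y1).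
Qed.

Lemma integrable_hemi_rsmooth f : rsmooth f -> leb2.-integrable (@hemi R) (EFin \o f).
Proof.
move=> /rsmooth_continuous cf; have [M fM] := continuous_hemi_bounded cf.
by apply: integrable_hemi_bounded fM; exact: continuous_measurable_plane.
Qed.

Lemma hemi_fubini f : leb2.-integrable (@hemi R) (EFin \o f) ->
  (\int[leb2]_(p in hemi) (f p)%:E =
    \int[leb]_(x in `]0%R, (pi / 2)%R[) \int[leb]_(y in `[0%R, (2 * pi)%R[) (f (x, y))%:E)%E /\
  (\int[leb2]_(p in hemi) (f p)%:E =
    \int[leb]_(y in `[0%R, (2 * pi)%R[) \int[leb]_(x in `]0%R, (pi / 2)%R[) (f (x, y))%:E)%E.
Proof.
move=> If.
have If' := (integrable_mkcond _ measurable_hemi).1 If.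
have E1 : (\int[leb2]_(p in hemi) (f p)%:E = \int[leb]_x \int[leb]_y ((EFin \o f) \_ hemi) (x, y))%E.
  by rewrite integral_mkcond -integral12_prod_meas1.
have in1 (x y : R) : ((x, y) \in @hemi R) = (x \in `]0, (pi / 2)[%classic) && (y \in `[0, (2 * pi)[%classic).
  by apply/idP/andP => [/set_mem[/= h1 h2]|[/set_mem h1 /set_mem h2]];
    [split; exact/mem_set|exact/mem_set].
split.
  rewrite E1 [RHS]integral_mkcond; apply: eq_integral => x _.
  rewrite [RHS]/patch; case: ifPn => [xI|xI].
    rewrite [RHS]integral_mkcond; apply: eq_integral => y _.
    by rewrite /patch in1 xI.
  apply: integral0_eq => y _; by rewrite /patch in1 (negbTE xI).
rewrite E1 (Fubini If') [RHS]integral_mkcond; apply: eq_integral => y _.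
rewrite [RHS]/patch; case: ifPn => [yI|yI].
  rewrite [RHS]integral_mkcond; apply: eq_integral => x _.
  by rewrite /patch in1 yI andbT.
by apply: integral0_eq => x _; rewrite /patch in1 (negbTE yI) andbF.
Qed.

Lemma rsmooth_section1 f (y : R) : rsmooth f ->
  forall x : R, is_derive x 1 (fun t => f (t, y)) (dd (1, 0) f (x, y)).
Proof.
move=> sf x; have df := @diff_derivable _ _ _ f (x, y) (1, 0) (rsmooth_differentiable (x, y) sf).
have E : (fun h : R => h^-1 *: ((f \o shift ((x, y) : R * R)) (h *: ((1, 0) : R * R)) - f (x, y))) =
    (fun h : R => h^-1 *: (((fun t => f (t, y)) \o shift x) (h *: (1 : R)) - f (x, y))).
  apply/funext => h /=; congr (_ *: (f _ - _)); apply/pair_equal_spec => /=.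
  by rewrite /GRing.scale/= mulr0 add0r.
by rewrite ddE; apply: DeriveDef; [move: df|]; rewrite /derivable /derive E.
Qed.

Lemma rsmooth_section2 f (x : R) : rsmooth f ->
  forall y : R, is_derive y 1 (fun t => f (x, t)) (dd (0, 1) f (x, y)).
Proof.
move=> sf y; have df := @diff_derivable _ _ _ f (x, y) (0, 1) (rsmooth_differentiable (x, y) sf).
have E : (fun h : R => h^-1 *: ((f \o shift ((x, y) : R * R)) (h *: ((0, 1) : R * R)) - f (x, y))) =
    (fun h : R => h^-1 *: (((fun t => f (x, t)) \o shift y) (h *: (1 : R)) - f (x, y))).
  apply/funext => h /=; congr (_ *: (f _ - _)); apply/pair_equal_spec => /=.
  by rewrite /GRing.scale/= mulr0 add0r.
by rewrite ddE; apply: DeriveDef; [move: df|]; rewrite /derivable /derive E.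
Qed.

Lemma is_derive_continuous (F F' : R -> R) : (forall x : R, is_derive x 1 F (F' x)) ->
  continuous F.
Proof.
by move=> FD x; apply: differentiable_continuous; apply/derivable1_diffP; case: (FD x).
Qed.

Lemma integral_is_derive (F F' : R -> R) (a b : R) : a < b ->
  (forall x : R, is_derive x 1 F (F' x)) -> continuous F' ->
  (\int[leb]_(x in `[a, b]) (F' x)%:E = (F b - F a)%:E)%E.
Proof.
move=> ab FD cF'.
have cF := is_derive_continuous FD.
rewrite (@continuous_FTC2 _ F' F)//.
- exact: continuous_subspaceT.
- split=> [x _||]; first by case: (FD x).
  + by apply: cvg_at_right_filter; exact: cF.
  + by apply: cvg_at_left_filter; exact: cF.
- by move=> x _; rewrite derive1E; case: (FD x).
Qed.

Lemma hemi_integral_dd1 f : rsmooth f -> (forall y, f (0, y) = f (pi / 2, y)) ->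
  (\int[leb2]_(p in hemi) (dd (1, 0) f p)%:E = 0)%E.
Proof.
move=> sf fb; have sd := rsmooth_dd (1, 0) sf.
have [_ ->] := hemi_fubini (integrable_hemi_rsmooth sd).
apply: integral0_eq => y _.
have cd := is_derive_continuous (rsmooth_section1 y sd).
have md (D : set R) : measurable_fun D (fun x => (dd (1, 0) f (x, y))%:E).
  by apply/measurable_EFinP; apply: measurable_funTS; exact: continuous_measurable_fun.
rewrite integral_itv_obnd_cbnd// integral_itv_bndo_bndc//.
have p0 : 0 < pi / 2 :> R by rewrite divr_gt0 ?pi_gt0.
by rewrite (integral_is_derive p0 (rsmooth_section1 y sf) cd) -fb subrr.
Qed.

Lemma hemi_integral_dd2 f : rsmooth f -> (forall x, f (x, 0) = f (x, 2 * pi)) ->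
  (\int[leb2]_(p in hemi) (dd (0, 1) f p)%:E = 0)%E.
Proof.
move=> sf fb; have sd := rsmooth_dd (0, 1) sf.
have [-> _] := hemi_fubini (integrable_hemi_rsmooth sd).
apply: integral0_eq => x _.
have cd := is_derive_continuous (rsmooth_section2 x sd).
have md (D : set R) : measurable_fun D (fun y => (dd (0, 1) f (x, y))%:E).
  by apply/measurable_EFinP; apply: measurable_funTS; exact: continuous_measurable_fun.
rewrite integral_itv_bndo_bndc//.
have p0 : 0 < 2 * pi :> R by rewrite mulr_gt0 ?pi_gt0.
by rewrite (integral_is_derive p0 (rsmooth_section2 x sf) cd) -fb subrr.
Qed.

End PlaneIntegration.

(** * The weighted L^2 space of the hemisphere and Green's formula *)

Section HemisphereL2.
Context {R : realType}.
Local Notation mR := (measurableTypeR R).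
Local Notation leb := (@lebesgue_measure R).
Local Notation leb2 := (leb \x leb)%E.
Implicit Types (f g u : R * R -> R) (F H : R * R -> R).

Definition wgt (p : mR * mR) : R := (tan p.1)^-1.

Definition hL2 u := wL2 leb2 (@hemi R) wgt (u : mR * mR -> R).
Definition hip u v : R := wip leb2 (@hemi R) wgt (u : mR * mR -> R) (v : mR * mR -> R).

Lemma hemi_trig (p : R * R) : hemi p ->
  [/\ 0 < sin p.1, 0 < cos p.1, sin p.1 <= 1 & cos p.1 <= 1].
Proof.
move=> [/=]; rewrite in_itv/= => /andP[x0 x1] _; split.
- by rewrite sin_gt0_pihalf// x0 x1.
- by rewrite cos_gt0_pihalf// x1 andbT; have := pihalf_02 R; lra.
- exact: sin_le1.
- exact: cos_le1.
Qed.

Lemma wgtE (p : R * R) : wgt p = cos p.1 / sin p.1.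
Proof. by rewrite /wgt /tan invf_div. Qed.

Lemma wgt_gt0 (p : mR * mR) : hemi p -> 0 < wgt p.
Proof. by move=> /hemi_trig[s0 c0 _ _]; rewrite wgtE divr_gt0. Qed.

Lemma rsmooth_measurable f : rsmooth f -> measurable_fun (@hemi R) (f : mR * mR -> R).
Proof. by move=> /rsmooth_continuous; exact: continuous_measurable_plane. Qed.

Lemma measurable_wgt : measurable_fun (@hemi R) wgt.
Proof.
have -> : wgt = (fun p => cosx p * (sinx p)^-1) by apply/funext => p; exact: wgtE.
apply: measurable_funM; first by apply: rsmooth_measurable; exact: rsmooth_cosx.
have ms := rsmooth_measurable (@rsmooth_sinx R).
apply: (@measurable_comp _ _ _ (mR * mR)%type R R `]0, +oo[%classic (@GRing.inv R) _ sinx) ms.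
- exact: measurable_itv.
- by move=> _ [p /hemi_trig[s0 _ _ _] <-]; rewrite /= in_itv/= s0.
- apply: open_continuous_measurable_fun; first exact: interval_open.
  move=> t; rewrite inE/= in_itv/= andbT => t0; apply: inv_continuous; exact: lt0r_neq0.
Qed.

(** The weight is cos x / sin x: first-order vanishing at the equator bounds u^2 times the weight by
    C^2 sin x cos x. *)
Lemma hL2_bounded_sin u (C : R) : measurable_fun (@hemi R) (u : mR * mR -> R) ->
  (forall p, hemi p -> `|u p| <= C * sin p.1) -> hL2 u.
Proof.
move=> mu uC; split => //.
have I : leb2.-integrable (@hemi R) (EFin \o (fun p : mR * mR => u p ^+ 2 * wgt p)).
  apply: (@integrable_hemi_bounded _ _ (C ^+ 2)).
    by apply: measurable_funM; [exact: measurable_funX|exact: measurable_wgt].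
  move=> p hp; have [s0 c0 s1 c1] := hemi_trig hp.
  have u2 : u p ^+ 2 <= C ^+ 2 * sin p.1 ^+ 2.
    rewrite -exprMn -[leLHS]real_normK ?num_real// lerXn2r ?nnegrE ?uC//.
    by apply: le_trans (uC p hp).
  rewrite ger0_norm; last exact: mulr_ge0 (sqr_ge0 _) (ltW (wgt_gt0 hp)).
  apply: (@le_trans _ _ (C ^+ 2 * sin p.1 ^+ 2 * wgt p)).
    by rewrite ler_wpM2r// ltW// wgt_gt0.
  rewrite wgtE -mulrA; have -> : sin p.1 ^+ 2 * (cos p.1 / sin p.1) = sin p.1 * cos p.1.
    by field; rewrite gt_eqF.
  by rewrite ler_piMr ?sqr_ge0// mulr_ile1// ltW.
exact: (integrable_lty measurable_hemi I).
Qed.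

Lemma rho_polar (p : R * R) : rho (polar p) = cos p.1 ^+ 2.
Proof. by rewrite /rho /polar/= !exprMn -mulrDr cos2Dsin2 mulr1. Qed.

Lemma one_sub_rho_polar (p : R * R) : 1 - rho (polar p) = sin p.1 ^+ 2.
Proof. by rewrite rho_polar -(cos2Dsin2 p.1) addrC addKr. Qed.

Lemma hL2_sin_mul f : rsmooth f -> hL2 (fun p => sin p.1 * f p).
Proof.
move=> sf; have [M fM] := continuous_hemi_bounded (rsmooth_continuous sf).
apply: (@hL2_bounded_sin _ M).
  by apply: rsmooth_measurable; apply: (@rsmooth_mul _ sinx f) => //; exact: rsmooth_sinx.
move=> p hp; have [s0 _ _ _] := hemi_trig hp.
by rewrite normrM gtr0_norm// mulrC ler_wpM2r ?(ltW s0)// fM.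
Qed.

Lemma hL2_ext f g : (forall p, hemi p -> f p = g p) -> hL2 f -> hL2 g.
Proof.
move=> fg [mf sf]; split.
  by apply: eq_measurable_fun mf => p; rewrite inE => /fg.
rewrite (_ : wsq _ _ _ _ = wsq leb2 hemi wgt (f : mR * mR -> R))//.
by apply: eq_integral => p; rewrite inE => /fg ->.
Qed.

Lemma hL2_pull_vanishing F g : rsmooth g -> (forall y, F y = (1 - rho y) * g y) ->
  hL2 (pull F).
Proof.
move=> sg Fg; apply: (@hL2_ext (fun p => sin p.1 * (sinx p * pull g p))).
  by move=> p _; rewrite /pull Fg one_sub_rho_polar expr2 /sinx mulrA.
apply: hL2_sin_mul; apply: rsmooth_mul; [exact: rsmooth_sinx|exact: rsmooth_pull].
Qed.

Lemma rsmooth_lap F : rsmooth F -> rsmooth (lap F).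
Proof. by move=> sF; apply: rsmooth_add; do 2!apply: rsmooth_dd. Qed.

Lemma lop_pull_hemi F p : rsmooth F -> hemi p ->
  lop (pull F) p = sin p.1 * (sinx p * pull (lap F) p).
Proof.
move=> sF hp; have [s0 c0 _ _] := hemi_trig hp.
by rewrite lop_pull ?gt_eqF// expr2 /sinx /pull mulrA.
Qed.

Lemma hL2_lop_pull F : rsmooth F -> hL2 (lop (pull F)).
Proof.
move=> sF; apply: (@hL2_ext (fun p => sin p.1 * (sinx p * pull (lap F) p))).
  by move=> p hp; rewrite lop_pull_hemi.
apply: hL2_sin_mul; apply: rsmooth_mul; first exact: rsmooth_sinx.
exact/rsmooth_pull/rsmooth_lap.
Qed.

Lemma hL2_pull_compact F (r : R) : rsmooth F -> r < 1 ->
  (forall y, r <= rho y -> F y = 0) -> hL2 (pull F).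
Proof.
move=> sF r1 F0.
have [M FM] := continuous_hemi_bounded (rsmooth_continuous (rsmooth_pull sF)).
have k0 : 0 < 1 - r by rewrite subr_gt0.
apply: (@hL2_bounded_sin _ (M / (1 - r))); first by apply: rsmooth_measurable; exact: rsmooth_pull.
move=> p hp; have [s0 c0 s1 c1] := hemi_trig hp.
have M0 : 0 <= M by rewrite (le_trans _ (FM p hp)).
have [rp|rp] := leP r (rho (polar p)).
  by rewrite /pull F0// normr0 mulr_ge0 ?divr_ge0 ?(ltW k0) ?(ltW s0).
rewrite (le_trans (FM p hp))// -mulrA ler_peMr// ler_pdivlMl// mulr1.
have := one_sub_rho_polar p; nra.
Qed.

(** Component along v of F grad H - H grad F, the field whose divergence is the integrand of Green's
    formula. *)
Definition crossgrad v F H (y : R * R) : R := F y * dd v H y - H y * dd v F y.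

Lemma rsmooth_crossgrad v F H : rsmooth F -> rsmooth H -> rsmooth (crossgrad v F H).
Proof.
by move=> sF sH; apply: rsmooth_sub; apply: rsmooth_mul => //; exact: rsmooth_dd.
Qed.

Lemma dd_crossgrad v F H : rsmooth F -> rsmooth H -> dd v (crossgrad v F H) =
  fun y => F y * dd v (dd v H) y - H y * dd v (dd v F) y.
Proof.
move=> sF sH; have sF' := rsmooth_dd v sF; have sH' := rsmooth_dd v sH.
have [_ ->] := isdd_add (isdd_mul (isdd_rsmooth v sF) (isdd_rsmooth v sH'))
   (isdd_opp (isdd_mul (isdd_rsmooth v sH) (isdd_rsmooth v sF'))).
by apply/funext => y; ring.
Qed.

(** The weight cot x times the factor sin^2 x of the operator is the Jacobian sin x cos x, so this
    is the Euclidean Green formula, read as a divergence on the rectangle. *)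
Lemma green_hemi F H : rsmooth F -> rsmooth H ->
  (forall y, rho y = 1 -> F y = 0) -> (forall y, rho y = 1 -> H y = 0) ->
  hip (pull F) (lop (pull H)) = hip (pull H) (lop (pull F)).
Proof.
move=> sF sH F0 H0.
pose G F H p := sinx p * cosx p * (pull F p * pull (lap H) p) : R.
have sG A B : rsmooth A -> rsmooth B -> rsmooth (G A B).
  move=> sA sB; apply: rsmooth_mul.
    by apply: rsmooth_mul; [exact: rsmooth_sinx|exact: rsmooth_cosx].
  by apply: rsmooth_mul; [exact: rsmooth_pull|exact/rsmooth_pull/rsmooth_lap].
have hG A B : rsmooth B -> hip (pull A) (lop (pull B)) = \int[leb2]_(p in hemi) (G A B p).
  move=> sB; apply: eq_Rintegral => p; rewrite inE => hp.
  rewrite lop_pull_hemi// wgtE /G /sinx /cosx; have [s0 _ _ _] := hemi_trig hp.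
  by field; rewrite gt_eqF.
rewrite !hG//; apply/eqP; rewrite -subr_eq0.
rewrite -RintegralB; [|exact: measurable_hemi|exact/integrable_hemi_rsmooth/sG..].
pose V1 := crossgrad (1, 0) F H; pose V2 := crossgrad (0, 1) F H.
have s1 : rsmooth V1 by exact: rsmooth_crossgrad.
have s2 : rsmooth V2 by exact: rsmooth_crossgrad.
pose A := dd (1, 0) (flux_x V1 V2); pose B := dd (0, 1) (flux_phi V1 V2).
have sA : rsmooth A by exact/rsmooth_dd/rsmooth_flux_x.
have sB : rsmooth B by exact/rsmooth_dd/rsmooth_flux_phi.
rewrite (_ : \int[leb2]_(x in hemi) _ = \int[leb2]_(p in hemi) (A p + B p)); last first.
  apply: eq_Rintegral.
  move=> p _; rewrite /A /B divergence_polar// /V1 /V2 !dd_crossgrad//.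
  by rewrite /G /pull /lap /sinx /cosx; ring.
rewrite RintegralD; [|exact: measurable_hemi|exact: integrable_hemi_rsmooth..].
rewrite /Rintegral hemi_integral_dd1 ?hemi_integral_dd2 ?addr0//.
- exact: rsmooth_flux_phi.
- by move=> x; rewrite /flux_phi /pull /polar /sinx /sinphi /cosphi /= mulr_natl cos0 sin0 cos2pi sin2pi.
- exact: rsmooth_flux_x.
(* At the pole x = pi/2 the flux vanishes with cos x; on the equator x = 0 it vanishes because F and
   H do. *)
- move=> y; rewrite /flux_x /cosx /= cos_pihalf oppr0 mul0r cos0.
  have r1 : rho (polar (0, y)) = 1 by rewrite rho_polar cos0 expr1n.
  by rewrite /pull /V1 /V2 /crossgrad F0// H0// !mul0r subrr !mul0r addr0 mulr0.
Qed.

End HemisphereL2.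

Section HemisphereInnerProduct.
Context {R : realType}.
Implicit Types (u v g : R * R -> R) (c : R).

Lemma hL2_add u v : hL2 u -> hL2 v -> hL2 (fun p => u p + v p).
Proof. by move=> Lu Lv; apply: (wL2_add measurable_hemi measurable_wgt wgt_gt0). Qed.

Lemma hL2_sub u v : hL2 u -> hL2 v -> hL2 (fun p => u p - v p).
Proof. by move=> Lu Lv; apply: (wL2_sub measurable_hemi measurable_wgt wgt_gt0). Qed.

Lemma hL2_scale c u : hL2 u -> hL2 (fun p => c * u p).
Proof. by move=> Lu; apply: (wL2_scale measurable_hemi measurable_wgt wgt_gt0). Qed.

Lemma hL2_opp u : hL2 u -> hL2 (fun p => - u p).
Proof. by move=> Lu; apply: (wL2_opp measurable_hemi measurable_wgt wgt_gt0). Qed.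

Lemma hip_ge0 u : 0 <= hip u u.
Proof. exact: wip_ge0 wgt_gt0 _. Qed.

Lemma hip_ext u u' v v' : (forall p, hemi p -> u p = u' p) ->
  (forall p, hemi p -> v p = v' p) -> hip u v = hip u' v'.
Proof. exact: wip_ext. Qed.

Lemma hipDl u v g : hL2 u -> hL2 v -> hL2 g ->
  hip (fun p => u p + v p) g = hip u g + hip v g.
Proof. by move=> Lu Lv Lg; apply: (wipDl measurable_hemi measurable_wgt wgt_gt0). Qed.

Lemma hipBl u v g : hL2 u -> hL2 v -> hL2 g ->
  hip (fun p => u p - v p) g = hip u g - hip v g.
Proof. by move=> Lu Lv Lg; apply: (wipBl measurable_hemi measurable_wgt wgt_gt0). Qed.

Lemma hipZl c u g : hL2 u -> hL2 g -> hip (fun p => c * u p) g = c * hip u g.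
Proof. by move=> Lu Lg; apply: (wipZl measurable_hemi measurable_wgt wgt_gt0). Qed.

Lemma hip_sq_ext u u' : (forall p, hemi p -> u p = u' p) -> hip u u = hip u' u'.
Proof. by move=> h; exact: hip_ext. Qed.

Lemma hipC u v : hip u v = hip v u.
Proof. exact: wipC. Qed.

Lemma hipDr u v v' : hL2 u -> hL2 v -> hL2 v' ->
  hip u (fun p => v p + v' p) = hip u v + hip u v'.
Proof. by move=> Lu Lv Lv'; rewrite hipC hipDl// hipC [X in _ + X]hipC. Qed.

Lemma hipZr c u v : hL2 u -> hL2 v -> hip u (fun p => c * v p) = c * hip u v.
Proof. by move=> Lu Lv; rewrite hipC hipZl// hipC. Qed.

End HemisphereInnerProduct.

(** * Orthogonality and normalization of the eigenfunctions *)

Section Eigenbasis.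
Context {R : realType}.
Local Notation mR := (measurableTypeR R).
Local Notation leb := (@lebesgue_measure R).
Local Notation leb2 := (leb \x leb)%E.
Implicit Types (F G : R * R -> R) (q : {poly R}) (b : bool) (k m n : nat).

(** This is (1 - rho) F read in coordinates. The factor puts every smooth F into L^2, and each
    eigenfunction has this form. *)
Definition sin2pull F (p : R * R) : R := sin p.1 * (sinx p * pull F p).

Lemma hL2_sin2pull F : rsmooth F -> hL2 (sin2pull F).
Proof.
move=> sF; apply: hL2_sin_mul; apply: rsmooth_mul; first exact: rsmooth_sinx.
exact: rsmooth_pull.
Qed.

(** The factor sin^3 cos is sin^4 times the weight cot; the density is smooth up to the boundary, so
    the integration lemmas apply to it. *)
Definition hdens F G (p : R * R) : R := sinx p ^+ 3 * cosx p * (pull F p * pull G p).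

Lemma rsmooth_hdens F G : rsmooth F -> rsmooth G -> rsmooth (hdens F G).
Proof.
move=> sF sG; apply: rsmooth_mul; apply: rsmooth_mul; try exact: rsmooth_pull.
- exact/rsmooth_exp/rsmooth_sinx.
- exact: rsmooth_cosx.
Qed.

Lemma hip_sin2pull F G :
  hip (sin2pull F) (sin2pull G) = \int[leb2]_(p in hemi) (hdens F G p).
Proof.
apply: eq_Rintegral => p; rewrite inE => hp; have [s0 _ _ _] := hemi_trig hp.
by rewrite wgtE /sin2pull /hdens /sinx /cosx; field; rewrite gt_eqF.
Qed.

(** A rotation derives z^k into i k z^k and leaves functions of rho alone; in real terms it
    exchanges the two harmonics of frequency k. *)
Lemma dd2_pull_radial q b k : dd (0, 1) (pull (radial q b k)) =
  fun p => (-1) ^+ (~~ b) * k%:R * pull (radial q (~~ b) k) p.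
Proof.
have sr := rsmooth_radial q b k.
have [_ ->] := isdd_pull (0, 1) sr.
have E v : dd v (radial q b k) = fun y => q.[rho y] * dd v (zharm b k) y
    + zharm b k y * (q^`().[rho y] * dd v rho y).
  exact: (dd_radial_mul (@is_derive_poly R q) v (rsmooth_zharm b k)).
rewrite !E; apply/funext => p.
have -> : cosx p * (cosphi p * (0, 1).2) + sinphi p * (- sinx p * (0, 1).1) = (polar p).1.
  by rewrite /= mulr0 mulr1 mulr0 addr0.
have -> : cosx p * (- sinphi p * (0, 1).2) + cosphi p * (- sinx p * (0, 1).1) = - (polar p).2.
  by rewrite /= mulr0 mulr1 mulr0 addr0 mulrN.
rewrite /pull /radial !dd_rho; move: (polar p) => y /=.
case: k {sr E} => [|k]; first by rewrite zharm0 !dd_cst; ring.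
rewrite !dd_zharmS !zharmS negbK /=.
by case: b => /=; ring.
Qed.

(** The integrand is an exact derivative in phi of a periodic function, as the remaining factor
    depends on x only. *)
Lemma angular_skew F G : rsmooth F -> rsmooth G ->
  \int[leb2]_(p in hemi) (sinx p ^+ 3 * cosx p *
    (pull F p * dd (0, 1) (pull G) p + pull G p * dd (0, 1) (pull F) p)) = 0.
Proof.
move=> sF sG; have sd := rsmooth_hdens sF sG.
have dE : dd (0, 1) (hdens F G) = fun p => sinx p ^+ 3 * cosx p *
    (pull F p * dd (0, 1) (pull G) p + pull G p * dd (0, 1) (pull F) p).
  have sc : isdd (0, 1) (fun p => sinx p ^+ 3 * cosx p) (fun=> 0 : R).
    rewrite (_ : (fun p => _) = fun p => (sinx p * (sinx p * sinx p)) * cosx p); last first.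
      by apply/funext => p; ring.
    have [d E] := isdd_mul (isdd_mul (isdd_sinx (0, 1))
      (isdd_mul (isdd_sinx (0, 1)) (isdd_sinx (0, 1)))) (isdd_cosx ((0, 1) : R * R)).
    by split; [exact: d|apply: (etrans E); apply/funext => p /=; ring].
  have [_ ->] := isdd_mul sc (isdd_mul (isdd_rsmooth (0, 1) (rsmooth_pull sF))
    (isdd_rsmooth (0, 1) (rsmooth_pull sG))).
  by apply/funext => p; ring.
have := hemi_integral_dd2 sd; rewrite dE => /(_ _)H.
rewrite /Rintegral H// => x; rewrite /hdens /pull /polar /sinx /cosx /=.
by rewrite mulr_natl cos0 sin0 cos2pi sin2pi.
Qed.

Lemma integrable_hdens F G : rsmooth F -> rsmooth G ->
  leb2.-integrable (@hemi R) (EFin \o (hdens F G : mR * mR -> R)).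
Proof. by move=> sF sG; apply: integrable_hemi_rsmooth; exact: rsmooth_hdens. Qed.

Definition radial_hip q b k q' b' k' : R :=
  hip (sin2pull (radial q b k)) (sin2pull (radial q' b' k')).

Lemma radial_hip_angular q b k q' b' k' :
  (-1) ^+ (~~ b) * k%:R * radial_hip q (~~ b) k q' b' k'
  + (-1) ^+ (~~ b') * k'%:R * radial_hip q b k q' (~~ b') k' = 0.
Proof.
have s c (r : {poly R}) i := rsmooth_radial r c i.
rewrite -(angular_skew (s b q k) (s b' q' k')) /radial_hip !hip_sin2pull.
have I c c' := integrable_hdens (s c q k) (s c' q' k').
rewrite -RintegralZl//; last exact: measurable_hemi.
rewrite -RintegralZl//; last exact: measurable_hemi.
rewrite -RintegralD; first last.
- by apply: integrable_EFinZl => //; exact: measurable_hemi.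
- by apply: integrable_EFinZl => //; exact: measurable_hemi.
- exact: measurable_hemi.
apply: eq_Rintegral => p _; rewrite !dd2_pull_radial /hdens; ring.
Qed.

(** The rotation identity, used for b, ~~ b' and for ~~ b, b', gives two linear relations between
    the products X and Y; eliminating Y leaves (k^2 - k'^2) X = 0. *)
Lemma radial_hip_freq_eq0 q b k q' b' k' : k != k' -> radial_hip q b k q' b' k' = 0.
Proof.
move=> kk'.
have := radial_hip_angular q (~~ b) k q' b' k'; have := radial_hip_angular q b k q' (~~ b') k'.
rewrite !negbK; set X := radial_hip q b k q' b' k'; set Y := radial_hip q (~~ b) k q' (~~ b') k' => h1 h2.
have : (k%:R ^+ 2 - k'%:R ^+ 2) * X = 0.
  move: (congr1 ( *%R k%:R) h2) (congr1 ( *%R k'%:R) h1); rewrite !mulr0.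
  by move: X Y {h1 h2} => X Y; case: b; case: b' => /=; rewrite ?expr0 ?expr1; lra.
move/eqP; rewrite mulf_eq0 => /orP[|/eqP//].
by rewrite subr_eq0 -!natrX eqr_nat eqn_exp2r// (negbTE kk').
Qed.

(** At equal frequency the two terms of the rotation identity coincide: exchanging the harmonics
    between the factors does not change the integrand. So 2 k X = 0. *)
Lemma radial_hip_parity_eq0 q b k q' : (0 < k)%N -> radial_hip q b k q' (~~ b) k = 0.
Proof.
move=> k0; have := radial_hip_angular q (~~ b) k q' (~~ b) k.
rewrite !negbK.
have -> : radial_hip q (~~ b) k q' b k = radial_hip q b k q' (~~ b) k.
  by apply: eq_Rintegral => p _; rewrite /sin2pull /pull /radial; ring.
move: (radial_hip _ _ _ _ _ _) => X; have := ltr0n R k; rewrite k0 => {}k0.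
by case: b => /=; rewrite ?expr0 ?expr1; nra.
Qed.

Lemma pull_efun b k m : pull (efun b k m) = sin2pull (radial (eigpoly k m) b k) :> (R * R -> R).
Proof.
by apply/funext => p; rewrite /pull efunE one_sub_rho_polar /sin2pull /sinx /pull; ring.
Qed.

Lemma hL2_efun b k m : hL2 (pull (@efun R b k m)).
Proof. by rewrite pull_efun; apply: hL2_sin2pull; exact: rsmooth_radial. Qed.

Lemma lop_efun b k m (p : R * R) : hemi p ->
  lop (pull (efun b k m)) p = - eigval k m * pull (efun b k m) p.
Proof.
move=> hp; rewrite lop_pull_hemi//; last exact: rsmooth_efun.
by rewrite /pull -lap_efun one_sub_rho_polar /sinx; ring.
Qed.

Lemma efun_circle b k m (y : R * R) : rho y = 1 -> efun b k m y = 0.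
Proof. by move=> y1; rewrite efunE y1 subrr mul0r. Qed.

Lemma eigval_inj k : injective (@eigval R k).
Proof.
move=> m m'; rewrite /eigval => /(mulfI (lt0r_neq0 (ltr0n _ _ : 0 < 4))).
rewrite -!natrM => /eqP; rewrite eqr_nat => /eqP.
wlog mm : m m' / (m < m')%N.
  move=> H; case: (ltngtP m m') => // h e; first exact: H.
  by apply/esym; apply: H.
suff : (m.+1 * (m.+1 + k) < m'.+1 * (m'.+1 + k))%N by move=> /ltn_eqF/eqP.
by rewrite ltn_mul// ltn_add2r.
Qed.

(** By Green's formula the operator is symmetric on these functions, and for fixed k different
    levels have different eigenvalues. *)
Lemma efun_diff_level b k m m' : m != m' ->
  hip (pull (@efun R b k m)) (pull (efun b k m')) = 0.
Proof.
move=> mm'.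
have := green_hemi (rsmooth_efun b k m) (rsmooth_efun b k m')
  (@efun_circle b k m) (@efun_circle b k m').
have hz i j : hip (pull (@efun R b k i)) (lop (pull (efun b k j))) =
    - eigval k j * hip (pull (efun b k i)) (pull (efun b k j)).
  transitivity (hip (fun p : R * R => - eigval k j * pull (efun b k j) p) (pull (efun b k i))).
    by rewrite hipC; apply: hip_ext => // p; exact: lop_efun.
  rewrite [RHS](_ : _ = - eigval k j * hip (pull (efun b k j)) (pull (efun b k i))).
    by apply: hipZl; exact: hL2_efun.
  by congr (_ * _); exact: hipC.
rewrite !hz (_ : hip (pull (efun b k m')) _ = hip (pull (efun b k m)) (pull (efun b k m'))); last exact: hipC.
move: (hip _ _) => X /eqP; rewrite -subr_eq0 -mulrBl mulf_eq0 => /orP[|/eqP//].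
by rewrite subr_eq0 eqr_opp => /eqP/eigval_inj/esym/eqP; rewrite (negbTE mm').
Qed.

Lemma pull_zharm b k (p : R * R) : zharm b k (polar p) =
  cos p.1 ^+ k * (if b then sin (k%:R * p.2) else cos (k%:R * p.2)).
Proof.
elim: k b => [|k IH] b.
  by rewrite zharm0 mul0r sin0 cos0; case: b; rewrite /= ?mulr0 ?mulr1.
rewrite zharmS !IH -natr1 mulrDl mul1r sinD cosD exprS /polar.
by case: b => /=; ring.
Qed.

Lemma hemi_integral_gt0 (g : R * R -> R) (p : R * R) : rsmooth g ->
  (forall z, hemi z -> 0 <= g z) -> 0 < p.1 < pi / 2 -> 0 < p.2 < 2 * pi -> 0 < g p ->
  0 < \int[leb2]_(z in hemi) g z.
Proof.
move=> sg g0 /andP[x0 x1] /andP[y0 y1] gp0.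
have /(_ p) := rsmooth_continuous sg; move=> /cvgrPdist_lt /(_ (g p / 2) (divr_gt0 gp0 (ltr0Sn _ 1))).
case: p x0 x1 y0 y1 gp0 => x y /= x0 x1 y0 y1 gp0 /nbhs_ballP[e /= e0 eP].
pose r := Num.min e (Num.min (Num.min x (pi / 2 - x)) (Num.min y (2 * pi - y))).
have r0 : 0 < r by rewrite !lt_min e0 x0 y0 !subr_gt0 x1 y1.
have : r <= r by [].
rewrite {2}/r !le_min => /and3P[re /andP[rx rx'] /andP[ry ry']].
pose A : set mR := `](x - r), (x + r)[%classic.
pose B : set mR := `](y - r), (y + r)[%classic.
have mA : measurable A by exact: measurable_itv.
have mB : measurable B by exact: measurable_itv.
have AB z : (A `*` B) z -> hemi z /\ g (x, y) / 2 <= g z.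
  rewrite /A /B /= !in_itv/= => -[/andP[a1 a2] /andP[b1 b2]].
  split; first by split; rewrite /= in_itv/=; apply/andP; split; lra.
  have : `|g (x, y) - g z| < g (x, y) / 2.
    by apply: eP; split; rewrite /ball/= ltr_norml; apply/andP; split; lra.
  by rewrite ltr_norml => /andP[_]; lra.
have c0 : 0 < g (x, y) / 2 by rewrite divr_gt0.
have leb0 (a : R) : leb (`](a - r), (a + r)[%classic : set mR) = (2 * r)%:E.
  rewrite lebesgue_measure_itv/= lte_fin.
  have -> : a - r < a + r by lra.
  by rewrite -EFinD; congr EFin; ring.
have Ig := integrable_hemi_rsmooth sg.
rewrite -lte_fin /Rintegral fineK; last exact: (integrable_fin_num measurable_hemi Ig).
apply: (@lt_le_trans _ _ ((g (x, y) / 2)%:E * leb2 (A `*` B))%E).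
  have -> : leb2 (A `*` B) = ((2 * r) * (2 * r))%:E.
    by rewrite EFinM -{1}(leb0 x) -(leb0 y); exact: product_measure1E.
  rewrite -EFinM lte_fin.
  by rewrite !mulr_gt0 ?divr_gt0.
have mAB : measurable (A `*` B) by exact: measurableX.
rewrite -integral_cst//.
apply: (@le_trans _ _ (\int[leb2]_(z in A `*` B) (g z)%:E)%E).
  apply: ge0_le_integral => //.
  - by move=> z _; rewrite lee_fin ltW.
  - apply/measurable_EFinP; apply: continuous_measurable_plane; exact: rsmooth_continuous.
  - by move=> z /AB[_ ?]; rewrite lee_fin.
apply: ge0_subset_integral => //.
- exact: measurable_hemi.
- exact: (measurable_int _ Ig).
- by move=> z /AB[].
Qed.

(** The excluded case is Im z^0 = 0. Otherwise one point of positive density is enough; it is sought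
    near the pole, where the polynomial factor is close to its constant coefficient 1. *)
Lemma efun_norm_gt0 b k m : (0 < k)%N || ~~ b ->
  0 < hip (pull (@efun R b k m)) (pull (efun b k m)).
Proof.
move=> kb; rewrite pull_efun hip_sin2pull.
set q := eigpoly k m.
have sr := rsmooth_radial q b k.
(* the trigonometric factor is +1 or -1 at this angle *)
pose phi : R := if b then pi / (2 * k%:R) else pi.
have trig : (if b then sin (k%:R * phi) else cos (k%:R * phi)) ^+ 2 = 1.
  rewrite /phi; case: b kb {sr phi} => [|_] /=.
    rewrite orbF => k0; have -> : k%:R * (pi / (2 * k%:R)) = pi / 2 :> R.
      by field; rewrite pnatr_eq0 -lt0n.
    by rewrite sin_pihalf expr1n.
  elim: k {q} => [|k IH]; first by rewrite mul0r cos0 expr1n.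
  by rewrite -natr1 mulrDl mul1r cosD cospi sinpi mulr0 subr0 mulrN1 sqrrN.
have phi0 : 0 < phi < 2 * pi.
  have p0 := pi_gt0 R; rewrite /phi; case: b kb {sr phi trig} => [|_]; last by apply/andP; split; lra.
  rewrite orbF => k0; have k1 : 1 <= k%:R :> R by rewrite ler1n.
  have d0 : 0 < 2 * k%:R :> R by lra.
  rewrite divr_gt0//= ltr_pdivrMr//; nra.
have [x [/andP[x0 x1] qx]] : exists x : R, 0 < x < pi / 2 /\ 0 < q.[cos x ^+ 2].
  have cq : continuous (fun x : R => q.[cos x ^+ 2]).
    move=> x; apply: differentiable_continuous; apply/derivable1_diffP.
    have hc : is_derive x 1 (fun x : R => cos x ^+ 2) (2 * cos x ^+ 1 * - sin x).
      exact: (is_derive_pow 2 (is_derive_cos x)).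
    by have [] := @is_derive1_comp _ (horner q) _ x _ _ (is_derive_poly q _) hc.
  have q0 : q.[cos (pi / 2) ^+ 2] = 1.
    rewrite cos_pihalf expr0n/= horner_coef0 coef_eigpoly /eigcoef big_ord0//.
  have /cvgrPdist_lt /(_ 1 ltr01) := cq (pi / 2); rewrite q0 => /nbhs_ballP[e /= e0 eP].
  have p0 := pihalf_02 R; move/andP: p0 => [p0 _].
  pose r := Num.min (e / 2) (pi / 4).
  have r0 : 0 < r by rewrite lt_min divr_gt0//= divr_gt0// pi_gt0.
  have : r <= r by [].
  rewrite {2}/r le_min => /andP[re rp].
  exists (pi / 2 - r); split; first by apply/andP; split; lra.
  have : `|1 - q.[cos (pi / 2 - r) ^+ 2]| < 1.
    by apply: eP; rewrite /ball/= ltr_norml; apply/andP; split; lra.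
  by rewrite ltr_norml => /andP[_]; lra.
apply: (@hemi_integral_gt0 _ (x, phi)).
- exact: rsmooth_hdens.
- move=> z hz; have [s0 c0 _ _] := hemi_trig hz.
  by rewrite /hdens -expr2; apply: mulr_ge0; [rewrite mulr_ge0 ?exprn_ge0 ?ltW|exact: sqr_ge0].
- by rewrite x0 x1.
- exact: phi0.
- have s0 : 0 < sin x by rewrite sin_gt0_pihalf// x0 x1.
  have c0 : 0 < cos x by rewrite cos_gt0_pihalf// x1 andbT; have := pihalf_02 R; lra.
  rewrite /hdens /pull /radial rho_polar pull_zharm -expr2 !exprMn trig mulr1 /sinx /cosx /=.
  by rewrite !mulr_gt0// ?exprn_gt0.
Qed.

(* The pair (a, b) is the eigenfunction 4 (a + 1) (b + 1): a - b is the angular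
   frequency. *)
Definition pairfun (ab : nat * nat) : R * R -> R :=
  efun (ab.1 < ab.2)%N (ab.1 - ab.2 + (ab.2 - ab.1))%N (minn ab.1 ab.2).

Definition pairval (ab : nat * nat) : R := 4 * (ab.1.+1%:R * ab.2.+1%:R).

Lemma eigval_pairval (ab : nat * nat) :
  eigval (ab.1 - ab.2 + (ab.2 - ab.1))%N (minn ab.1 ab.2) = pairval ab.
Proof.
rewrite /eigval /pairval; congr (4 * _); rewrite -!natrM; apply: (congr1 (fun i => i%:R)).
case: ab => a b /=; case: (leqP a b) => h; first by congr (_ * _)%N; lia.
by rewrite mulnC; congr (_ * _)%N; lia.
Qed.

Lemma pairfun_ortho ab ab' : ab != ab' ->
  hip (pull (pairfun ab)) (pull (pairfun ab')) = 0.
Proof.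
case: ab => a b; case: ab' => a' b' ne; rewrite /pairfun/=.
set k := (a - b + (b - a))%N; set k' := (a' - b' + (b' - a'))%N.
have [kk|kk] := eqVneq k k'; last by rewrite !pull_efun; exact: radial_hip_freq_eq0.
rewrite -kk; have [bb|bb] := eqVneq (a < b)%N (a' < b')%N.
  rewrite -bb; have [mm|mm] := eqVneq (minn a b) (minn a' b'); last exact: efun_diff_level.
  exfalso; move/eqP: ne; apply; move: kk bb mm; rewrite /k /k'.
  by case: ltnP => h1; case: ltnP => h2 // ? _ ?; congr (_, _); lia.
have -> : (a' < b')%N = ~~ (a < b)%N by move: bb; case: (a < b)%N; case: (a' < b')%N.
rewrite !pull_efun; apply: radial_hip_parity_eq0; rewrite lt0n; apply/eqP => k0.
by move: bb k0 kk; rewrite /k /k'; case: ltnP => h1; case: ltnP => h2 // _; lia.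
Qed.

Lemma pairfun_norm_gt0 ab : 0 < hip (pull (pairfun ab)) (pull (pairfun ab)).
Proof.
apply: efun_norm_gt0; case: ab => a b /=; case: ltnP => h //=.
by rewrite -leqNgt; lia.
Qed.

Lemma lap_scale (c : R) F y : rsmooth F -> lap (fun z => c * F z) y = c * lap F y.
Proof.
move=> sF; rewrite (@lap_radial_mul _ (fun=> c) (fun=> 0) (fun=> 0))//.
by rewrite !mulr0 mul0r !addr0 mul0r addr0.
Qed.

Definition eignorm ab : R := (Num.sqrt (hip (pull (pairfun ab)) (pull (pairfun ab))))^-1.

(** Cantor's enumeration of pairs turns the double index into a sequence, as the abstract basis
    theory expects. *)
Definition nfun n (y : R * R) : R := eignorm (Cantor.of_nat n) * pairfun (Cantor.of_nat n) y.
Definition eigvaln n : R := pairval (Cantor.of_nat n).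
Definition ebasis n : R * R -> R := pull (nfun n).

Lemma rsmooth_nfun n : rsmooth (nfun n).
Proof. by apply: rsmooth_scale; exact: rsmooth_efun. Qed.

Lemma hL2_ebasis n : hL2 (ebasis n).
Proof. by apply: hL2_scale; exact: hL2_efun. Qed.

Lemma of_nat_inj : injective Cantor.of_nat.
Proof. by move=> m n /(congr1 Cantor.to_nat); rewrite !Cantor.cancel_to_of. Qed.

Lemma ebasis_ortho m n : hip (ebasis m) (ebasis n) = (m == n)%:R.
Proof.
have E : hip (ebasis m) (ebasis n) = eignorm (Cantor.of_nat m) * eignorm (Cantor.of_nat n) *
    hip (pull (pairfun (Cantor.of_nat m))) (pull (pairfun (Cantor.of_nat n))).
  rewrite hipZl; [|exact: hL2_efun|exact: hL2_ebasis].
  by rewrite hipZr ?mulrA//; exact: hL2_efun.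
rewrite E; have [->|mn] := eqVneq m n; last first.
  by rewrite pairfun_ortho ?mulr0//; apply: contra mn => /eqP/of_nat_inj ->.
have h := pairfun_norm_gt0 (Cantor.of_nat n).
rewrite /eignorm -invfM -expr2 sqr_sqrtr ?ltW// mulVf// gt_eqF//.
Qed.

Lemma lop_ebasis n (p : R * R) : hemi p -> lop (ebasis n) p = - eigvaln n * ebasis n p.
Proof.
move=> hp; rewrite lop_pull_hemi//; last exact: rsmooth_nfun.
have := lop_efun ((Cantor.of_nat n).1 < (Cantor.of_nat n).2)%N
  ((Cantor.of_nat n).1 - (Cantor.of_nat n).2 + ((Cantor.of_nat n).2 - (Cantor.of_nat n).1))%N
  (minn (Cantor.of_nat n).1 (Cantor.of_nat n).2) hp.
rewrite lop_pull_hemi//; last exact: rsmooth_efun.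
rewrite eigval_pairval -/(pairfun _) -/(eigvaln n) => h.
rewrite /ebasis /nfun /pull lap_scale; last exact: rsmooth_efun.
move: h; rewrite /pull; move: (lap _ _) (pairfun _ _) (eignorm _) => L P c h.
have -> : sin p.1 * (sinx p * (c * L)) = c * (sin p.1 * (sinx p * L)) by ring.
by rewrite h; ring.
Qed.

End Eigenbasis.

(** * Completeness of the eigenfunctions *)

Section StepLimit.
Context {R : realType}.

Lemma bernoulli_ineq (x : R) n : -1 <= x -> 1 + n%:R * x <= (1 + x) ^+ n.
Proof.
move=> x1; elim: n => [|n IH]; first by rewrite mul0r addr0 expr0.
rewrite exprS; apply: (@le_trans _ _ ((1 + x) * (1 + n%:R * x))); last first.
  by rewrite ler_wpM2l//; lra.
have : 0 <= n%:R * x ^+ 2 by rewrite mulr_ge0 ?sqr_ge0.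
rewrite -natr1; lra.
Qed.

(** With r = t^2, n r^n is (n t^n) t^n, and Bernoulli at 1/t bounds n t^n. *)
Lemma cvg_natmul_expr (r : R) : 0 <= r < 1 -> n%:R * r ^+ n @[n --> \oo] --> 0.
Proof.
move=> /andP[r0 r1]; set t := Num.sqrt r.
have t0 : 0 <= t by rewrite sqrtr_ge0.
have tt : t ^+ 2 = r by rewrite sqr_sqrtr.
have t1 : t < 1 by rewrite -(@ltr_pXn2r _ 2)// ?nnegrE// tt expr1n.
have [t00|tn0] := eqVneq t 0.
  rewrite -tt t00 expr0n/=; apply: cvg_near_cst; near=> n.
  by rewrite expr0n (_ : n == 0%N = false) ?mulr0//; apply/negbTE; rewrite -lt0n; near: n; exists 1%N.
have tpos : 0 < t by rewrite lt_neqAle eq_sym tn0.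
apply: (@squeeze_cvgr _ _ _ _ (fun=> 0) (fun n => (t^-1 - 1)^-1 * t ^+ n)).
- apply: nearW => n; rewrite mulr_ge0 ?exprn_ge0//= -tt -exprM mulnC exprM expr2 mulrA.
  rewrite ler_wpM2r ?exprn_ge0//.
  have d0 : 0 < t^-1 - 1 by rewrite subr_gt0 invf_gt1.
  rewrite -(ler_pM2l d0) divff ?gt_eqF// mulrA -ler_pdivlMr ?exprn_gt0// mul1r mulrC.
  have := @bernoulli_ineq (t^-1 - 1) n; rewrite (addrC 1 (_ - 1)) subrK exprVn => h.
  by rewrite (le_trans _ (h _)) ?lerDr//; lra.
- exact: cvg_cst.
- rewrite -[X in _ --> X](mulr0 (t^-1 - 1)^-1); apply: cvgMr; apply: cvg_expr.
  by rewrite ger0_norm.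
Unshelve. all: by end_near. Qed.

(** Polynomials in s that tend on [0, 1] to the indicator of s < 1/2 while staying between 0 and 1.
    The extra factor n in the exponent forces the limit 0 at s = 1/2 itself. *)
Definition stepseq (s : R) n := (1 - s ^+ n) ^+ (n * 2 ^ n).

Lemma stepseq_bound (s : R) n : 0 <= s <= 1 -> 0 <= stepseq s n <= 1.
Proof.
move=> /andP[s0 s1]; have h0 : 0 <= s ^+ n by rewrite exprn_ge0.
have h1 : s ^+ n <= 1 by rewrite exprn_ile1.
by rewrite /stepseq exprn_ge0 ?subr_ge0// exprn_ile1 ?subr_ge0//; lra.
Qed.

Lemma stepseq_cvg (s : R) : 0 <= s <= 1 ->
  stepseq s n @[n --> \oo] --> ((s < 2^-1)%R%:R : R).
Proof.
move=> s01; have /andP[s0 s1] := s01.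
have [s2|s2] := ltP s 2^-1.
  have e : n%:R * (2 * s) ^+ n @[n --> \oo] --> (0 : R) by apply: cvg_natmul_expr; lra.
  apply: (@squeeze_cvgr _ _ _ _ (fun n => 1 - n%:R * (2 * s) ^+ n) (fun=> 1)).
  - apply: nearW => n; rewrite (andP (stepseq_bound n s01)).2 andbT.
    have h1 : s ^+ n <= 1 by rewrite exprn_ile1.
    have := @bernoulli_ineq (- s ^+ n) (n * 2 ^ n).
    by rewrite natrM natrX exprMn mulrN mulrA; apply; lra.
  - by rewrite -[X in _ --> X](subr0 1); apply: cvgB => //; exact: cvg_cst.
  - exact: cvg_cst.
(* From 1 - s^n <= exp(- s^n) the sequence is at most exp(- n (2 s)^n), and here 2 s >= 1. *)
apply: (@squeeze_cvgr _ _ _ _ (fun=> 0) (fun n => expR (-1) ^+ n)).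
- apply: nearW => n; rewrite (andP (stepseq_bound n s01)).1/= /stepseq.
  have h1 : s ^+ n <= 1 by rewrite exprn_ile1.
  apply: (@le_trans _ _ (expR (- s ^+ n) ^+ (n * 2 ^ n))).
    rewrite lerXn2r ?nnegrE ?expR_ge0 ?subr_ge0//.
    by have := expR_ge1Dx (- s ^+ n); lra.
  rewrite -!expRM_natr ler_expR mulN1r mulNr lerN2 natrM natrX mulrC -mulrA -exprMn.
  rewrite ler_peMr// exprn_ege1//; lra.
- exact: cvg_cst.
- apply: cvg_expr; by rewrite ger0_norm ?expR_ge0// -[ltRHS]expR0 ltr_expR ltrN10.
Qed.

End StepLimit.

(** * A function on the hemisphere whose polynomial moments vanish has vanishing integral over every
    set read on the disc *)

Section MomentProblem.
Context {R : realType}.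
Local Notation mR := (measurableTypeR R).
Local Notation leb := (@lebesgue_measure R).
Local Notation leb2 := (leb \x leb)%E.
Implicit Types (f g P : R * R -> R) (n : nat).

(** Polynomials as the algebra generated by the coordinates: smoothness, boundedness on the disc and
    the inclusion in [zspan] all follow by induction on the construction. *)
Definition polfun := alg (fun f : R * R -> R => f = (fun y => y.1) \/ f = (fun y => y.2)).

Lemma polfun_rsmooth P : polfun P -> rsmooth P.
Proof.
apply: alg_rsmooth => [f p [->|->]|f v [->|->]].
- exact: differentiable_fst.
- exact: differentiable_snd.
- by rewrite dd_fst; exact: alg_cst.
- by rewrite dd_snd; exact: alg_cst.
Qed.

Lemma polfun_exp P n : polfun P -> polfun (fun y => P y ^+ n).
Proof.
move=> pP; elim: n => [|n IH]; first by under eq_fun do rewrite expr0; exact: alg_cst.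
by under eq_fun do rewrite exprS; exact: alg_mul.
Qed.

Definition coordinate (b : bool) (y : R * R) : R := if b then y.1 else y.2.

Lemma polfun_coordinate b : polfun (coordinate b).
Proof. by apply: alg_base; case: b; [left|right]. Qed.

(* Affine rescaling that maps a to 1/2 and the values of a coordinate on the
   disc into [0, 1] *)
Definition rescale (a t : R) : R := 2^-1 + (t - a) / (2 * (2 + `|a|)).

Lemma rescale_lt (a t : R) : (rescale a t < 2^-1) = (t < a).
Proof.
by rewrite /rescale gtrDl pmulr_llt0 ?subr_lt0// invr_gt0 mulr_gt0// ltr_wpDr.
Qed.

Lemma rescale_itv (a t : R) : `|t| <= 1 -> 0 <= rescale a t <= 1.
Proof.
rewrite ler_norml => /andP[t0 t1].
have a0 := normr_ge0 a; have a1 := ler_norm a; have := ler_norm (- a); rewrite normrN => a2.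
have d0 : 0 < 2 * (2 + `|a|) by lra.
have e : (t - a) / (2 * (2 + `|a|)) * (2 * (2 + `|a|)) = t - a.
  by rewrite mulfVK// gt_eqF.
by rewrite /rescale; apply/andP; split; nra.
Qed.

Lemma coordinate_disc b y : rho y <= 1 -> `|coordinate b y| <= 1.
Proof.
rewrite /rho => y1; rewrite -(@ler_pXn2r _ 2)// ?nnegrE// real_normK ?num_real// expr1n.
by have := sqr_ge0 y.1; have := sqr_ge0 y.2; case: b => /=; lra.
Qed.

Lemma polfun_step b (a : R) n : polfun (fun y => stepseq (rescale a (coordinate b y)) n).
Proof.
apply: (@polfun_exp (fun y => 1 - rescale a (coordinate b y) ^+ n)).
have pr : polfun (fun y => rescale a (coordinate b y)).
  apply: alg_add; first exact: alg_cst.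
  apply: alg_mul; last exact: alg_cst.
  by apply: alg_add; [exact: polfun_coordinate|exact: alg_cst].
apply: alg_add; first exact: alg_cst.
have -> : (fun y => - rescale a (coordinate b y) ^+ n) =
    (fun y => -1 * rescale a (coordinate b y) ^+ n).
  by apply/funext => y; rewrite mulN1r.
by apply: alg_mul; [exact: alg_cst|exact: polfun_exp].
Qed.

Lemma measurable_polar : measurable_fun setT (polar : mR * mR -> mR * mR).
Proof.
apply/prod_measurable_funP; split.
- apply: continuous_measurable_plane; apply: rsmooth_continuous.
  exact: (rsmooth_mul (@rsmooth_cosx R) (@rsmooth_cosphi R)).
- apply: continuous_measurable_plane; apply: rsmooth_continuous.
  exact: (rsmooth_mul (@rsmooth_cosx R) (@rsmooth_sinphi R)).
Qed.

Lemma rho_polar_le1 (p : R * R) : rho (polar p) <= 1.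
Proof. by rewrite rho_polar -(cos2Dsin2 p.1) lerDl sqr_ge0. Qed.

Variable h : R * R -> R.
Hypothesis Ih : leb2.-integrable (@hemi R) (EFin \o (h : mR * mR -> R)).

Definition moment f : R := \int[leb2]_(p in hemi) (h p * f (polar p)).

Definition bmeas f (M : R) := measurable_fun setT (f : mR * mR -> R) /\
  forall y, rho y <= 1 -> `|f y| <= M.

Lemma bmeas_mul f g M N : bmeas f M -> bmeas g N -> bmeas (fun y => f y * g y) (M * N).
Proof.
move=> [mf fM] [mg gN]; split; first exact: measurable_funM.
by move=> y y1; rewrite normrM ler_pM ?fM ?gN.
Qed.

Lemma measurable_moment f M : bmeas f M ->
  measurable_fun (@hemi R) (fun p : mR * mR => (h p * f (polar p))%:E).
Proof.
move=> [mf _]; apply/measurable_EFinP; apply: measurable_funM.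
  by apply/measurable_EFinP; exact: measurable_int Ih.
apply: measurable_funTS; exact: measurableT_comp mf measurable_polar.
Qed.

Lemma integrable_moment f M : bmeas f M ->
  leb2.-integrable (@hemi R) (EFin \o (fun p : mR * mR => h p * f (polar p))).
Proof.
move=> bf; have I' := integrable_EFinZl measurable_hemi M Ih.
apply: le_integrable I' => //; first exact: measurable_hemi.
  exact: measurable_moment bf.
move=> p hp /=; rewrite lee_fin !normrM mulrC ler_wpM2r//.
have fM := bf.2 _ (rho_polar_le1 p).
by rewrite (le_trans fM)// ler_norm.
Qed.

Lemma moment_cvg (u : nat -> R * R -> R) f M : (forall n, bmeas (u n) M) ->
  measurable_fun setT (f : mR * mR -> R) ->
  (forall y, rho y <= 1 -> u n y @[n --> \oo] --> f y) ->
  (forall n, moment (u n) = 0) -> moment f = 0.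
Proof.
move=> bu mf uf u0.
have If' := integrable_EFinZl measurable_hemi M Ih.
have Ig := integrable_norm If'.
have mh : measurable_fun (@hemi R) (h : mR * mR -> R).
  by apply/measurable_EFinP; exact: measurable_int Ih.
have mlim : measurable_fun (@hemi R) (fun p : mR * mR => (h p * f (polar p))%:E).
  apply/measurable_EFinP; apply: measurable_funM => //.
  by apply: measurable_funTS; exact: measurableT_comp mf measurable_polar.
have [||_ _] := @dominated_convergence _ _ _ leb2 _ measurable_hemi
    (fun n (p : mR * mR) => (h p * u n (polar p))%:E) _ _
    (fun n => measurable_moment (bu n)) mlim _ Ig.
- apply: nearW => p hp; apply: cvg_EFin; first exact: nearW.
  by apply: cvgMr; apply: uf; exact: rho_polar_le1.
- apply: nearW => p n hp /=; rewrite lee_fin !normrM mulrC ler_wpM2r//.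
  by have := (bu n).2 _ (rho_polar_le1 p) => h1; rewrite (le_trans h1)// ler_norm.
have E n : (\int[leb2]_(p in hemi) (h p * u n (polar p))%:E = 0)%E.
  have := u0 n; rewrite /moment /Rintegral => h0.
  by rewrite -[LHS]fineK ?h0//; exact: (integrable_fin_num measurable_hemi (integrable_moment (bu n))).
have -> : (fun n => \int[leb2]_(p in hemi) (h p * u n (polar p))%:E)%E = (fun=> 0%E).
  by apply/funext.
by move=> /(cvg_unique _ (cvg_cst _)) h0; rewrite /moment /Rintegral -h0.
Qed.

Lemma momentB f g M N : bmeas f M -> bmeas g N ->
  moment (fun y => f y - g y) = moment f - moment g.
Proof.
move=> bf bg; rewrite /moment -RintegralB; first last.
- exact: integrable_moment bg.
- exact: integrable_moment bf.
- exact: measurable_hemi.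
by apply: eq_Rintegral => p _; rewrite mulrBr.
Qed.

Lemma momentD f g M N : bmeas f M -> bmeas g N ->
  moment (fun y => f y + g y) = moment f + moment g.
Proof.
move=> bf bg; rewrite /moment -RintegralD; first last.
- exact: integrable_moment bg.
- exact: integrable_moment bf.
- exact: measurable_hemi.
by apply: eq_Rintegral => p _; rewrite mulrDr.
Qed.

Lemma polfun_measurable P : polfun P -> measurable_fun setT (P : mR * mR -> R).
Proof.
by move=> /polfun_rsmooth/rsmooth_continuous; exact: continuous_measurable_plane.
Qed.

Lemma polfun_bmeas P : polfun P -> exists M, bmeas P M.
Proof.
move=> pP; suff [M PM] : exists M, forall y, rho y <= 1 -> `|P y| <= M.
  by exists M; split => //; exact: polfun_measurable.
elim: pP => {P} [f [->|->]|c|f g _ [M fM] _ [N gN]|f g _ [M fM] _ [N gN]].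
- by exists 1; exact: (coordinate_disc true).
- by exists 1; exact: (coordinate_disc false).
- by exists `|c|.
- exists (M + N) => y y1; apply: (le_trans (ler_normD _ _)).
  by rewrite lerD ?fM ?gN.
- by exists (M * N) => y y1; rewrite normrM ler_pM ?fM ?gN.
Qed.

Lemma measurable_halfplane b (a : R) :
  measurable ([set y : R * R | coordinate b y < a] : set (mR * mR)).
Proof.
have := polfun_measurable (polfun_coordinate b) measurableT (measurable_itv `]-oo, a[).
rewrite setTI (_ : _ @^-1` _ = [set y : R * R | coordinate b y < a])//.
Qed.

(** Finite intersections of half-planes parallel to the axes: concatenating lists intersects cells,
    which makes them a pi-system. *)
Definition cell (l : seq (bool * R)) (y : R * R) : bool :=
  all (fun t => coordinate t.1 y < t.2) l.

Lemma measurable_cell l : measurable ([set y | cell l y] : set (mR * mR)).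
Proof.
elim: l => [|[b a] l IH].
  by rewrite (_ : [set y | _] = setT)//; apply/seteqP.
rewrite (_ : [set y | _] = [set y | coordinate b y < a] `&` [set y | cell l y]).
  by apply: measurableI => //; exact: measurable_halfplane.
by apply/seteqP; split=> y /=; [move=> /andP[]|move=> [? ?]; apply/andP].
Qed.

Definition ind (S : set (R * R)) (y : R * R) : R := \1_S y.

Lemma bmeas_ind (S : set (mR * mR)) : measurable S -> bmeas (ind S) 1.
Proof.
move=> mS; split; first exact: measurable_indic.
by move=> y _; rewrite /ind indicE; case: (_ \in _); rewrite ?normr1 ?normr0.
Qed.

Hypothesis hP : forall P, polfun P -> moment P = 0.

(** Each half-plane is added by multiplying with step polynomials and passing to the limit. The
    factor P is arbitrary so that the induction hypothesis absorbs the step polynomial. *)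
Lemma moment_cell l P : polfun P -> moment (fun y => P y * ind [set y | cell l y] y) = 0.
Proof.
elim: l P => [|[b a] l IH] P pP.
  rewrite -[RHS](hP pP); congr moment; apply/funext => y.
  by rewrite /ind indicE mem_set// mulr1.
have [M bP] := polfun_bmeas pP.
pose u n y := P y * stepseq (rescale a (coordinate b y)) n * ind [set y | cell l y] y.
apply: (@moment_cvg u _ (M * 1 * 1)).
- move=> n; apply: bmeas_mul; last by apply: bmeas_ind; exact: measurable_cell.
  apply: bmeas_mul => //; split; first by apply: polfun_measurable; exact: polfun_step.
  move=> y y1; have /andP[s0 s1] := stepseq_bound n (rescale_itv a (coordinate_disc b y1)).
  by rewrite ger0_norm.
- apply: measurable_funM; first exact: polfun_measurable.
  by apply: measurable_indic; exact: measurable_cell.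
- move=> y y1.
  have -> : P y * ind [set y | cell ((b, a) :: l) y] y =
      P y * (rescale a (coordinate b y) < 2^-1)%R%:R * ind [set y | cell l y] y.
    rewrite rescale_lt /ind !indicE !mem_setE /cell/= -mulrA -natrM mulnb.
    by [].
  apply: cvgMl; apply: cvgMr; apply: stepseq_cvg; exact/rescale_itv/coordinate_disc.
- by move=> n; apply: IH; apply: alg_mul => //; exact: polfun_step.
Qed.

Let cells : set (set (mR * mR)) := [set S | exists l, S = [set y | cell l y]].

Let cells_setI : setI_closed cells.
Proof.
move=> _ _ [l ->] [l' ->]; exists (l ++ l'); apply/seteqP.
by split=> y /=; rewrite /cell all_cat => /andP.
Qed.

Let cells_generate : @measurable _ (mR * mR)%type = <<s cells >>.
Proof.
apply/seteqP; split; last first.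
  apply: smallest_sub; first exact: sigma_algebra_measurable.
  by move=> _ [l ->]; exact: measurable_cell.
rewrite measurable_prod_measurableType; apply: smallest_sub.
  exact: smallest_sigma_algebra.
move=> _ [A mA [B mB <-]].
have mc b : measurable_fun (setT : set (g_sigma_algebraType cells)) (coordinate b : _ -> mR).
  apply: (measurability _ (RGenInftyO.measurableE R)).
  move=> _ [_ [a ->] <-]; rewrite setTI; apply: sub_sigma_algebra.
  by exists [:: (b, a)]; apply/seteqP; split => y /=; rewrite in_itv/= /cell/= andbT.
have m1 := mc true measurableT A mA; have m2 := mc false measurableT B mB.
have := @measurableI _ (g_sigma_algebraType cells) _ _ m1 m2.
rewrite !setTI; congr (measurable _).
Qed.

(** Dynkin's theorem: the cells generate the sigma-algebra, and the sets of zero moment form a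
    lambda-system. *)
Lemma moment_measurable_set (S : set (mR * mR)) : measurable S -> moment (ind S) = 0.
Proof.
move=> mS; have pi_cell l : moment (ind [set y | cell l y]) = 0.
  rewrite -[RHS](moment_cell l (alg_cst _ 1)); congr moment.
  by apply/funext => y; rewrite mul1r.
have mT : moment (ind setT) = 0.
  rewrite -[RHS](pi_cell [::]); congr (moment (ind _)); exact/seteqP.
have := mS; rewrite {1}cells_generate => sS.
apply: (@dynkin_induction _ _ cells (fun S => moment (ind S) = 0) cells_generate cells_setI mT) sS.
- by move=> _ [l ->].
- move=> A mA A0.
  have -> : ind (~` A) = fun y => ind setT y - ind A y.
    by apply/funext => y; rewrite /ind !indicE in_setC in_setT; case: (_ \in _); rewrite ?subrr ?subr0.
  by rewrite (momentB (bmeas_ind measurableT) (bmeas_ind mA)) mT A0 subrr.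
- move=> F mF tF F0.
  (* Additivity handles the finite partial unions, dominated convergence the countable one. *)
  pose U n := \big[setU/set0]_(k < n) F k.
  have mU n : measurable (U n) by apply: bigsetU_measurable.
  have U0 n : moment (ind (U n)) = 0.
    elim: n => [|n IH].
      rewrite /U big_ord0 /moment (_ : Rintegral _ _ _ = Rintegral leb2 hemi (cst 0)).
        by rewrite Rintegral_cst ?mul0r//; exact: measurable_hemi.
      by apply: eq_Rintegral => p _; rewrite /ind indicE in_set0 mulr0.
    have -> : ind (U n.+1) = fun y => ind (U n) y + ind (F n) y.
      apply/funext => y; rewrite /ind /U big_ord_recr/= !indicE in_setU.
      case yU : (y \in \big[setU/set0]_(i < n) F i) => /=; last by rewrite add0r.
      case yF : (y \in F n); last by rewrite addr0.
      exfalso; move/set_mem: yU; rewrite -bigcup_mkord => -[k /= kn Fk].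
      have kE : k = n by apply: tF => //; exists y; split => //; exact: set_mem.
      by rewrite kE ltnn in kn.
    by rewrite (momentD (bmeas_ind (mU n)) (bmeas_ind (mF n))) IH F0 addr0.
  apply: (@moment_cvg (fun n => ind (U n)) _ 1) => //.
  + by move=> n; exact: bmeas_ind.
  + by apply: measurable_indic; exact: bigcup_measurable.
  + move=> y _; rewrite /ind indicE; case: (boolP (y \in _)) => [/set_mem[k _ Fk]|yF].
      apply: cvg_near_cst; near=> n; rewrite indicE mem_set// /U -bigcup_mkord.
      by exists k => //=; near: n; exists k.+1.
    apply: cvg_near_cst; near=> n; rewrite indicE (_ : (y \in U n) = false)//.
    apply/negbTE; apply: contra yF => /set_mem; rewrite /U -bigcup_mkord => -[k _ Fk].
    by apply/mem_set; exists k.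
Unshelve. all: by end_near. Qed.

End MomentProblem.

(** * Measurable inverse of the polar map, and completeness of the eigenbasis *)

Section Completeness.
Context {R : realType}.
Local Notation mR := (measurableTypeR R).
Local Notation leb := (@lebesgue_measure R).
Local Notation leb2 := (leb \x leb)%E.
Implicit Types (P F G : R * R -> R) (b : bool) (i k m n : nat).

(** Cut to the open interval where [acos] is continuous, for measurability. The default 0 outside is
    the right value at cos 0 = 1; the value -1 is never reached below pi. *)
Definition acos_itv (t : R) : R := (acos \_ `]-1, 1[%classic) t.

Lemma measurable_acos_itv : measurable_fun setT (acos_itv : mR -> mR).
Proof.
apply/(measurable_restrictT (acos : mR -> mR)); first exact: measurable_itv.
apply: open_continuous_measurable_fun; first exact: interval_open.
by move=> x; rewrite inE/= in_itv/=; exact: continuous_acos.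
Qed.

Lemma acos_itvK (x : R) : 0 <= x < pi -> acos_itv (cos x) = x.
Proof.
move=> /andP[x0 x1]; rewrite /acos_itv /patch.
have xc : acos (cos x) = x by apply: cosK; rewrite in_itv/= x0 ltW.
have [->|xn0] := eqVneq x 0.
  by rewrite cos0 mem_setE in_itv/= ltxx andbF.
have xpos : 0 < x by rewrite lt_neqAle eq_sym xn0.
rewrite mem_setE in_itv/= -{2}(@cos0 R) -cospi !ltr_cos ?in_itv/= ?x0 ?(ltW x1) ?lexx ?pi_ge0//.
by rewrite xpos x1.
Qed.

(** This is cos (phi / 2), recovered from cos phi and the sign of sin phi. The arc cosine covers
    only half a turn, so it is applied to phi / 2, which ranges over [0, pi[. *)
Definition half_angle (y : R * R) : R :=
  (if 0 <= y.2 then 1 else -1) * Num.sqrt ((1 + y.1 / Num.sqrt (rho y)) / 2).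

Definition unpolar (y : R * R) : R * R :=
  (acos_itv (Num.sqrt (rho y)), 2 * acos_itv (half_angle y)).

Lemma polarK (p : R * R) : hemi p -> unpolar (polar p) = p.
Proof.
move=> hp; have [s0 c0 _ _] := hemi_trig hp.
case: p hp s0 c0 => x phi [/=]; rewrite !in_itv/= => /andP[x0 x1] /andP[f0 f1] s0 c0.
have pp := pi_gt0 R.
have r : Num.sqrt (rho (polar (x, phi))) = cos x by rewrite rho_polar sqrtr_sqr gtr0_norm.
rewrite /unpolar r acos_itvK ?(ltW x0)//=; last by lra.
congr (_, _); suff -> : half_angle (polar (x, phi)) = cos (phi / 2).
  by rewrite acos_itvK; [field|apply/andP; split; lra].
rewrite /half_angle r /= mulrAC divff ?gt_eqF// mul1r pmulr_rge0//.
have e1 : phi = phi / 2 + phi / 2 by field.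
have cE : (1 + cos phi) / 2 = cos (phi / 2) ^+ 2.
  rewrite {1}e1 cosD -!expr2; have := cos2Dsin2 (phi / 2).
  by move=> /(canRL (addKr _)) ->; field.
rewrite cE sqrtr_sqr.
have [fp|fp] := leP phi pi.
  have ch : 0 <= cos (phi / 2) by rewrite cos_ge0_pihalf//; apply/andP; split; lra.
  by rewrite sin_ge0_pi ?f0 ?fp// mul1r ger0_norm.
have ch : cos (phi / 2) < 0.
  have -> : phi / 2 = (phi / 2 - pi) + pi by ring.
  rewrite cosDpi oppr_lt0 cos_gt0_pihalf//; apply/andP; split; lra.
have sn : sin phi < 0.
  have -> : phi = (phi - pi) + pi by ring.
  rewrite sinDpi oppr_lt0 sin_gt0_pi//; apply/andP; split; lra.
by rewrite leNgt sn/= mulN1r ltr0_norm// opprK.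
Qed.

Lemma measurable_sqrt_comp (f : mR * mR -> mR) : measurable_fun setT f ->
  measurable_fun setT (fun y => Num.sqrt (f y) : mR).
Proof.
move=> mf; apply: (@measurableT_comp _ _ _ _ _ _ (@Num.sqrt R : mR -> mR)) => //.
by apply: continuous_measurable_fun; exact: sqrt_continuous.
Qed.

Lemma measurable_unpolar : measurable_fun setT (unpolar : mR * mR -> mR * mR).
Proof.
have mr : measurable_fun setT (rho : mR * mR -> mR).
  by apply: continuous_measurable_plane; apply: rsmooth_continuous; exact: rsmooth_rho.
have msr := measurable_sqrt_comp mr.
have mfst : measurable_fun setT (fst : mR * mR -> mR) by exact: measurable_fst.
have msnd : measurable_fun setT (snd : mR * mR -> mR) by exact: measurable_snd.
have minv : measurable_fun setT (fun y : mR * mR => (Num.sqrt (rho y))^-1 : mR).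
  have -> : (fun y : mR * mR => (Num.sqrt (rho y))^-1) =
      (fun y : mR * mR => ((fun t : R => t^-1) \_ `]0, +oo[%classic) (Num.sqrt (rho y))).
    apply/funext => y; rewrite /patch mem_setE in_itv/= andbT.
    case: ltP => // h; have -> : Num.sqrt (rho y) = 0 by apply/le_anti; rewrite h sqrtr_ge0.
    by rewrite invr0.
  apply: (@measurableT_comp _ _ _ _ _ _ ((fun t : R => t^-1) \_ `]0, +oo[%classic : mR -> mR)) => //.
  apply/(measurable_restrictT (@GRing.inv R : mR -> mR)); first exact: measurable_itv.
  apply: open_continuous_measurable_fun; first exact: interval_open.
  by move=> t; rewrite inE/= in_itv/= andbT => t0; apply: inv_continuous; exact: lt0r_neq0.
have mcut : measurable_fun setT (fun y : mR * mR => if 0 <= y.2 then 1 else -1 : mR).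
  apply: measurable_fun_ifT; [|exact: measurable_cst..].
  by apply: measurable_fun_ler => //; exact: measurable_cst.
have mhalf : measurable_fun setT (half_angle : mR * mR -> mR).
  apply: measurable_funM => //; apply: measurable_sqrt_comp.
  apply: measurable_funM; last exact: measurable_cst.
  apply: measurable_funD; first exact: measurable_cst.
  exact: measurable_funM.
apply/prod_measurable_funP; split.
  exact: (measurableT_comp measurable_acos_itv msr).
apply: measurable_funM; first exact: measurable_cst.
exact: (measurableT_comp measurable_acos_itv mhalf).
Qed.

(** With S the image on the disc of the set where h > 0, |h| = 2 h 1_S - h, and both terms have zero
    integral. The map [unpolar] serves to exhibit S as a measurable set. *)
Lemma moments_eq0 (h : R * R -> R) :
  leb2.-integrable (@hemi R) (EFin \o (h : mR * mR -> R)) ->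
  (forall P, polfun P -> moment h P = 0) ->
  (\int[leb2]_(p in hemi) `|(h p)%:E| = 0)%E.
Proof.
move=> Ih hP; have mh : measurable_fun (@hemi R) (h : mR * mR -> R).
  by apply/measurable_EFinP; exact: measurable_int Ih.
pose A : set (mR * mR) := @hemi R `&` [set p | 0 < h p].
have mA : measurable A.
  have := mh measurable_hemi _ (measurable_itv `]0, +oo[).
  rewrite (_ : _ `&` _ = A)//; apply/seteqP; split=> p [hp] /=; rewrite /A/= in_itv/= andbT => h0; by split.
pose S : set (mR * mR) := unpolar @^-1` A.
have mS : measurable S by rewrite -[S]setTI; exact: (measurable_unpolar measurableT).
have S0 := moment_measurable_set Ih hP mS.
have T0 := hP _ (alg_cst _ 1).
have bS := integrable_moment Ih (bmeas_ind mS).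
have bT : leb2.-integrable (@hemi R) (EFin \o (fun p : mR * mR => h p * 1)).
  by apply: eq_integrable Ih => [|p _]; [exact: measurable_hemi|rewrite /= mulr1].
have : \int[leb2]_(p in hemi) (2 * (h p * ind S (polar p)) + (-1) * (h p * 1)) = 0.
  rewrite RintegralD ?RintegralZl//; first by rewrite -/(moment h (ind S)) -/(moment h (fun=> 1)) S0 T0 !mulr0 addr0.
  all: try exact: measurable_hemi.
  - by apply: integrable_EFinZl => //; exact: measurable_hemi.
  - by apply: integrable_EFinZl => //; exact: measurable_hemi.
have E (p : mR * mR) : p \in (@hemi R) -> 2 * (h p * ind S (polar p)) + (-1) * (h p * 1) = `|h p|.
  rewrite inE => hp; have -> : ind S (polar p) = (0 < h p)%R%:R.
    rewrite /ind indicE /S; congr (nat_of_bool _)%:R.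
    apply/idP/idP => [/set_mem|h0]; first by rewrite /preimage/= polarK// => -[].
    by apply/mem_set; rewrite /preimage/= polarK.
  case: ltP => h0 /=; first by rewrite gtr0_norm// mulr1n; ring.
  by rewrite ler0_norm// mulr0n; ring.
have -> : \int[leb2]_(p in hemi) (2 * (h p * ind S (polar p)) + (-1) * (h p * 1)) =
    \int[leb2]_(p in hemi) `|h p| by exact: eq_Rintegral.
rewrite /Rintegral => H.
have In : leb2.-integrable (@hemi R) (EFin \o (fun p : mR * mR => `|h p|)).
  exact: (integrable_norm Ih).
by rewrite -[LHS]fineK ?H//; exact: (integrable_fin_num measurable_hemi In).
Qed.

(** The functions that products (polynomial in rho) times (harmonic) can reach; closure under both
    coordinates will show that these are all polynomials. *)
Inductive zspan : (R * R -> R) -> Prop :=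
| zspan_base i b k : zspan (fun y => rho y ^+ i * zharm b k y)
| zspan_add F G : zspan F -> zspan G -> zspan (fun y => F y + G y)
| zspan_scale c F : zspan F -> zspan (fun y => c * F y).

(** This is |z|^2 z^k = conj(z) z^(k+1). *)
Lemma rho_zharm b k (y : R * R) : rho y * zharm b k y =
  y.1 * zharm b k.+1 y - (-1) ^+ (~~ b) * (y.2 * zharm (~~ b) k.+1 y).
Proof. by rewrite !zharmS negbK /rho; case: b => /=; ring. Qed.

(** y_1 = (z + conj z) / 2, so y_1 z^(k+1) is the half-sum of z^(k+2) and rho z^k; degree 0 is
    apart, having no lower power. The second coordinate is (z - conj z) / (2 i). *)
Lemma zspan_mul_fst F : zspan F -> zspan (fun y => y.1 * F y).
Proof.
elim => {F} [i b [|k]|F G _ IF _ IG|c F _ IF].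
- have -> : (fun y : R * R => y.1 * (rho y ^+ i * zharm b 0 y)) =
     fun y => (~~ b)%:R * (rho y ^+ i * zharm false 1 y).
    by apply/funext => y; rewrite zharmS !zharm0 /=; ring.
  exact/zspan_scale/zspan_base.
- have -> : (fun y : R * R => y.1 * (rho y ^+ i * zharm b k.+1 y)) =
     fun y => 2^-1 * (rho y ^+ i * zharm b k.+2 y + rho y ^+ i.+1 * zharm b k y).
    apply/funext => y; rewrite exprS -mulrA (mulrCA (rho y)) rho_zharm (zharmS b k.+1).
    by field.
  by apply: zspan_scale; apply: zspan_add; exact: zspan_base.
- by under eq_fun do rewrite mulrDr; exact: zspan_add.
- by under eq_fun do rewrite mulrCA; exact: zspan_scale.
Qed.

Lemma zspan_mul_snd F : zspan F -> zspan (fun y => y.2 * F y).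
Proof.
elim => {F} [i b [|k]|F G _ IF _ IG|c F _ IF].
- have -> : (fun y : R * R => y.2 * (rho y ^+ i * zharm b 0 y)) =
     fun y => (~~ b)%:R * (rho y ^+ i * zharm true 1 y).
    by apply/funext => y; rewrite zharmS !zharm0 /=; ring.
  exact/zspan_scale/zspan_base.
- have -> : (fun y : R * R => y.2 * (rho y ^+ i * zharm b k.+1 y)) =
     fun y => ((-1) ^+ b * 2^-1) * (rho y ^+ i * zharm (~~ b) k.+2 y
       + (-1) * (rho y ^+ i.+1 * zharm (~~ b) k y)).
    apply/funext => y; have -> : rho y ^+ i.+1 * zharm (~~ b) k y = rho y ^+ i * (rho y * zharm (~~ b) k y).
      by rewrite exprS; ring.
    by rewrite rho_zharm (zharmS (~~ b) k.+1) negbK; case: b => /=; field.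
  apply: zspan_scale; apply: zspan_add; first exact: zspan_base.
  exact/zspan_scale/zspan_base.
- by under eq_fun do rewrite mulrDr; exact: zspan_add.
- by under eq_fun do rewrite mulrCA; exact: zspan_scale.
Qed.

Lemma polfun_mul_zspan P F : polfun P -> zspan F -> zspan (fun y => P y * F y).
Proof.
move=> pP; elim: pP F => {P} [f [->|->]|c|f g _ If _ Ig|f g _ If _ Ig] F zF.
- exact: zspan_mul_fst.
- exact: zspan_mul_snd.
- exact: zspan_scale.
- by under eq_fun do rewrite mulrDl; apply: zspan_add; [exact: If|exact: Ig].
- by under eq_fun do rewrite -mulrA; apply: If; exact: Ig.
Qed.

Lemma polfun_zspan P : polfun P -> zspan P.
Proof.
move=> pP; have := polfun_mul_zspan pP (zspan_base 0 false 0).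
by under eq_fun do rewrite expr0 mul1r zharm0 mulr1.
Qed.

Lemma zspan_rsmooth F : zspan F -> rsmooth F.
Proof.
elim => {F} [i b k|F G _ sF _ sG|c F _ sF].
- apply: rsmooth_mul; last exact: rsmooth_zharm.
  exact/rsmooth_exp/rsmooth_rho.
- exact: rsmooth_add.
- exact: rsmooth_scale.
Qed.

Section Orthogonal.
Variable g : R * R -> R.
Hypothesis Lg : hL2 g.
Hypothesis g_ortho : forall n, hip g (ebasis n) = 0.

Local Notation orth F := (hip g (sin2pull F) = 0).

Let hipD F G : rsmooth F -> rsmooth G ->
  hip g (sin2pull (fun y => F y + G y)) = hip g (sin2pull F) + hip g (sin2pull G).
Proof.
move=> sF sG; rewrite -hipDr; [|exact: Lg|exact: hL2_sin2pull..].
by apply: wip_ext => // p _; rewrite /sin2pull /pull; ring.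
Qed.

Let hipZ c F : rsmooth F ->
  hip g (sin2pull (fun y => c * F y)) = c * hip g (sin2pull F).
Proof.
move=> sF; rewrite -hipZr; [|exact: Lg|exact: hL2_sin2pull].
by apply: wip_ext => // p _; rewrite /sin2pull /pull; ring.
Qed.

Lemma orth_eigpoly b k m : orth (radial (eigpoly k m) b k).
Proof.
have [kb|kb] := boolP ((k == 0%N) && b).
  (* Frequency 0 has no imaginary harmonic: the function is 0 and no basis element corresponds to
     it. *)
  move/andP: kb => [/eqP -> ->].
  rewrite (_ : radial _ _ _ = fun y => 0 * radial (eigpoly 0 m) true 0 y); last first.
    by apply/funext => y; rewrite /radial zharm0 !mulr0.
  by rewrite hipZ ?mul0r//; exact: rsmooth_radial.
(* The pair with minimum m and difference k, ordered according to b: the inverse of the indexing in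
   [pairfun]. *)
pose ab : nat * nat := if b then (m, m + k)%N else (m + k, m)%N.
have pE : pairfun ab = efun b k m :> (R * R -> R).
  rewrite /pairfun /ab; case: b kb {ab} => kb /=.
    rewrite andbT in kb; congr efun; [|lia|lia].
    by rewrite -[X in (X < _)%N]addn0 ltn_add2l lt0n.
  by congr efun; [apply/negbTE; rewrite -leqNgt leq_addr|lia|lia].
have := g_ortho (Cantor.to_nat ab); rewrite /ebasis /nfun Cantor.cancel_of_to.
have -> : pull (fun y : R * R => eignorm ab * pairfun ab y) =
    (fun p => eignorm ab * sin2pull (radial (eigpoly k m) b k) p).
  by apply/funext => p; rewrite -pull_efun /pull pE.
rewrite hipZr; [|exact: Lg|by apply: hL2_sin2pull; exact: rsmooth_radial].
by move/eqP; rewrite mulf_eq0 /eignorm invr_eq0 sqrtr_eq0 leNgt pairfun_norm_gt0/= => /eqP.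
Qed.

(** The leading coefficient: no factor j < m vanishes because the eigenvalues at fixed k are
    distinct. So [eigpoly k m] has degree exactly m, and these polynomials are triangular. *)
Lemma eigcoef_neq0 k m : eigcoef k m m != 0 :> R.
Proof.
apply/prodf_neq0 => i _; rewrite subr_eq0 eq_sym; apply/eqP => h.
have := @eigval_gt0 R k i; set E := eigval k i => E0.
have : eigval k m = E by apply: (mulIf (x := E^-1)); rewrite ?invr_eq0 ?gt_eqF// h divff// gt_eqF.
by move=> /eigval_inj mi; have := ltn_ord i; rewrite -mi ltnn.
Qed.

(** Division by a triangular family: subtract the multiple of [eigpoly k n] that kills the top
    coefficient and recurse on the size. *)
Lemma orth_radial q b k : orth (radial q b k).
Proof.
suff : forall n (q : {poly R}), (size q <= n)%N -> orth (radial q b k) by apply.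
elim=> [|n IH] {}q sq.
  rewrite (_ : radial q b k = fun y => 0 * radial q b k y).
    by rewrite hipZ ?mul0r//; exact: rsmooth_radial.
  apply/funext => y; rewrite mul0r /radial.
  by move: sq; rewrite leqn0 size_poly_eq0 => /eqP ->; rewrite horner0 mul0r.
pose c := q`_n / eigcoef k n n.
pose r := q - c *: eigpoly k n.
have rE : radial q b k = fun y => radial r b k y + c * radial (eigpoly k n) b k y.
  by apply/funext => y; rewrite /radial /r hornerD hornerN hornerZ; ring.
rewrite rE hipD ?hipZ; try exact: rsmooth_radial.
  rewrite orth_eigpoly mulr0 addr0; apply: IH.
  apply/leq_sizeP => j; rewrite leq_eqVlt => /predU1P[<-|nj].
    rewrite /r coefB coefZ coef_eigpoly /c mulfVK ?subrr//; exact: eigcoef_neq0.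
  rewrite /r coefB coefZ coef_poly ltnS leqNgt nj/= mulr0 subr0.
  by apply: (leq_sizeP _ _ sq).
by apply: rsmooth_scale; exact: rsmooth_radial.
Qed.

Lemma orth_zspan F : zspan F -> orth F.
Proof.
elim => {F} [i b k|F G zF IF zG IG|c F zF IF].
- rewrite -[RHS](orth_radial 'X^i b k); congr (hip _ (sin2pull _)).
  by apply/funext => y; rewrite /radial hornerXn.
- by rewrite hipD ?IF ?IG ?addr0//; exact: zspan_rsmooth.
- by rewrite hipZ ?IF ?mulr0//; exact: zspan_rsmooth.
Qed.

(** Against (1 - rho) P the weighted product of g is the moment of h = g sin x cos x, and h is
    integrable as the case P = 1. Vanishing moments give h = 0 almost everywhere, hence g = 0, since
    sin x cos x > 0 on the hemisphere. *)
Lemma ebasis_complete : hip g g = 0.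
Proof.
pose h (p : R * R) : R := g p * (sin p.1 * cos p.1).
have hE P (p : mR * mR) : p \in (@hemi R) -> g p * sin2pull P p * wgt p = h p * P (polar p).
  rewrite inE => hp; have [s0 _ _ _] := hemi_trig hp.
  by rewrite wgtE /h /sin2pull /sinx /pull; field; rewrite gt_eqF.
have s1 : rsmooth (fun=> 1 : R) by exact: rsmooth_cst.
have Ih : leb2.-integrable (@hemi R) (EFin \o (h : mR * mR -> R)).
  have := wip_integrable measurable_hemi measurable_wgt wgt_gt0 Lg (hL2_sin2pull s1).
  by apply: eq_integrable => [|p hp]; [exact: measurable_hemi|rewrite /= hE// mulr1].
have hP P : polfun P -> moment h P = 0.
  move=> pP; rewrite -[RHS](orth_zspan (polfun_zspan pP)).
  by apply/esym/eq_Rintegral => p hp; rewrite hE.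
have := moments_eq0 Ih hP => /(ae_eq_integral_abs _ measurable_hemi (measurable_int _ Ih)) h0.
rewrite /hip /wip /Rintegral (_ : integral _ _ _ = \int[leb2]_(p in hemi) (cst 0%E p))%E.
  by rewrite integral_cst ?mul0e//; exact: measurable_hemi.
apply: ae_eq_integral.
- exact: measurable_hemi.
- exact: (measurable_int _ (wip_integrable measurable_hemi measurable_wgt wgt_gt0 Lg Lg)).
- exact: measurable_cst.
- apply: filterS h0 => p /= h0 hp; have [s0 c0 _ _] := hemi_trig hp.
  have := h0 hp; rewrite /h => -[] /eqP.
  by rewrite mulf_eq0 [_ * cos _ == _]gt_eqF ?mulr_gt0// orbF => /eqP ->; rewrite !mul0r.
Qed.

End Orthogonal.

End Completeness.

(** * Approximation by test functions *)

Section CutoffApproximation.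
Context {R : realType}.
Local Notation mR := (measurableTypeR R).
Local Notation leb := (@lebesgue_measure R).
Local Notation leb2 := (leb \x leb)%E.
Implicit Types (F G : R * R -> R) (delta : R).

Definition rtest F := rsmooth F /\ exists2 r : R, r < 1 & forall y, r <= rho y -> F y = 0.

(** The factor e normalizes the cutoff to 1 at s = 1 - t = 1, the pole. [kappa1] and [kappa2] are
    its first two derivatives in t. *)
Definition kappa delta (t : R) : R := expR 1 * lcut delta 0 0 (1 - t).
Definition kappa1 delta (t : R) : R := - (expR 1 * (delta * lcut delta 2 1 (1 - t))).
Definition kappa2 delta (t : R) : R := expR 1 * (delta *
  (- lcut delta 2 2 (1 - t) - delta * 2 * lcut delta 3 2 (1 - t) + delta * lcut delta 4 2 (1 - t))).

Lemma is_derive_onem (h : R -> R) (t d : R) : is_derive (1 - t) 1 h d ->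
  is_derive t 1 (fun x => h (1 - x)) (- d).
Proof.
move=> hd; rewrite -mulrN1; apply: (@is_derive1_comp _ h (fun x => 1 - x)) => //.
rewrite -[X in is_derive _ _ _ X]add0r.
by apply: (@is_deriveB R R R (fun=> 1) (@id R)); exact: is_derive_cst.
Qed.

Lemma is_derive_scale (c : R) (h : R -> R) (t d : R) : is_derive t 1 h d ->
  is_derive t 1 (fun x => c * h x) (c * d).
Proof. exact: (@is_deriveZ R R R h c). Qed.

Section Delta.
Variable delta : R.
Hypothesis delta0 : 0 < delta.

Lemma is_derive_kappa (t : R) : is_derive t 1 (kappa delta) (kappa1 delta t).
Proof.
have := is_derive_scale (expR 1) (is_derive_onem (is_derive_lcut delta0 0 0 (1 - t))).
move=> h; apply: (is_derive_eq h); rewrite /kappa1; ring.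
Qed.

Lemma is_derive_kappa1 (t : R) : is_derive t 1 (kappa1 delta) (kappa2 delta t).
Proof.
have := is_derive_scale (- (expR 1 * delta)) (is_derive_onem (is_derive_lcut delta0 2 1 (1 - t))).
have -> : (fun x : R => - (expR 1 * delta) * lcut delta 2 1 (1 - x)) = kappa1 delta.
  by apply/funext => x; rewrite /kappa1; ring.
move=> h; apply: (is_derive_eq h); rewrite /kappa2; ring.
Qed.

Lemma rsmooth_kappa : rsmooth (fun y => kappa delta (rho y)).
Proof.
apply: rsmooth_scale.
pose H (h : R -> R) := exists n m, h = lcut delta n m.
apply: (@rsmooth_comp1 _ H (fun y => 1 - rho y)); last by exists 0%N, 0%N.
  by apply: rsmooth_sub; [exact: rsmooth_cst|exact: rsmooth_rho].
move=> _ [n [m ->]]; exists (- m%:R), (- delta * n%:R), delta.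
exists (lcut delta n m.+1), (lcut delta n.+1 m.+1), (lcut delta n.+2 m.+1).
split; [by exists n, m.+1|by exists n.+1, m.+1|by exists n.+2, m.+1|move=> x].
exact: is_derive_lcut.
Qed.

Lemma kappa_far t : 1 - t <= expR (- delta^-1) -> [/\ kappa delta t = 0,
  kappa1 delta t = 0 & kappa2 delta t = 0].
Proof.
by move=> h; rewrite /kappa /kappa1 /kappa2 !lcut_eq0// !mulr0 !(subr0, addr0, oppr0) !mulr0.
Qed.

Lemma kappa_itv t : 0 <= t -> 0 <= kappa delta t <= 1.
Proof.
move=> t0; rewrite /kappa /lcut; case: ifPn => [s0|]; last by rewrite mulr0 lexx ler01.
rewrite expr0 mul1r mulr_ge0 ?expR_ge0 ?hexp_ge0//= /hexp; case: ifPn => [u0|]; last by rewrite mulr0.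
rewrite expr0 mul1r -expRD -[leRHS]expR0 ler_expR subr_le0 invf_ge1//.
have : ln (1 - t) <= 0 by apply: ln_le0; lra.
by move=> h; rewrite gerDl pmulr_rle0.
Qed.

Lemma kappa1_bound t : `|(1 - t) * kappa1 delta t| <= expR 1 * (2 * delta).
Proof.
have /andP[h0 h1] := lcut_bound delta 2 1 (1 - t).
rewrite /kappa1 mulrN normrN mulrCA normrM gtr0_norm ?expR_gt0// ler_wpM2l ?expR_ge0//.
rewrite mulrCA normrM gtr0_norm// mulrC ler_wpM2r ?(ltW delta0)//.
by rewrite expr1 in h0 h1; rewrite ger0_norm.
Qed.

(** 38 = 2! + 2 * 3! + 4!, from [lcut_bound] and delta <= 1. *)
Lemma kappa2_bound t : delta <= 1 -> `|(1 - t) ^+ 2 * kappa2 delta t| <= expR 1 * (38 * delta).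
Proof.
move=> d1; have /andP[h0 h1] := lcut_bound delta 2 2 (1 - t).
have /andP[h2 h3] := lcut_bound delta 3 2 (1 - t).
have /andP[h4 h5] := lcut_bound delta 4 2 (1 - t).
rewrite /kappa2 mulrCA normrM gtr0_norm ?expR_gt0// ler_wpM2l ?expR_ge0//.
rewrite mulrCA normrM gtr0_norm// mulrC ler_wpM2r ?(ltW delta0)//.
rewrite (_ : (1 - t) ^+ 2 * _ = - ((1 - t) ^+ 2 * lcut delta 2 2 (1 - t))
  - delta * 2 * ((1 - t) ^+ 2 * lcut delta 3 2 (1 - t))
  + delta * ((1 - t) ^+ 2 * lcut delta 4 2 (1 - t))); last by ring.
move: h0 h1 h2 h3 h4 h5; move: (_ * lcut _ 2 _ _) (_ * lcut _ 3 _ _) (_ * lcut _ 4 _ _) => a b c.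
rewrite (_ : 2`! = 2)%N// (_ : 3`! = 6)%N// (_ : 4`! = 24)%N// => h0 h1 h2 h3 h4 h5.
have b1 : delta * b <= 6 by nra.
have b2 : 0 <= delta * b by rewrite mulr_ge0// ltW.
have c1 : delta * c <= 24 by nra.
have c2 : 0 <= delta * c by rewrite mulr_ge0// ltW.
by rewrite ler_norml; apply/andP; split; lra.
Qed.

End Delta.

Lemma kappa_cvg t : 0 <= t < 1 -> kappa (n.+1%:R^-1) t @[n --> \oo] --> (1 : R).
Proof.
move=> /andP[t0 t1]; set l := ln (1 - t).
have c0 : 1 + n.+1%:R^-1 * l @[n --> \oo] --> (1 : R).
  rewrite -[X in _ --> X]addr0 -(mul0r l); apply: cvgD; first exact: cvg_cst.
  by apply: cvgMl; exact: cvg_harmonic.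
have c1 : expR 1 * expR (- (1 + n.+1%:R^-1 * l)^-1) @[n --> \oo] --> (1 : R).
  rewrite -[X in _ --> X](_ : expR 1 * expR (- 1^-1) = 1); last by rewrite invr1 -expRD subrr expR0.
  apply: cvgMr; apply: continuous_cvg; first exact: continuous_expR.
  by apply: cvgN; apply: cvgV.
apply: cvg_trans c1; apply: near_eq_cvg.
have /cvgrPdist_lt /(_ 1 ltr01) := c0; apply: filterS => n; rewrite ltr_norml => /andP[_ h].
rewrite /kappa /lcut /hexp subr_gt0 t1 -/l.
have -> : 0 < 1 + n.+1%:R^-1 * l by move: h; move: (1 + _) => x; lra.
by rewrite expr0 !mul1r.
Qed.

(** The derivative of ln (sin^2 x + eps). Where sin^2 x > eps it dominates the weight cot x, and its
    integral is explicit, so it measures the support of the cutoff without truncating the domain. *)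
Definition logdens (eps x : R) : R := 2 * sin x * cos x / (sin x ^+ 2 + eps).

Section LogDensity.
Variable eps : R.
Hypothesis e0 : 0 < eps.

Let d0 (x : R) : 0 < sin x ^+ 2 + eps.
Proof. by rewrite ltr_wpDl ?sqr_ge0. Qed.

Lemma continuous_logdens : continuous (logdens eps).
Proof.
move=> x; apply: cvgM.
  by apply: cvgM; [apply: cvgMr; exact: continuous_sin|exact: continuous_cos].
apply: cvgV; first by rewrite gt_eqF.
apply: cvgD; last exact: cvg_cst.
by apply: (@cvgM _ _ _ _ sin sin); exact: continuous_sin.
Qed.

Lemma integrable_logdens :
  leb2.-integrable (@hemi R) (EFin \o (fun p : mR * mR => logdens eps p.1)).
Proof.
apply: (@integrable_hemi_bounded _ _ (2 / eps)).
  apply: measurable_funTS; apply: (@measurableT_comp _ _ _ _ _ _ (logdens eps : mR -> mR)).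
    by apply: continuous_measurable_fun; exact: continuous_logdens.
  exact: measurable_fst.
move=> p hp; have [s0 c0 s1 c1] := hemi_trig hp.
rewrite /logdens ger0_norm; last first.
  by rewrite divr_ge0 ?mulr_ge0 ?(ltW s0) ?(ltW c0) ?(ltW (d0 _)).
apply: ler_pM; rewrite ?invr_ge0 ?(ltW (d0 _))//.
- by rewrite !mulr_ge0 ?(ltW s0) ?(ltW c0).
- by nra.
- by rewrite lef_pV2 ?posrE// lerDr sqr_ge0.
Qed.

Lemma integral_logdens : (\int[leb2]_(p in hemi) (logdens eps p.1)%:E =
   ((ln (1 + eps) - ln eps) * (2 * pi))%:E)%E.
Proof.
pose l (x : R) := ln (sin x ^+ 2 + eps).
have lD (x : R) : is_derive x 1 l (logdens eps x).
  have h1 : is_derive x 1 (fun t : R => sin t ^+ 2) (2 * sin x ^+ 1 * cos x).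
    exact: (is_derive_pow 2 (is_derive_sin x)).
  have h2 : is_derive x 1 (fun t : R => sin t ^+ 2 + eps) (2 * sin x ^+ 1 * cos x + 0).
    by apply: (@is_deriveD R R R (fun t => sin t ^+ 2) (fun=> eps)).
  have h3 := @is_derive1_comp _ (@ln R) _ x _ _ (is_derive1_ln (d0 x)) h2.
  by apply: (is_derive_eq h3); rewrite /logdens expr1 addr0 mulrC.
have md (D : set R) : measurable_fun D (logdens eps : mR -> mR).
  by apply: measurable_funTS; apply: continuous_measurable_fun; exact: continuous_logdens.
have [_ H] := hemi_fubini integrable_logdens; apply: (etrans H).
have pp := pi_gt0 R; have p2 : 0 < pi / 2 :> R by rewrite divr_gt0.
transitivity (\int[leb]_(y in `[0%R, (2 * pi)%R[) (ln (1 + eps) - ln eps)%:E)%E.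
  apply: eq_integral => y _ /=.
  rewrite integral_itv_obnd_cbnd ?integral_itv_bndo_bndc//;
    try by apply/measurable_EFinP; exact: md.
  rewrite (integral_is_derive p2 lD continuous_logdens) /l sin_pihalf sin0 expr1n expr0n/= add0r.
  by [].
rewrite integral_cst; last exact: measurable_itv.
have := @lebesgue_measure_itv R `[0, (2 * pi)[; rewrite /= lte_fin mulr_gt0// => ->.
by rewrite -EFinD subr0 -EFinM.
Qed.

(** With eps = exp(-1/delta) the right side is K^2 times O(1/delta), the logarithmic growth of omega
    near the equator. *)
Lemma support_bound (u : R * R -> R) (K : R) :
  measurable_fun (@hemi R) (u : mR * mR -> R) ->
  (forall p, hemi p -> `|u p| <= K) -> (forall p, hemi p -> sin p.1 ^+ 2 <= eps -> u p = 0) ->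
  hip u u <= K ^+ 2 * ((ln (1 + eps) - ln eps) * (2 * pi)).
Proof.
move=> mu uK u0; have fw := integral_logdens; set L := (_ - _) * _ in fw *.
have le (p : R * R) : hemi p -> u p ^+ 2 * wgt p <= K ^+ 2 * logdens eps p.1.
  move=> hp; have [s0 c0 _ _] := hemi_trig hp.
  have f0 : 0 <= logdens eps p.1.
    by rewrite /logdens divr_ge0 ?mulr_ge0 ?(ltW s0) ?(ltW c0) ?(ltW (d0 _)).
  have [se|se] := leP (sin p.1 ^+ 2) eps.
    by rewrite u0// expr0n/= mul0r mulr_ge0 ?sqr_ge0.
  have u2 : u p ^+ 2 <= K ^+ 2.
    rewrite -[leLHS]real_normK ?num_real// lerXn2r ?nnegrE ?uK//.
    by apply: le_trans (uK p hp).
  apply: ler_pM; rewrite ?sqr_ge0 ?(ltW (wgt_gt0 hp))//.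
  rewrite wgtE /logdens ler_pdivrMr// mulrAC ler_pdivlMr; last exact: d0.
  by nra.
have IK := integrable_EFinZl measurable_hemi (K ^+ 2) integrable_logdens.
have bd : (wsq leb2 (@hemi R) wgt (u : mR * mR -> R) <= (K ^+ 2 * L)%:E)%E.
  rewrite EFinM -fw -(integralZl measurable_hemi integrable_logdens).
  apply: ge0_le_integral.
  - exact: measurable_hemi.
  - by move=> p hp; rewrite lee_fin; apply: mulr_ge0; [exact: sqr_ge0|exact/ltW/wgt_gt0].
  - exact: wsq_measurable measurable_wgt _ mu.
  - exact: (measurable_int _ IK).
  - by move=> p hp; rewrite -EFinM lee_fin; exact: le.
have Lu : hL2 u by split => //; apply: (le_lt_trans bd); exact: ltry.
rewrite -lee_fin; apply: le_trans bd.
by rewrite (wsqE measurable_hemi measurable_wgt wgt_gt0 Lu).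
Qed.

End LogDensity.

Lemma hip_add_sq_le (f g : R * R -> R) : hL2 f -> hL2 g ->
  hip (fun p => f p + g p) (fun p => f p + g p) <= 2 * hip f f + 2 * hip g g.
Proof.
move=> Lf Lg; have := hip_ge0 (fun p => f p - g p).
have S := hL2_add Lf Lg; have D := hL2_sub Lf Lg.
rewrite (hipDl Lf Lg S) (hipBl Lf Lg D) (hipC f (fun p => f p - g p)) (hipC g (fun p => f p - g p)).
rewrite (hipC f (fun p => f p + g p)) (hipC g (fun p => f p + g p)).
rewrite !(hipDl Lf Lg)// !(hipBl Lf Lg)//.
by rewrite (hipC g f); lra.
Qed.

Lemma hL2_kappa_mul delta (v : R * R -> R) : 0 < delta -> hL2 v ->
  hL2 (fun p => (kappa delta (rho (polar p)) - 1) * v p).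
Proof.
move=> d0 Lv; apply: (@wL2_dominated _ _ _ _ _ measurable_hemi _ measurable_wgt wgt_gt0 _ v 1) => //.
  apply: measurable_funM; last exact: (proj1 Lv).
  apply: measurable_funB; last exact: measurable_cst.
  exact: (rsmooth_measurable (rsmooth_pull (rsmooth_kappa d0))).
move=> p _; rewrite exprMn ler_wpM2r ?sqr_ge0//.
by have /andP[h0 h1] := kappa_itv d0 (rho_ge0 (polar p)); nra.
Qed.

(** Dominated convergence with majorant v^2: the cutoff lies in [0, 1] and tends to 1 wherever rho <
    1, that is, on all of the hemisphere. *)
Lemma kappa_mul_cvg (v : R * R -> R) : hL2 v ->
  (fun n => let u p := (kappa n.+1%:R^-1 (rho (polar p)) - 1) * v p in hip u u)
    @ \oo --> (0 : R).
Proof.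
move=> Lv; pose u n (p : R * R) : R := (kappa n.+1%:R^-1 (rho (polar p)) - 1) * v p.
have d0 n : 0 < n.+1%:R^-1 :> R by rewrite invr_gt0.
have Lu n : hL2 (u n) := hL2_kappa_mul (d0 n) Lv.
have Iv := wL2_integrable_sq measurable_wgt wgt_gt0 Lv.
have [||_ _] := @dominated_convergence _ _ _ leb2 _ measurable_hemi
    (fun n (p : mR * mR) => (u n p ^+ 2 * wgt p)%:E) (cst 0%E) _
    (fun n => wsq_measurable measurable_wgt (proj1 (Lu n))) (measurable_cst _) _ Iv.
- apply: nearW => p hp; have [s0 c0 _ _] := hemi_trig hp.
  apply: cvg_EFin; first exact: nearW.
  have t01 : 0 <= rho (polar p) < 1.
    by rewrite rho_ge0/= -subr_gt0 one_sub_rho_polar exprn_gt0.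
  have h1 : u n p @[n --> \oo] --> (0 : R).
    rewrite -[X in _ --> X](mul0r (v p)) -[X in X * _](subrr 1); apply: cvgMl.
    by apply: cvgB; [exact: kappa_cvg|exact: cvg_cst].
  rewrite -[X in _ --> X](mul0r (wgt p)) -[X in X * _](mulr0 0); apply: cvgMl.
  by apply: (@cvgM _ _ _ _ (fun n => u n p) (fun n => u n p)).
- apply: nearW => p n hp /=; rewrite lee_fin.
  rewrite ger0_norm; last exact: mulr_ge0 (sqr_ge0 _) (ltW (wgt_gt0 hp)).
  rewrite ler_wpM2r ?(ltW (wgt_gt0 hp))// exprMn ler_piMl ?sqr_ge0//.
  by have /andP[h0 h1] := kappa_itv (d0 n) (rho_ge0 (polar p)); nra.
rewrite integral_cst ?mul0e; last exact: measurable_hemi.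
move=> /fine_cvg /= h; apply: cvg_trans h; apply: near_eq_cvg; apply: nearW => n /=.
by rewrite -/(wsq leb2 (@hemi R) wgt (u n : mR * mR -> R)) (wsqE measurable_hemi measurable_wgt wgt_gt0 (Lu n)).
Qed.

(** F' is the cutoff times F. Beyond the convergent part (kappa - 1) times the operator on F there
    is a commutator; the factor 1 - rho in F supplies the second power of 1 - rho that [kappa2]
    needs. *)
Lemma cutoff_approximation F G (eps : R) : rsmooth G -> (forall y, F y = (1 - rho y) * G y) ->
  0 < eps -> exists F', rtest F' /\
  (let u p := pull F' p - pull F p in hip u u <= eps) /\
  (let u p := lop (pull F') p - lop (pull F) p in hip u u <= eps).
Proof.
move=> sG FE eps0.
have sF : rsmooth F.
  have -> : F = fun y => (1 - rho y) * G y by apply/funext.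
  by apply: rsmooth_mul => //; apply: rsmooth_sub; [exact: rsmooth_cst|exact: rsmooth_rho].
have LF := hL2_pull_vanishing sG FE; have LlF := hL2_lop_pull sF.
have sE : rsmooth (euler F).
  apply: rsmooth_add; apply: rsmooth_mul; try exact: rsmooth_dd.
  - exact: rsmooth_fst.
  - exact: rsmooth_snd.
have [M1 M1P] := continuous_hemi_bounded (rsmooth_continuous (rsmooth_pull sE)).
have [M2 M2P] := continuous_hemi_bounded (rsmooth_continuous (rsmooth_pull sG)).
(* 8 = 4 * 2 comes from the Euler term, and 160 = 4 * 38 + 4 * 2 from the two terms in G. *)
pose K : R := expR 1 * (8 * `|M1| + 160 * `|M2|).
have c1 := kappa_mul_cvg LF; have c2 := kappa_mul_cvg LlF.
have c3 : (4 * pi * K ^+ 2) * n.+1%:R^-1 @[n --> \oo] --> (0 : R).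
  by rewrite -[X in _ --> X](mulr0 (4 * pi * K ^+ 2)); apply: cvgMr; exact: cvg_harmonic.
have e4 : 0 < eps / 4 by rewrite divr_gt0.
move/cvgrPdist_le/(_ _ eps0): c1 => c1; move/cvgrPdist_le/(_ _ e4): c2 => c2.
move/cvgrPdist_le/(_ _ e4): c3 => c3.
have [n [h1 [h2 h3]]] : exists n, let d := n.+1%:R^-1 in
   hip (fun p => (kappa d (rho (polar p)) - 1) * pull F p) (fun p => (kappa d (rho (polar p)) - 1) * pull F p) <= eps /\
   (hip (fun p => (kappa d (rho (polar p)) - 1) * lop (pull F) p) (fun p => (kappa d (rho (polar p)) - 1) * lop (pull F) p) <= eps / 4 /\
   (4 * pi * K ^+ 2) * d <= eps / 4).
  case: c1 => [n1 _ P1]; case: c2 => [n2 _ P2]; case: c3 => [n3 _ P3].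
  exists (n1 + n2 + n3)%N; split; last split.
  - have /P1 /= : (n1 <= n1 + n2 + n3)%N by rewrite -addnA leq_addr.
    by rewrite sub0r normrN; apply: le_trans; exact: ler_norm.
  - have /P2 /= : (n2 <= n1 + n2 + n3)%N by rewrite addnAC leq_addl.
    by rewrite sub0r normrN; apply: le_trans; exact: ler_norm.
  - have /P3 /= : (n3 <= n1 + n2 + n3)%N by rewrite leq_addl.
    by rewrite sub0r normrN; apply: le_trans; exact: ler_norm.
set d : R := n.+1%:R^-1 in h1 h2 h3.
have d0 : 0 < d by rewrite invr_gt0.
have d1 : d <= 1 by rewrite invf_le1// ler1n.
have sk := rsmooth_kappa d0.
pose F' y := kappa d (rho y) * F y.
have sF' : rsmooth F' by exact: rsmooth_mul.
exists F'; split.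
  split=> //; exists (1 - expR (- d^-1)); first by rewrite gtrBl expR_gt0.
  by move=> y hy; rewrite /F'; have [|-> _ _] := @kappa_far _ d0 (rho y); rewrite ?mul0r//; lra.
split.
  rewrite /= (_ : (fun p => pull F' p - pull F p) = fun p => (kappa d (rho (polar p)) - 1) * pull F p)//.
  by apply/funext => p; rewrite /pull /F'; ring.
pose a (p : R * R) : R := (kappa d (rho (polar p)) - 1) * lop (pull F) p.
(* The commutator: the operator on kappa F minus kappa times the operator on F. It contains only
   derivatives of kappa, so it is O(delta) and vanishes near the equator. *)
pose r (p : R * R) : R := lop (pull F') p - lop (pull F) p - a p.
have La : hL2 a := hL2_kappa_mul d0 LlF.
have LlF' := hL2_lop_pull sF'.
have Lr : hL2 r by exact: hL2_sub (hL2_sub LlF' LlF) La.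
have rE (p : R * R) : hemi p -> r p =
    4 * ((1 - rho (polar p)) * kappa1 d (rho (polar p))) * pull (euler F) p
    + 4 * rho (polar p) * ((1 - rho (polar p)) ^+ 2 * kappa2 d (rho (polar p))) * pull G p
    + 4 * (1 - rho (polar p)) * ((1 - rho (polar p)) * kappa1 d (rho (polar p))) * pull G p.
  move=> hp; rewrite /r /a !lop_pull_hemi// /pull.
  rewrite (lap_radial_mul (is_derive_kappa d0) (is_derive_kappa1 d0))// (FE (polar p)).
  have -> : sinx p = sin p.1 by []; have := one_sub_rho_polar p; rewrite expr2.
  move: (kappa _ _) (kappa1 _ _) (kappa2 _ _); move: (rho _) (sin _) (lap _ _) (euler _ _) (G _) => *.
  match goal with h : 1 - ?t = ?s * ?s |- _ => have -> : t = 1 - s * s by rewrite -h; ring end.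
  ring.
have r0 (p : R * R) : hemi p -> sin p.1 ^+ 2 <= expR (- d^-1) -> r p = 0.
  move=> hp; rewrite -one_sub_rho_polar => h; rewrite rE//.
  by have [_ e1 e2] := kappa_far d0 h; rewrite e1 e2; ring.
have rK (p : R * R) : hemi p -> `|r p| <= K * d.
  move=> hp; rewrite rE//; have [s0 _ s1 _] := hemi_trig hp.
  have k1 := kappa1_bound d0 (rho (polar p)); have k2 := kappa2_bound d0 (rho (polar p)) d1.
  have g1 : `|pull (euler F) p| <= `|M1| by apply: (le_trans (M1P p hp)); exact: ler_norm.
  have g2 : `|pull G p| <= `|M2| by apply: (le_trans (M2P p hp)); exact: ler_norm.
  have q0 := rho_ge0 (polar p); have q1 := rho_polar_le1 p.
  move: k1 k2 g1 g2 q0 q1; move: (pull (euler F) p) (pull G p) (rho (polar p)) => x y t.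
  move: (_ * kappa1 _ _) (_ * kappa2 _ _) => a1 a2 k1 k2 g1 g2 q0 q1.
  have E0 := expR_gt0 (1 : R).
  have A : `|4 * a1 * x| <= 4 * (expR 1 * (2 * d)) * `|M1|.
    by rewrite !normrM ger0_norm//; apply: ler_pM => //; rewrite ler_wpM2l.
  have B : `|4 * t * a2 * y| <= 4 * (expR 1 * (38 * d)) * `|M2|.
    rewrite !normrM (ger0_norm q0) (@ger0_norm _ 4)//; apply: ler_pM => //.
      by rewrite !mulr_ge0.
    by apply: ler_pM => //; rewrite ?mulr_ge0// -[leRHS]mulr1 ler_wpM2l.
  have C : `|4 * (1 - t) * a1 * y| <= 4 * (expR 1 * (2 * d)) * `|M2|.
    have t1 : 0 <= 1 - t by lra.
    rewrite !normrM (ger0_norm t1) (@ger0_norm _ 4)//; apply: ler_pM => //.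
      by rewrite !mulr_ge0.
    by apply: ler_pM => //; rewrite ?mulr_ge0// -[leRHS]mulr1 ler_wpM2l//; lra.
  apply: (le_trans (ler_normD _ _)); apply: (le_trans (lerD (ler_normD _ _) (lexx _))).
  apply: (le_trans (lerD (lerD A B) C)); rewrite /K.
  by rewrite le_eqVlt; apply/orP; left; apply/eqP; ring.
have := support_bound (expR_gt0 (- d^-1)) (proj1 Lr) rK r0 => hr.
have : hip r r <= eps / 4.
  apply: (le_trans hr); apply: le_trans h3; rewrite expRK opprK.
  have le1 : expR (- d^-1) <= 1 by rewrite -[leRHS]expR0 ler_expR oppr_le0 invr_ge0 ltW.
  (* With - ln eps = 1/d, the squared norm is at most (K d)^2 (2/d) (2 pi) = 4 pi K^2 d, which was
     made at most eps / 4. *)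
  have : ln (1 + expR (- d^-1)) <= d^-1.
    apply: (@le_trans _ _ (expR (- d^-1))); first by apply: le_ln1Dx; apply: lt_trans (ltrN10 _) _; exact: expR_gt0.
    by rewrite (le_trans le1)// invf_ge1.
  move=> hl; rewrite (_ : 4 * pi * K ^+ 2 * d = (K * d) ^+ 2 * (2 * d^-1 * (2 * pi))); last by field; rewrite gt_eqF.
  apply: ler_wpM2l; first exact: sqr_ge0.
  by apply: ler_wpM2r; [rewrite mulr_ge0// pi_ge0|lra].
move=> hr4 /=.
rewrite (_ : (fun p => lop (pull F') p - lop (pull F) p) = (fun p => a p + r p)); last first.
  by apply/funext => p; rewrite /r; ring.
apply: (le_trans (hip_add_sq_le La Lr)); lra.
Qed.

End CutoffApproximation.

(** * The closure on real functions, described by Fourier coefficients *)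

Section RealGraph.
Context {R : realType}.
Implicit Types (F G u v : R * R -> R).

Lemma hip_parseval u : hL2 u ->
  \sum_(i < n) hip u (ebasis i) ^+ 2 @[n --> \oo] --> hip u u.
Proof.
exact: (parseval measurable_hemi measurable_wgt wgt_gt0 (@hL2_ebasis R) (@ebasis_ortho R)
  (@ebasis_complete R)).
Qed.

Lemma hip_expansion u : hL2 u ->
  (let w n p := psum ebasis (fun i => hip u (ebasis i)) n p - u p in
   hip (w n) (w n) @[n --> \oo] --> (0 : R)).
Proof.
exact: (basis_expansion measurable_hemi measurable_wgt wgt_gt0 (@hL2_ebasis R) (@ebasis_ortho R)
  (@ebasis_complete R)).
Qed.

Lemma hL2_psum (c : nat -> R) n : hL2 (psum ebasis c n).
Proof. exact: (wL2_psum measurable_hemi measurable_wgt wgt_gt0 (@hL2_ebasis R)). Qed.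

Lemma hip_cvg0 (a : R^nat) (w : nat -> R * R -> R) : a j @[j --> \oo] --> (0 : R) ->
  (forall j, hip (w j) (w j) <= 2 * j.+1%:R^-1 + 2 * a j) ->
  hip (w j) (w j) @[j --> \oo] --> (0 : R).
Proof.
move=> a0 wa; apply: (@squeeze_cvgr _ _ _ _ (fun=> 0) (fun j => 2 * j.+1%:R^-1 + 2 * a j)).
- by apply: nearW => j; rewrite wa andbT; exact: hip_ge0.
- exact: cvg_cst.
- rewrite -[X in _ --> X](_ : 2 * 0 + 2 * 0 = 0); last by rewrite !mulr0 addr0.
  by apply: cvgD; apply: cvgMr => //; exact: cvg_harmonic.
Qed.

Lemma lap_add F G y : rsmooth F -> rsmooth G ->
  lap (fun z => F z + G z) y = lap F y + lap G y.
Proof.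
move=> sF sG; rewrite /lap !dd_add => [|p|p|p|p|p|p|p|p]; last first.
all: try exact: rsmooth_differentiable.
all: try by apply: rsmooth_differentiable; exact: rsmooth_dd.
ring.
Qed.

Definition nsum (c : nat -> R) n (y : R * R) : R := \sum_(i < n) c i * nfun i y.

Lemma rsmooth_nsum c n : rsmooth (nsum c n).
Proof.
apply: (@rsmooth_sum _ n (fun i y => c i * nfun i y)) => i.
by apply: rsmooth_scale; exact: rsmooth_nfun.
Qed.

Lemma pull_nsum c n : pull (nsum c n) = psum ebasis c n.
Proof. by []. Qed.

(** Every eigenfunction has the factor 1 - rho explicitly; this is the form in which
    [cutoff_approximation] accepts truncated expansions. *)
Lemma nsum_vanishing c n : exists2 G, rsmooth G & forall y, nsum c n y = (1 - rho y) * G y.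
Proof.
pose q i := let: ab := Cantor.of_nat i in
  @radial R (eigpoly (ab.1 - ab.2 + (ab.2 - ab.1)) (minn ab.1 ab.2)) (ab.1 < ab.2)%N
    (ab.1 - ab.2 + (ab.2 - ab.1)).
exists (fun y => \sum_(i < n) c i * (eignorm (Cantor.of_nat i) * q i y)).
  apply: (@rsmooth_sum _ n (fun i y => c i * (eignorm (Cantor.of_nat i) * q i y))) => i.
  do 2!apply: rsmooth_scale; rewrite /q.
  by case: (Cantor.of_nat i) => a b; exact: rsmooth_radial.
move=> y; rewrite mulr_sumr; apply: eq_bigr => i _; rewrite /nfun /pairfun /q.
by case: (Cantor.of_nat i) => a b; rewrite efunE; ring.
Qed.

Lemma lop_nsum c n p : hemi p ->
  lop (pull (nsum c n)) p = - psum ebasis (fun i => eigvaln i * c i) n p.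
Proof.
move=> hp; rewrite lop_pull_hemi//; last exact: rsmooth_nsum.
have L m : sin p.1 * (sinx p * pull (lap (nfun m)) p) = - eigvaln m * ebasis m p.
  by rewrite -lop_ebasis// lop_pull_hemi//; exact: rsmooth_nfun.
elim: n => [|n IH].
  have -> : nsum c 0 = fun=> 0 by apply/funext => y; rewrite /nsum big_ord0.
  by rewrite /pull /lap /psum !(dd_cst, big_ord0) addr0 !mulr0 oppr0.
have -> : nsum c n.+1 = fun y => nsum c n y + c n * nfun n y.
  by apply/funext => y; rewrite /nsum big_ord_recr.
rewrite psumS /pull lap_add; [|exact: rsmooth_nsum|apply: rsmooth_scale; exact: rsmooth_nfun].
rewrite lap_scale; last exact: rsmooth_nfun.
move: IH (L n); rewrite /pull; move: (lap _ _) (lap (nfun n) _) => a b IH Ln.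
have -> : sin p.1 * (sinx p * (a + c n * b)) =
    sin p.1 * (sinx p * a) + c n * (sin p.1 * (sinx p * b)) by ring.
by rewrite IH Ln; ring.
Qed.

Lemma rtest_vanishing F : rtest F -> forall y, rho y = 1 -> F y = 0.
Proof. by move=> [_ [r r1 F0]] y y1; apply: F0; rewrite y1 ltW. Qed.

Lemma hL2_rtest F : rtest F -> hL2 (pull F).
Proof. by move=> [sF [r r1 F0]]; exact: hL2_pull_compact r1 F0. Qed.

(** Green's formula: the test function and the eigenfunction both vanish on the circle, so the
    operator moves onto the eigenfunction. *)
Lemma lop_rtest_coef F n : rtest F ->
  hip (fun p => - lop (pull F) p) (ebasis n) = eigvaln n * hip (pull F) (ebasis n).
Proof.
move=> tF; have [sF _] := tF; have sn := @rsmooth_nfun R n.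
have n0 (y : R * R) : rho y = 1 -> nfun n y = 0.
  by move=> y1; rewrite /nfun /pairfun efun_circle// mulr0.
have LF := hL2_lop_pull sF.
rewrite [LHS](wipNl measurable_hemi measurable_wgt wgt_gt0 LF (hL2_ebasis n)) -/(hip _ _).
rewrite [hip (lop _) _]hipC (green_hemi sn sF n0 (rtest_vanishing tF)) -/(ebasis n) hipC.
rewrite (@hip_ext _ _ (fun p => - eigvaln n * ebasis n p) _ (pull F))//; last exact: lop_ebasis.
by rewrite hipZl ?mulNr ?opprK; [rewrite hipC|exact: hL2_ebasis|exact: hL2_rtest].
Qed.

(** The relation holds for test functions, and both sides are continuous for the two L^2 limits that
    define the closure. *)
Lemma graph_coef u v (F : nat -> R * R -> R) n : hL2 u -> hL2 v -> (forall j, rtest (F j)) ->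
  (let w j p := pull (F j) p - u p in hip (w j) (w j) @[j --> \oo] --> (0 : R)) ->
  (let w j p := - lop (pull (F j)) p - v p in hip (w j) (w j) @[j --> \oo] --> (0 : R)) ->
  hip v (ebasis n) = eigvaln n * hip u (ebasis n).
Proof.
move=> Lu Lv tF /= cu cv.
have c1 := wip_cvg measurable_hemi measurable_wgt wgt_gt0 (fun j => hL2_rtest (tF j)) Lu (hL2_ebasis n) cu.
have LF j : hL2 (fun p => - lop (pull (F j)) p).
  by apply: hL2_opp; exact: hL2_lop_pull (proj1 (tF j)).
have c2 := wip_cvg measurable_hemi measurable_wgt wgt_gt0 LF Lv (hL2_ebasis n) cv.
have c3 : hip (fun p => - lop (pull (F j)) p) (ebasis n) @[j --> \oo] --> eigvaln n * hip u (ebasis n).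
  by under eq_cvg do rewrite lop_rtest_coef//; apply: cvgMr.
exact: cvg_unique c2 c3.
Qed.

(** The partial sums of u have images equal to the partial sums of v, so both expansions converge
    together; each partial sum is then replaced by a test function within 1/(j + 1) in both
    norms. *)
Lemma graph_approximation u v : hL2 u -> hL2 v ->
  (forall n, hip v (ebasis n) = eigvaln n * hip u (ebasis n)) ->
  exists F : nat -> R * R -> R, [/\ forall j, rtest (F j),
    (let w j p := pull (F j) p - u p in hip (w j) (w j) @[j --> \oo] --> (0 : R)) &
    (let w j p := - lop (pull (F j)) p - v p in hip (w j) (w j) @[j --> \oo] --> (0 : R))].
Proof.
move=> Lu Lv uv.
have [F FP] : {F : nat -> R * R -> R & forall j, rtest (F j) /\
  (let w p := pull (F j) p - pull (nsum (fun i => hip u (ebasis i)) j) p in hip w w <= j.+1%:R^-1) /\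
  (let w p := lop (pull (F j)) p - lop (pull (nsum (fun i => hip u (ebasis i)) j)) p in hip w w <= j.+1%:R^-1)}.
  apply: (@choice _ _ (fun j G => rtest G /\
    (let w p := pull G p - pull (nsum (fun i => hip u (ebasis i)) j) p in hip w w <= j.+1%:R^-1) /\
    (let w p := lop (pull G) p - lop (pull (nsum (fun i => hip u (ebasis i)) j)) p in hip w w <= j.+1%:R^-1))).
  move=> j; have [G sG GE] := nsum_vanishing (fun i => hip u (ebasis i)) j.
  by apply: cutoff_approximation sG GE _; rewrite invr_gt0.
exists F; split => [j||]; first by have [] := FP j.
- apply: (hip_cvg0 (hip_expansion Lu)) => j /=; have [tF [/= h _]] := FP j.
  have LF := hL2_rtest tF; have Ln := hL2_psum (fun i => hip u (ebasis i)) j.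
  rewrite (@hip_sq_ext _ _ (fun p => (pull (F j) p - pull (nsum (fun i => hip u (ebasis i)) j) p)
    + (psum ebasis (fun i => hip u (ebasis i)) j p - u p))); last first.
    by move=> p _; rewrite pull_nsum; ring.
  apply: le_trans (hip_add_sq_le (hL2_sub LF Ln) (hL2_sub Ln Lu)) _.
  by rewrite lerD2r ler_wpM2l//; exact: h.
- apply: (hip_cvg0 (hip_expansion Lv)) => j /=; have [tF [_ /= h]] := FP j.
  have LF := hL2_lop_pull (proj1 tF).
  have Lj := hL2_lop_pull (rsmooth_nsum (fun i => hip u (ebasis i)) j).
  have Ln := hL2_psum (fun i => hip v (ebasis i)) j.
  set L := lop (pull (nsum _ j)) in Lj h.
  have E p : hemi p -> psum ebasis (fun i => hip v (ebasis i)) j p = - L p.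
    by move=> hp; rewrite /L lop_nsum// opprK; apply: eq_bigr => i _; rewrite uv.
  rewrite (@hip_sq_ext _ _ (fun p => (- 1) * (lop (pull (F j)) p - L p)
    + (psum ebasis (fun i => hip v (ebasis i)) j p - v p))); last first.
    by move=> p hp; rewrite E//; ring.
  have LD := hL2_sub LF Lj.
  apply: le_trans (hip_add_sq_le (hL2_scale (- 1) LD) (hL2_sub Ln Lv)) _.
  rewrite lerD2r hipZl//; last exact: hL2_scale.
  by rewrite hipZr// [X in 2 * X](_ : _ = hip (fun p => lop (pull (F j)) p - L p)
    (fun p => lop (pull (F j)) p - L p)) ?ler_wpM2l//; ring.
Qed.

End RealGraph.

(** * The complex operator and its spectrum *)

Section ComplexL2.
Context {R : realType}.
Local Notation mR := (measurableTypeR R).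
Local Notation leb := (@lebesgue_measure R).
Local Notation leb2 := (leb \x leb)%E.
Local Notation Re := complex.Re.
Local Notation Im := complex.Im.
Local Open Scope complex_scope.
Implicit Types (u v f : R * R -> R[i]) (z : R[i]).

Lemma ReD z z' : Re (z + z') = Re z + Re z'. Proof. by case: z; case: z'. Qed.
Lemma ImD z z' : Im (z + z') = Im z + Im z'. Proof. by case: z; case: z'. Qed.
Lemma ReN z : Re (- z) = - Re z. Proof. by case: z. Qed.
Lemma ImN z : Im (- z) = - Im z. Proof. by case: z. Qed.
Lemma ReM z z' : Re (z * z') = Re z * Re z' - Im z * Im z'. Proof. by case: z; case: z'. Qed.
Lemma ImM z z' : Im (z * z') = Re z * Im z' + Im z * Re z'. Proof. by case: z; case: z'. Qed.

Definition ReImE := (ReD, ImD, ReN, ImN, ReM, ImM).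

Lemma complex_ext z z' : Re z = Re z' -> Im z = Im z' -> z = z'.
Proof. by case: z => a b; case: z' => c d /= -> ->. Qed.

Definition rep u (p : R * R) : R := Re (u p).
Definition imp u (p : R * R) : R := Im (u p).

Definition cnsq u : R := hip (rep u) (rep u) + hip (imp u) (imp u).

Lemma cnsq_ge0 u : 0 <= cnsq u.
Proof. by rewrite addr_ge0// hip_ge0. Qed.

Lemma omega_integralE u :
  measurable_fun (@hemi R) (rep u : mR * mR -> R) ->
  measurable_fun (@hemi R) (imp u : mR * mR -> R) ->
  omega_integral (fun p => (Re (u p) ^+ 2 + Im (u p) ^+ 2)%:E) =
    (wsq leb2 (@hemi R) wgt (rep u : mR * mR -> R) + wsq leb2 (@hemi R) wgt (imp u : mR * mR -> R))%E.
Proof.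
move=> mr mi; rewrite /omega_integral /wsq -ge0_integralD//.
- by apply: eq_integral => p _; rewrite -EFinM -EFinD mulrDl.
- exact: measurable_hemi.
- by move=> p hp; rewrite lee_fin; apply: mulr_ge0; [exact: sqr_ge0|exact/ltW/wgt_gt0].
- exact: wsq_measurable measurable_wgt _ mr.
- by move=> p hp; rewrite lee_fin; apply: mulr_ge0; [exact: sqr_ge0|exact/ltW/wgt_gt0].
- exact: wsq_measurable measurable_wgt _ mi.
Qed.

Lemma inL2P u : inL2 u <-> hL2 (rep u) /\ hL2 (imp u).
Proof.
have i2 : (2^-1 : R) != 0 by rewrite invr_eq0.
have w0 (f : R * R -> R) : (0 <= wsq leb2 (@hemi R) wgt (f : mR * mR -> R))%E.
  exact: wsq_ge0 wgt_gt0 _.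
split=> [[mr mi n]|[[mr nr] [mi ni]]].
  have := lty_poweRy i2 n; rewrite omega_integralE// => h.
  by split; split => //; apply: le_lt_trans h; [exact: leeDl|exact: leeDr].
by split => //; apply: poweR_lty; rewrite omega_integralE// lte_add_pinfty.
Qed.

Lemma L2normE u : inL2 u -> L2norm u = (Num.sqrt (cnsq u))%:E.
Proof.
move=> iu; have [Lr Li] := (inL2P u).1 iu; have [mr mi _] := iu.
rewrite /L2norm omega_integralE//.
rewrite (wsqE measurable_hemi measurable_wgt wgt_gt0 Lr).
rewrite (wsqE measurable_hemi measurable_wgt wgt_gt0 Li).
by rewrite -EFinD poweR_EFin powR12_sqrt// cnsq_ge0.
Qed.

Lemma L2norm_cvg0 (w : nat -> R * R -> R[i]) : (forall n, inL2 (w n)) ->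
  (L2norm (w n) @[n --> \oo] --> 0%E) <->
  (hip (rep (w n)) (rep (w n)) @[n --> \oo] --> (0 : R)) /\
  (hip (imp (w n)) (imp (w n)) @[n --> \oo] --> (0 : R)).
Proof.
move=> iw; split=> [h|[hr hi]].
  have c : cnsq (w n) @[n --> \oo] --> (0 : R).

    have /fine_cvg h2 : L2norm (w n) @[n --> \oo] --> (0 : R)%:E by [].
    rewrite -[X in _ --> X](mulr0 0).
    apply: cvg_trans (cvgM h2 h2); apply: near_eq_cvg; apply: nearW => n /=.
    by rewrite L2normE//= -expr2 sqr_sqrtr// cnsq_ge0.
  split; apply: (@squeeze_cvgr _ _ _ _ (fun=> 0) (fun n => cnsq (w n))) => //;
    try exact: cvg_cst; apply: nearW => n; rewrite hip_ge0/=.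
  - by rewrite lerDl hip_ge0.
  - by rewrite lerDr hip_ge0.
apply: cvg_trans (_ : (Num.sqrt (cnsq (w n)))%:E @[n --> \oo] --> 0%E).
  by apply: near_eq_cvg; apply: nearW => n; rewrite L2normE.
apply: cvg_EFin; first exact: nearW.
rewrite -[X in _ --> X](@sqrtr0 R); apply: continuous_cvg; first exact: sqrt_continuous.
by rewrite -[X in _ --> X](addr0 0); apply: cvgD.
Qed.

Lemma ddE_fun (v : R * R) (g : R * R -> R) : dd v g = 'D_v g.
Proof. by apply/funext => p; rewrite ddE. Qed.

Lemma Re_grushin_laplacian u : rep (grushin_laplacian u) = lop (rep u).
Proof.
by apply/funext => p; rewrite /rep /lop !ddE_fun /grushin_laplacian !ReImE /= !mul0r !subr0.
Qed.

Lemma Im_grushin_laplacian u : imp (grushin_laplacian u) = lop (imp u).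
Proof.
by apply/funext => p; rewrite /imp /lop !ddE_fun /grushin_laplacian !ReImE /= !mul0r !addr0.
Qed.

Lemma Re_graph_error u v : rep (fun p => - grushin_laplacian u p - v p) =
  fun p => - lop (rep u) p - rep v p.
Proof. by rewrite -Re_grushin_laplacian; apply/funext => p; rewrite /rep ReD !ReN. Qed.

Lemma Im_graph_error u v : imp (fun p => - grushin_laplacian u p - v p) =
  fun p => - lop (imp u) p - imp v p.
Proof. by rewrite -Im_grushin_laplacian; apply/funext => p; rewrite /imp ImD !ImN. Qed.

Lemma test_function_rtest u : test_function u ->
  exists F G, [/\ rtest F, rtest G, rep u = pull F & imp u = pull G].
Proof.
move=> [F [/smoothP[s1 s2] [r r1 F0] uF]].
exists (fun y => Re (F y)), (fun y => Im (F y)); split.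
- by split=> //; exists r => // y ry; rewrite F0.
- by split=> //; exists r => // y ry; rewrite F0.
- by apply/funext => -[x y]; rewrite /rep uF.
- by apply/funext => -[x y]; rewrite /imp uF.
Qed.

Lemma rtest_test_function (F G : R * R -> R) : rtest F -> rtest G ->
  test_function (fun p => pull F p +i* pull G p).
Proof.
move=> [sF [r r1 F0]] [sG [s s1 G0]]; exists (fun y => F y +i* G y); split => //.
- exact/smoothP.
(* Real and imaginary part come with different radii; the larger one serves both. *)
- exists (Num.max r s); first by rewrite gt_max r1 s1.
  by move=> y; rewrite ge_max => /andP[ry sy]; rewrite F0// G0.
Qed.

Definition ccoef u n : R[i] := hip (rep u) (ebasis n) +i* hip (imp u) (ebasis n).

Lemma inL2_parts u (f g : R * R -> R) : (forall p, u p = f p +i* g p) -> hL2 f -> hL2 g -> inL2 u.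
Proof.
move=> uE Lf Lg; apply/inL2P.
by split; [apply: hL2_ext Lf|apply: hL2_ext Lg] => p _; rewrite /rep /imp uE.
Qed.

(** The closure is the maximal diagonal operator in the basis. Both directions reduce to the real
    graph, as the operator acts separately on real and imaginary parts. *)
Lemma minus_DeltaP u v : minus_Delta u v <->
  [/\ inL2 u, inL2 v & forall n, ccoef v n = (eigvaln n)%:C * ccoef u n].
Proof.
split=> [[iu iv [w [tw cu cv]]]|[iu iv E]].
  have [Lu1 Lu2] := (inL2P u).1 iu; have [Lv1 Lv2] := (inL2P v).1 iv.
  split => // n.
  have [FG FGP] := choice (fun j => test_function_rtest (tw j)).
  have [H HP] := choice FGP.
  have iw1 j : inL2 (fun p => w j p - u p).
    have [tF tG E1 E2] := HP j.
    apply: (@inL2_parts _ (fun p => pull (FG j) p - rep u p) (fun p => pull (H j) p - imp u p)).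
    - by move=> p; rewrite -E1 -E2; apply: complex_ext; rewrite !ReImE.
    - by apply: hL2_sub => //; exact: hL2_rtest.
    - by apply: hL2_sub => //; exact: hL2_rtest.
  have iw2 j : inL2 (fun p => - grushin_laplacian (w j) p - v p).
    have [tF tG E1 E2] := HP j.
    apply/inL2P; rewrite Re_graph_error Im_graph_error E1 E2; split.
    - by apply: hL2_sub => //; apply: hL2_opp; exact: hL2_lop_pull (proj1 tF).
    - by apply: hL2_sub => //; apply: hL2_opp; exact: hL2_lop_pull (proj1 tG).
  have [c1 c2] := (L2norm_cvg0 iw1).1 cu; have [c3 c4] := (L2norm_cvg0 iw2).1 cv.
  apply: complex_ext; rewrite !ReImE /= mul0r ?subr0 ?addr0.
  - apply: (@graph_coef _ (rep u) (rep v) FG n Lu1 Lv1); first by move=> j; have [] := HP j.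
      apply: cvg_trans c1; apply: near_eq_cvg; apply: nearW => j /=; have [_ _ E1 _] := HP j.
      by congr hip; apply/funext => p; rewrite -E1 /rep !ReImE.
    apply: cvg_trans c3; apply: near_eq_cvg; apply: nearW => j /=; have [_ _ E1 _] := HP j.
    by rewrite Re_graph_error E1.
  - apply: (@graph_coef _ (imp u) (imp v) H n Lu2 Lv2); first by move=> j; have [] := HP j.
      apply: cvg_trans c2; apply: near_eq_cvg; apply: nearW => j /=; have [_ _ _ E1] := HP j.
      by congr hip; apply/funext => p; rewrite -E1 /imp !ReImE.
    apply: cvg_trans c4; apply: near_eq_cvg; apply: nearW => j /=; have [_ _ _ E1] := HP j.
    by rewrite Im_graph_error E1.
have [Lu1 Lu2] := (inL2P u).1 iu; have [Lv1 Lv2] := (inL2P v).1 iv.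
have [F [tF F1 F2]] : exists F : nat -> R * R -> R, [/\ forall j, rtest (F j),
    (let w j p := pull (F j) p - rep u p in hip (w j) (w j) @[j --> \oo] --> (0 : R)) &
    (let w j p := - lop (pull (F j)) p - rep v p in hip (w j) (w j) @[j --> \oo] --> (0 : R))].
  apply: graph_approximation => // n.
  by have := congr1 (@complex.Re R) (E n); rewrite ReM /= mul0r subr0.
have [G [tG G1 G2]] : exists F : nat -> R * R -> R, [/\ forall j, rtest (F j),
    (let w j p := pull (F j) p - imp u p in hip (w j) (w j) @[j --> \oo] --> (0 : R)) &
    (let w j p := - lop (pull (F j)) p - imp v p in hip (w j) (w j) @[j --> \oo] --> (0 : R))].
  apply: graph_approximation => // n.
  by have := congr1 (@complex.Im R) (E n); rewrite ImM /= mul0r addr0.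
split=> //; exists (fun j p => pull (F j) p +i* pull (G j) p); split.
- by move=> j; exact: rtest_test_function.
- apply/L2norm_cvg0.
    move=> j; apply: (@inL2_parts _ (fun p => pull (F j) p - rep u p) (fun p => pull (G j) p - imp u p)).
    + by move=> p; apply: complex_ext; rewrite !ReImE.
    + by apply: hL2_sub => //; exact: hL2_rtest.
    + by apply: hL2_sub => //; exact: hL2_rtest.
  split; [apply: cvg_trans F1|apply: cvg_trans G1]; apply: near_eq_cvg; apply: nearW => j /=;
    by congr hip; apply/funext => p; rewrite /rep /imp !ReImE.
- have Er j : rep (fun p => - grushin_laplacian (fun p => pull (F j) p +i* pull (G j) p) p - v p) =
      fun p => - lop (pull (F j)) p - rep v p by exact: Re_graph_error.
  have Ei j : imp (fun p => - grushin_laplacian (fun p => pull (F j) p +i* pull (G j) p) p - v p) =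
      fun p => - lop (pull (G j)) p - imp v p by exact: Im_graph_error.
  apply/L2norm_cvg0.
    move=> j; apply/inL2P; rewrite Er Ei.
    by split; apply: hL2_sub => //; apply: hL2_opp; apply: hL2_lop_pull; [exact: (proj1 (tF j))|exact: (proj1 (tG j))].
  by under eq_cvg do rewrite Er; split => //; under eq_cvg do rewrite Ei.
Qed.

End ComplexL2.

(** * Spectrum of the diagonal operator *)

Section Resolvent.
Context {R : realType}.
Local Notation Re := complex.Re.
Local Notation Im := complex.Im.
Local Open Scope complex_scope.
Implicit Types (u v f : R * R -> R[i]) (z : R[i]).

Definition sqn z : R := Re z ^+ 2 + Im z ^+ 2.

Lemma sqn_ge0 z : 0 <= sqn z. Proof. by rewrite addr_ge0// sqr_ge0. Qed.

Lemma sqnM z z' : sqn (z * z') = sqn z * sqn z'.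
Proof. rewrite /sqn !ReImE; ring. Qed.

Lemma sqn_eq0 z : sqn z = 0 -> z = 0.
Proof.
move=> /eqP; rewrite paddr_eq0 ?sqr_ge0// !sqrf_eq0 => /andP[/eqP a /eqP b].
exact: complex_ext.
Qed.

Lemma ccoef_lin z u f : inL2 u -> inL2 f ->
  inL2 (fun p => z * u p + f p) /\
  forall n, ccoef (fun p => z * u p + f p) n = z * ccoef u n + ccoef f n.
Proof.
move=> /inL2P[u1 u2] /inL2P[f1 f2].
have s1 := hL2_scale (Re z) u1; have s2 := hL2_scale (Im z) u2.
have s3 := hL2_scale (Re z) u2; have s4 := hL2_scale (Im z) u1.
have Er : rep (fun p => z * u p + f p) =
    fun p => (Re z * rep u p - Im z * imp u p) + rep f p.
  by apply/funext => p; rewrite /rep /imp !ReImE.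
have Ei : imp (fun p => z * u p + f p) =
    fun p => (Re z * imp u p + Im z * rep u p) + imp f p.
  by apply/funext => p; rewrite /rep /imp !ReImE.
have L1 := hL2_sub s1 s2; have L2 := hL2_add s3 s4.
split; first by apply/inL2P; rewrite Er Ei; split; exact: hL2_add.
move=> n; have Le := @hL2_ebasis R n.
rewrite /ccoef Er Ei (hipDl L1 f1 Le) (hipDl L2 f2 Le) (hipBl s1 s2 Le) (hipDl s3 s4 Le).
by rewrite !hipZl//; apply: complex_ext; rewrite !ReImE.
Qed.

Lemma hL2_0 : hL2 (fun=> 0 : R).
Proof. by have := hL2_scale 0 (@hL2_ebasis R 0); under eq_fun do rewrite mul0r. Qed.

Lemma hip0l (g : R * R -> R) : hL2 g -> hip (fun=> 0 : R) g = 0.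
Proof.
move=> Lg; rewrite -[RHS](mul0r (hip (fun=> 0) g)) -(hipZl 0 hL2_0 Lg).
by apply: hip_ext => // p _; rewrite mul0r.
Qed.

Lemma inL20 : inL2 (fun=> 0 : R[i]).
Proof. by apply/inL2P; split; exact: hL2_0. Qed.

Lemma ccoef0 n : ccoef (fun=> 0 : R[i]) n = 0.
Proof. by have h := hip0l (@hL2_ebasis R n); apply: complex_ext. Qed.

Lemma ccoef_sum m (c : 'I_m -> R[i]) (e : 'I_m -> R * R -> R[i]) : (forall i, inL2 (e i)) ->
  inL2 (fun p => \sum_(i < m) c i * e i p) /\
  forall n, ccoef (fun p => \sum_(i < m) c i * e i p) n = \sum_(i < m) c i * ccoef (e i) n.
Proof.
elim: m c e => [|m IH] c e ie.
  have -> : (fun p => \sum_(i < 0) c i * e i p) = fun=> 0 by apply/funext => p; rewrite big_ord0.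
  by split=> [|n]; [exact: inL20|rewrite big_ord0 ccoef0].
have [I1 I2] := IH (c \o lift ord0) (e \o lift ord0) (fun i => ie _).
have [J1 J2] := ccoef_lin (c ord0) (ie ord0) I1.
have -> : (fun p => \sum_(i < m.+1) c i * e i p) = fun p => c ord0 * e ord0 p +
    \sum_(i < m) (c \o lift ord0) i * (e \o lift ord0) i p.
  by apply/funext => p; rewrite big_ord_recl.
by split=> [//|n]; rewrite J2 I2 big_ord_recl.
Qed.

Lemma cparseval u : inL2 u -> \sum_(i < n) sqn (ccoef u i) @[n --> \oo] --> cnsq u.
Proof.
move=> /inL2P[u1 u2]; apply: cvg_trans (cvgD (hip_parseval u1) (hip_parseval u2)).
by apply: near_eq_cvg; apply: nearW => n /=; rewrite big_split.
Qed.

Lemma cbessel u n : inL2 u -> \sum_(i < n) sqn (ccoef u i) <= cnsq u.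
Proof.
move=> iu; have c := cparseval iu; rewrite -(cvg_lim (@Rhausdorff R) c).
apply: nondecreasing_cvgn_le; last by apply/cvg_ex; eexists; exact: c.
by apply/nondecreasing_seqP => k; rewrite big_ord_recr/= lerDl sqn_ge0.
Qed.

Lemma cnsq_le u v (K : R) : inL2 u -> inL2 v ->
  (forall n, sqn (ccoef u n) <= K * sqn (ccoef v n)) -> cnsq u <= K * cnsq v.
Proof.
move=> iu iv h.
have c : K * (\sum_(i < n) sqn (ccoef v i)) @[n --> \oo] --> K * cnsq v.
  by apply: cvgMl_tmp; exact: cparseval.
apply: (ler_cvg_to (cparseval iu) c).
by apply: nearW => n; rewrite mulr_sumr; apply: ler_sum.
Qed.

Lemma cnsq_eq0 u : inL2 u -> (forall n, ccoef u n = 0) -> cnsq u = 0.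
Proof.
move=> iu h; apply/eqP; rewrite eq_le cnsq_ge0 andbT -(mul0r (cnsq u)).
by apply: cnsq_le => // n; rewrite h /sqn /= expr0n /= addr0 mul0r.
Qed.

Lemma ccoef_eq0 u n : inL2 u -> cnsq u = 0 -> ccoef u n = 0.
Proof.
move=> iu u0; apply: sqn_eq0; apply/eqP; rewrite eq_le sqn_ge0 andbT.
have := cbessel n.+1 iu; rewrite u0 big_ord_recr/=; apply: le_trans.
by rewrite lerDr; apply: sumr_ge0 => i _; exact: sqn_ge0.
Qed.

Lemma csynthesis (c : nat -> R[i]) (M : R) : (forall n, \sum_(i < n) sqn (c i) <= M) ->
  exists2 u, inL2 u & forall n, ccoef u n = c n.
Proof.
move=> cM.
have [f Lf fE] : exists2 f : R * R -> R, hL2 f & forall n, hip f (ebasis n) = Re (c n).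
  apply: (basis_synthesis measurable_hemi measurable_wgt wgt_gt0 (@hL2_ebasis R)
    (@ebasis_ortho R) (c := fun n => Re (c n)) (M := M)).
  by move=> n; apply: le_trans (cM n); apply: ler_sum => i _; rewrite lerDl sqr_ge0.
have [g Lg gE] : exists2 f : R * R -> R, hL2 f & forall n, hip f (ebasis n) = Im (c n).
  apply: (basis_synthesis measurable_hemi measurable_wgt wgt_gt0 (@hL2_ebasis R)
    (@ebasis_ortho R) (c := fun n => Im (c n)) (M := M)).
  by move=> n; apply: le_trans (cM n); apply: ler_sum => i _; rewrite lerDr sqr_ge0.
exists (fun p => f p +i* g p); first by apply/inL2P.
by move=> n; apply: complex_ext => /=; [exact: fE|exact: gE].
Qed.

Lemma L2norm_eq0 u : inL2 u -> (L2norm u = 0%E) <-> cnsq u = 0.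
Proof.
move=> iu; rewrite L2normE//; split=> [[/eqP]|->]; last by rewrite sqrtr0.
by rewrite sqrtr_eq0 => h; apply/eqP; rewrite eq_le h cnsq_ge0.
Qed.

(** Divide the coefficients by the eigenvalue minus z: the lower bound keeps them square-summable.
    It concerns squared moduli, hence the resolvent constant sqrt (1/delta). *)
Lemma resolvent_setP z (delta : R) : 0 < delta ->
  (forall n, delta <= sqn ((eigvaln n)%:C - z)) -> resolvent_set minus_Delta z.
Proof.
move=> d0 dz.
have nz n : (eigvaln n)%:C - z != 0.
  apply/eqP => h; have := dz n; rewrite h /sqn /= expr0n /= addr0.
  by rewrite leNgt d0.
split=> [f iF|].
  have [|u iu uE] := @csynthesis (fun n => ccoef f n / ((eigvaln n)%:C - z)) (delta^-1 * cnsq f).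
    move=> n; apply: le_trans (_ : delta^-1 * \sum_(i < n) sqn (ccoef f i) <= _); last first.
      by rewrite ler_wpM2l ?invr_ge0 ?(ltW d0)//; exact: cbessel.
    rewrite mulr_sumr; apply: ler_sum => i _; rewrite ler_pdivlMl//.
    rewrite -{2}(divfK (nz i) (ccoef f i)) [leRHS]sqnM mulrC.
    by rewrite ler_wpM2l ?sqn_ge0.
  exists u; apply/minus_DeltaP; have [i1 i2] := ccoef_lin z iu iF.
  split => // n; rewrite i2 uE; move: (nz n); move: (_%:C) (ccoef f n) => l c h.
  by field.
exists (Num.sqrt delta^-1) => u v /minus_DeltaP[iu iv E].
have E2 : (fun p => v p - z * u p) = fun p => (- z) * u p + v p.
  by apply/funext => p; rewrite mulNr addrC.
have [i1 i2] := ccoef_lin (- z) iu iv.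
rewrite E2 !L2normE// -EFinM lee_fin -sqrtrM ?invr_ge0 ?(ltW d0)//.
apply: ler_wsqrtr; apply: cnsq_le => // n.
rewrite i2 E mulNr addrC -mulrBl sqnM ler_pdivlMl// ler_wpM2r ?sqn_ge0//.
Qed.

Definition cbasis n (p : R * R) : R[i] := (ebasis n p)%:C.

Lemma inL2_cbasis n : inL2 (cbasis n).
Proof.
apply/inL2P; split; first exact: hL2_ebasis.
exact: hL2_0.
Qed.

Lemma ccoef_cbasis m n : ccoef (cbasis m) n = (m == n)%:R.
Proof.
have h := hip0l (@hL2_ebasis R n).
by apply: complex_ext; rewrite /= ?ebasis_ortho ?h; case: (m == n).
Qed.

Lemma minus_Delta_eigen z u : minus_Delta u (fun p => z * u p) <->
  inL2 u /\ forall n, (eigvaln n)%:C != z -> ccoef u n = 0.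
Proof.
have E iu := @ccoef_lin z u (fun=> 0) iu inL20.
have zE : (fun p => z * u p) = fun p => z * u p + 0 by apply/funext => p; rewrite addr0.
rewrite zE; split=> [/minus_DeltaP[iu _ h]|[iu h]].
  split => // n nz; have := h n; rewrite (E iu).2 ccoef0 addr0 => /eqP.
  by rewrite -subr_eq0 -mulrBl mulf_eq0 subr_eq0 eq_sym (negPf nz)/= => /eqP.
apply/minus_DeltaP; split => //; first exact: (E iu).1.
move=> n; rewrite (E iu).2 ccoef0 addr0.
by have [->//|nz] := eqVneq (eigvaln n)%:C z; rewrite h// !mulr0.
Qed.

(** A resolvent estimate applied to an eigenvector would bound its norm by C times 0. *)
Lemma spectrum_eigvaln n : spectrum (@minus_Delta R) (eigvaln n)%:C.
Proof.
move=> [_ [C]] /(_ (cbasis n) (fun p => (eigvaln n)%:C * cbasis n p)) H.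
have ib := inL2_cbasis n.
have : minus_Delta (cbasis n) (fun p => (eigvaln n)%:C * cbasis n p).
  apply/minus_Delta_eigen; split => // m mn; rewrite ccoef_cbasis.
  by have [E|//] := eqVneq n m; rewrite E eqxx in mn.
move=> /H; rewrite (_ : (fun p => _ - _) = fun=> 0); last by apply/funext => p; rewrite subrr.
have -> : L2norm (fun=> 0 : R[i]) = 0%E.
  apply/(L2norm_eq0 inL20).
  by apply: cnsq_eq0 => [|k]; [exact: inL20|exact: ccoef0].
rewrite mule0 L2normE// lee_fin => h.
have h0 : cnsq (cbasis n) = 0.
  by apply/eqP; rewrite eq_le cnsq_ge0 andbT -sqrtr_eq0 eq_le h sqrtr_ge0.
have := ccoef_eq0 n ib h0; rewrite ccoef_cbasis eqxx => /eqP.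
by rewrite oner_eq0.
Qed.

End Resolvent.

(** * Multiplicities and reduction to the divisor sum *)

Section Counting.
Context {R : realType}.
Local Notation Re := complex.Re.
Local Notation Im := complex.Im.
Local Open Scope complex_scope.
Implicit Types (u v f : R * R -> R[i]) (z : R[i]) (k K : nat).

Definition level n : nat := ((Cantor.of_nat n).1.+1 * (Cantor.of_nat n).2.+1)%N.

Definition clevel k : R[i] := (4 * k%:R)%:C.

Lemma eigvaln_level n : (eigvaln n)%:C = clevel (level n).
Proof. by rewrite /clevel /level /eigvaln /pairval natrM. Qed.

Lemma clevel_inj : injective clevel.
Proof.
by move=> k l [] /(mulfI _) h; apply/eqP; rewrite -(eqr_nat R); apply/eqP/h; rewrite pnatr_eq0.
Qed.

Lemma level_gt0 n : (0 < level n)%N.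
Proof. by rewrite muln_gt0. Qed.

Lemma level_surj k : (0 < k)%N -> exists n, level n = k.
Proof.
move=> k0; exists (Cantor.to_nat (k.-1, 0%N)).
by rewrite /level Cantor.cancel_of_to /= prednK// muln1.
Qed.

(** The levels are isolated: a point that is none of them keeps a positive distance from all,
    through its imaginary part, or by lying below 4, or between two consecutive multiples of 4. *)
Lemma spectrumP z : spectrum (@minus_Delta R) z <-> exists2 k, (0 < k)%N & z = clevel k.
Proof.
split=> [sz|[k k0 ->]]; last first.
  by have [n <-] := level_surj k0; rewrite -eigvaln_level; exact: spectrum_eigvaln.
apply: contrapT => nk; apply: sz.
suff [d d0 dz] : exists2 d : R, 0 < d & forall k, (0 < k)%N -> d <= sqn (clevel k - z).
  by apply: (resolvent_setP d0) => n; rewrite eigvaln_level; exact/dz/level_gt0.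
have sE k : sqn (clevel k - z) = (4 * k%:R - Re z) ^+ 2 + Im z ^+ 2.
  by rewrite /sqn !ReImE /= sub0r sqrrN.
have [i0|i0] := eqVneq (Im z) 0; last first.
  exists (Im z ^+ 2); first by rewrite exprn_even_gt0.
  by move=> k _; rewrite sE lerDr sqr_ge0.
set a := Re z in sE.
have na k : (0 < k)%N -> a != 4 * k%:R.
  move=> k0; apply/eqP => aE; apply: nk; exists k => //.
  exact: complex_ext.
have [a4|a4] := ltP a 4.
  exists ((4 - a) ^+ 2); first by rewrite exprn_gt0// subr_gt0.
  move=> k k0; rewrite sE i0 expr0n/= addr0.
  have k1 : 1 <= k%:R :> R by rewrite ler1n.
  by nra.
pose l := Num.truncn (a / 4).
have a0 : 0 <= a / 4 by lra.
have := truncn_itv a0; rewrite -/l => /andP[l1 l2].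
have l0 : (0 < l)%N by rewrite -ltnS -(ltr_nat R); apply: le_lt_trans l2; lra.
have d1 : 0 < a - 4 * l%:R by rewrite subr_gt0 lt_neqAle eq_sym na//=; lra.
have d2 : 0 < 4 * l.+1%:R - a by lra.
pose t := Num.min (a - 4 * l%:R) (4 * l.+1%:R - a).
have t0 : 0 < t by rewrite lt_min d1.
have t1 : t <= a - 4 * l%:R by rewrite ge_min lexx.
have t2 : t <= 4 * l.+1%:R - a by rewrite ge_min lexx orbT.
exists (t ^+ 2); first by rewrite exprn_gt0.
move=> k k0; rewrite sE i0 expr0n/= addr0.
have [|] := leqP k l; rewrite -(ler_nat R) => kl; nra.
Qed.

Definition factpairs K k : {set 'I_K * 'I_K} := [set p : 'I_K * 'I_K | (p.1.+1 * p.2.+1)%N == k]%SET.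

(** The basis indices of level k are enumerated by the factorizations of k. The bound K may exceed
    k, so that all levels up to K are counted inside one and the same square. *)
Lemma multiplicityE K k : (0 < k <= K)%N ->
  multiplicity (@minus_Delta R) (clevel k) = (#|factpairs K k|%:R)%:E.
Proof.
move=> /andP[k0 kK]; set A := factpairs K k; set d := #|A|.
pose s (j : 'I_d) := Cantor.to_nat (val (enum_val j).1, val (enum_val j).2).
have sk j : level (s j) = k.
  by rewrite /level /s Cantor.cancel_of_to /=; have := enum_valP j; rewrite inE => /eqP.
have s_inj : injective s.
  move=> i j /(congr1 Cantor.of_nat); rewrite !Cantor.cancel_of_to => -[e1 e2].
  by apply: enum_val_inj; case: (enum_val i) (enum_val j) e1 e2 => [a b] [a' b'] /= /val_inj -> /val_inj ->.
have s_surj n : level n = k -> exists j, s j = n.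
  move=> nk; set ab := Cantor.of_nat n.
  have ak : (ab.1 < K)%N by apply: leq_trans kK; rewrite -nk leq_pmulr.
  have bk : (ab.2 < K)%N by apply: leq_trans kK; rewrite -nk leq_pmull.
  have pA : (Ordinal ak, Ordinal bk) \in A by rewrite inE /=; apply/eqP.
  exists (enum_rank_in pA (Ordinal ak, Ordinal bk)); rewrite /s enum_rankK_in//.
  by rewrite -[LHS]/(Cantor.to_nat (ab.1, ab.2)) -surjective_pairing Cantor.cancel_to_of.
have eig u : eigenspace_of (@minus_Delta R) (clevel k) u <->
    inL2 u /\ forall n, level n != k -> ccoef u n = 0.
  rewrite /eigenspace_of /=; apply: (iff_trans (minus_Delta_eigen _ _)).
  split=> -[iu h]; split => // n nk; apply: h.
    by rewrite eigvaln_level (inj_eq clevel_inj).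
  by move: nk; rewrite eigvaln_level (inj_eq clevel_inj).
apply/eqP; rewrite eq_le; apply/andP; split.
  apply/ereal_supP => _ [n [e [eA indep]] <-]; rewrite lee_fin ler_nat leqNgt; apply/negP => dn.
  (* More vectors than indices: a nonzero row in the kernel of the coefficient matrix gives a
     combination whose coefficients all vanish, hence null, against independence. *)
  pose M : 'M[R[i]]_(n, d) := \matrix_(i, j) ccoef (e i) (s j).
  have : kermx M != 0.
    by rewrite kermx_eq0 -row_leq_rank -ltnNge (leq_ltn_trans (rank_leq_col M)).
  move=> /rowV0Pn[v /sub_kermxP vM v0].
  have ie i : inL2 (e i) by have [] := (eig _).1 (eA i).
  have [iu uE] := ccoef_sum (v 0) ie.
  have u0 : cnsq (fun p => \sum_(i < n) v 0 i * e i p) = 0.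
    apply: cnsq_eq0 => // m; rewrite uE.
    have [mk|mk] := eqVneq (level m) k; last first.
      by rewrite big1// => i _; rewrite ((eig _).1 (eA i)).2// mulr0.
    have [j <-] := s_surj m mk.
    transitivity ((v *m M) 0 j); last by rewrite vM mxE.
    by rewrite mxE; apply: eq_bigr => i _; rewrite mxE.
  have := indep (v 0) ((L2norm_eq0 iu).2 u0) => vi.
  by case/eqP: v0; apply/rowP => i; rewrite vi mxE.
apply: ereal_sup_ubound; exists d => //; exists (fun j => cbasis (s j)); split=> [j|c].
  apply/eig; split; first exact: inL2_cbasis.
  move=> n nk; rewrite ccoef_cbasis; have [E|//] := eqVneq (s j) n.
  by rewrite -E sk eqxx in nk.
have [iu uE] := ccoef_sum c (fun j => inL2_cbasis (s j)).
move=> /(L2norm_eq0 iu).1 u0 i.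
have := ccoef_eq0 (s i) iu u0; rewrite uE (bigD1 i)//= ccoef_cbasis eqxx mulr1 big1 ?addr0// => j ji.
by rewrite ccoef_cbasis (inj_eq s_inj) (negPf ji) mulr0.
Qed.

Lemma multiplicity_gt0 k : (0 < k)%N -> (0 < multiplicity (@minus_Delta R) (clevel k) < +oo)%E.
Proof.
move=> k0; rewrite (@multiplicityE k k) ?k0 ?leqnn// ltry lte_fin ltr0n andbT card_gt0.
case: k k0 => // k _; apply/set0Pn; exists (ord_max, ord0).
by rewrite inE /= muln1.
Qed.

Lemma discrete_spectrumP z : discrete_spectrum (@minus_Delta R) z <->
  exists2 k, (0 < k)%N & z = clevel k.
Proof.
(* Consecutive levels are 4 apart, which gives the isolation radius. *)
split=> [[/spectrumP]//|[k k0 ->]]; split; [|exists 4 => //|exact: multiplicity_gt0].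
  by apply/spectrumP; exists k.
move=> _ /spectrumP[l l0 ->] h; congr clevel; apply/eqP; rewrite -(eqr_nat R).
move: h; rewrite /clevel -rmorphB/= normc_def /= expr0n/= addr0 sqrtr_sqr ltcR.
rewrite -mulrBr normrM ger0_norm// gtr_pMr// => h.
move: h; have [kl|kl|->] := ltngtP l k; rewrite ?eqxx//.
  rewrite distrC ger0_norm ?subr_ge0 ?ler_nat ?(ltnW kl)// -natrB ?(ltnW kl)// ltrn1 => h.
  by exfalso; lia.
rewrite ger0_norm ?subr_ge0 ?ler_nat ?(ltnW kl)// -natrB ?(ltnW kl)// ltrn1 => h.
by exfalso; lia.
Qed.

Lemma eigenvalue_countingE (E : R) : 0 <= E ->
  eigenvalue_counting (@minus_Delta R) E = ((divisor_sum (Num.truncn (E / 4)))%:R)%:E.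
Proof.
move=> E0; set K := Num.truncn (E / 4); have E4 : 0 <= E / 4 by rewrite divr_ge0.
have /andP[K1 K2] := truncn_itv E4; rewrite -/K in K1 K2.
rewrite /eigenvalue_counting.
have -> : discrete_spectrum (@minus_Delta R) `&` [set z | (z <= E%:C)%R] =
    [set clevel i.+1 | i in `I_K].
  apply/seteqP; split=> [z [/discrete_spectrumP[k k0 ->]] /=|z [i iK <-]].
    rewrite lecR => kE; exists k.-1; last by rewrite prednK.
    rewrite /= prednK// -ltnS -(ltr_nat R); apply: le_lt_trans K2.
    by rewrite ler_pdivlMr// mulrC.
  split; first by apply/discrete_spectrumP; exists i.+1.
  rewrite /= lecR; apply: le_trans (_ : 4 * K%:R <= _); first by rewrite ler_wpM2l// ler_nat.
  by rewrite mulrC -ler_pdivlMr.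
rewrite esum_fset; first last.
- by move=> z; rewrite inE => -[i iK <-]; have /andP[/ltW] := multiplicity_gt0 (ltn0Sn i).
- exact/finite_image/finite_II.
rewrite fsbig_image; last by move=> i j _ _ /clevel_inj [].
rewrite -(fsbig_ord _ _ (fun i => multiplicity (@minus_Delta R) (clevel i.+1))).
under eq_bigr => i _ do rewrite (@multiplicityE K i.+1) ?ltn_ord//.
rewrite sumEFin -natr_sum; congr ((_)%:R)%:E.
rewrite /divisor_sum pair_big /=.
(* Exchanging the sums, each pair is counted once, at the level equal to its product, if that
   product is at most K. *)
transitivity (\sum_(i < K) \sum_(p : 'I_K * 'I_K) ((p.1.+1 * p.2.+1)%N == i.+1 : nat))%N.
  apply: eq_bigr => i _; rewrite -sum1_card big_mkcond; apply: eq_bigr => p _.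
  by rewrite inE; case: eqP.
rewrite exchange_big; apply: eq_bigr => -[a b] _ /=; set m := (_ * _)%N.
have m0 : (0 < m)%N by rewrite muln_gt0.
move: m m0 => m m0.
have [mK|mK] := leqP m K.
  have mK' : (m.-1 < K)%N by rewrite prednK.
  rewrite (bigD1 (Ordinal mK'))//= prednK// eqxx big1 ?addn0// => i im.
  by apply/eqP; rewrite eqb0; apply: contra im => /eqP mi; apply/eqP/val_inj; rewrite /= mi.
rewrite big1// => i _; apply/eqP; rewrite eqb0; apply/eqP => mi.
by have := ltn_ord i; rewrite -ltnS -mi ltnS; lia.
Qed.

End Counting.

Theorem corollary2p4 (R : realType) :
  exists C : R, \forall E \near +oo,
    (`| eigenvalue_counting (@minus_Delta R) E
        - (E / 4 * ln E + (euler_mascheroni R - ln 2 - 1 / 2) * (E / 2))%:E |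
     <= (C * Num.sqrt E)%:E)%E.
Proof.
exists 7; near=> E.
(* The divisor estimate is used at x = E / 4 and asks x >= 1. *)
have E4 : 4 <= E by near: E; apply: nbhs_pinfty_ge; rewrite num_real.
have E0 : 0 <= E by lra.
rewrite eigenvalue_countingE// -EFinB abse_EFin lee_fin.
set K := Num.truncn (E / 4).
have := truncn_itv (divr_ge0 E0 (ler0n R 4)); rewrite -/K => KE.
have E1 : 1 <= E / 4 by lra.
have sE : Num.sqrt (E / 4) = Num.sqrt E / 2.
  rewrite sqrtrM// sqrtrV// (_ : 4 = 2 ^+ 2 :> R) ?sqrtr_sqr ?ger0_norm//.
  by rewrite -natrX.
have l4 : ln (4 : R) = 2 * ln 2.
  by rewrite (_ : 4 = 2 ^+ 2 :> R) ?lnXn// -?natrX// mulr_natl.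
have lE : ln (E / 4) = ln E - 2 * ln 2 by rewrite ln_div ?posrE// ?l4//; lra.
have := divisor_sum_asymptotics E1 KE; rewrite sE lE.
move: (divisor_sum K)%:R (ln E) (Num.sqrt E) (euler_mascheroni R) (ln 2) => D L s g l.
(* The constant 7 is 14 halved by sqrt (E / 4) = sqrt E / 2; the - ln 2 of the second term comes
   from ln (E / 4) = ln E - 2 ln 2. *)
rewrite (_ : 14 * (s / 2) = 7 * s); last by field.
rewrite (_ : E / 4 * (L - 2 * l) + (2 * g - 1) * (E / 4) = E / 4 * L + (g - l - 1 / 2) * (E / 2))//.
by field.
Unshelve. all: by end_near.
Qed.
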